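(* Let $\mathcal A$ be a reactive labelled stochastic timed automaton, and $\mathcal M$ a deterministic Muller automaton over the same atomic propositions. Then: 1. we can decide whether $\mathcal A$ satisfies $\mathcal M$ almost-surely; 2. for every initial distribution $\mu$ which is numerically amenable w.r.t. $\mathcal A$, we can compute arbitrary approximations of $\mathrm{Prob}^{\mathcal T_{\mathcal A}}_\mu(\mathcal M)$.
   Context: Stochastic timed automaton (STA): $\mathcal A=(L,\ell_0,X,E,(\mu_\gamma)_\gamma,(w_e)_{e\in E})$ with $L$ a finite set of locations, $\ell_0\in L$ the initial location, $X$ a finite set of clocks, $E\subseteq L\times G(X)\times2^X\times L$ a finite set of edges, where $G(X)$ is the set of guards (finite conjunctions of $x\bowtie c$, $x\in X$, $\bowtie\in\{<,\le,=,\ge,>\}$, $c\in\mathbb N$), weights $w_e$ positive integers, and for each configuration $\gamma=(\ell,\nu)\in L\times\mathbb R_{\ge0}^X$ a probability distribution $\mu_\gamma$ on delays with support $I(\gamma)=\{d\ge0\mid\exists e=(\ell,g,Y,\ell')\in E,\ \nu+d\models g\}$. It is assumed that if $I(\gamma)$ has positive Lebesgue measure then $\mu_\gamma$ has the same null sets as Lebesgue measure restricted to $I(\gamma)$, and otherwise $\mu_\gamma$ is uniform on the points of $I(\gamma)$. Here $\nu+d$ adds $d$ to every clock, $\gamma+d=(\ell,\nu+d)$, and $[Y\leftarrow0](\nu)$ resets the clocks in $Y$ to $0$. An edge $(\ell,g,Y,\ell')$ is enabled at $(\ell,\nu)$ if $\nu\models g$; $p_\gamma(e)=w_e/\sum\{w_{e'}\mid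 e'\text{ enabled at }\gamma\}$ if $e$ is enabled at $\gamma$, else $0$. $\mathcal T_{\mathcal A}$ is the stochastic transition system (Markov chain on a general state space) with state space $L\times\mathbb R_{\ge0}^X$ (product of $2^L$ and the Borel $\sigma$-algebra) and kernel, for $\gamma=(\ell,\nu)$, $$\kappa_{\mathcal A}(\gamma,B)=\sum_{e=(\ell,g,Y,\ell')\in E}\int_{d\ge0}\mathbf 1_B(\ell',[Y\leftarrow0](\nu+d))\,p_{\gamma+d}(e)\,\mathrm d\mu_\gamma(d).$$ For an initial distribution $\mu$ on the state space, $\mathrm{Prob}^{\mathcal T_{\mathcal A}}_\mu$ is the law on infinite sequences of configurations of the Markov chain with initial distribution $\mu$ and kernel $\kappa_{\mathcal A}$. $\mathcal A$ is reactive if $I(\gamma)=\mathbb R_{\ge0}$ for every configuration $\gamma$ and for every $\ell$ there is a distribution $\mu_\ell$ with support $\mathbb R_{\ge0}$ such that $\mu_{(\ell,\nu)}=\mu_\ell$ for all $\nu$. It is labelled if each location carries a label in $2^{\mathrm{AP}}$, $\mathrm{AP}$ a finite set of atomic propositions; a configuration $(\ell,\nu)$ has the label of $\ell$. A deterministic Muller automaton over $\mathrm{AP}$ is $\mathcal M=(Q,q_0,E',\mathcal F)$ with $Q$ finite, $q_0\in Q$, $E'\subseteq Q\times2^{\mathrm{AP}}\times Q$ deterministic and complete (exactly one successor for each $(q,u)$), $\mathcal F\subseteq2^Q$; a word in $(2^{\mathrm{AP}})^\omega$ is accepted if the set of locations visited infinitely often by its unique run from $q_0$ is in $\mathcal F$.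 $\mathrm{Prob}^{\mathcal T_{\mathcal A}}_\mu(\mathcal M)$ is the probability that the label sequence of the path is accepted by $\mathcal M$. Almost-sure satisfaction of $\mathcal M$ by $\mathcal A$ means that this probability is $1$ (for the initial distribution under consideration). Regions: let $M_{\mathcal A}$ be the maximal integer appearing in guards. Valuations $\nu,\nu'$ are region-equivalent if: for every $x\in X$, either $\nu(x),\nu'(x)>M_{\mathcal A}$, or $\lfloor\nu(x)\rfloor=\lfloor\nu'(x)\rfloor$ and ($\nu(x)$ is an integer iff $\nu'(x)$ is); and for all $x,y$ with $\nu(x),\nu(y)\le M_{\mathcal A}$, $\{\nu(x)\}\le\{\nu(y)\}$ iff $\{\nu'(x)\}\le\{\nu'(y)\}$ ($\{\cdot\}$ = fractional part). $R_{\mathcal A}$ is the finite set of classes (regions). $\mu$ is numerically amenable w.r.t. $\mathcal A$ if, given $k\in\mathbb N$, $\varepsilon>0$ and a sequence $(\ell_0,r_0),\dots,(\ell_k,r_k)$ in $L\times R_{\mathcal A}$, one can compute a numerical approximation up to $\varepsilon$ of the probability under $\mathrm{Prob}^{\mathcal T_{\mathcal A}}_\mu$ that for all $0\le i\le k$ the $i$-th configuration lies in $\{\ell_i\}\times r_i$. *)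

(* Defs.v *)
From HB Require Import structures.
From Stdlib Require Cantor.
From mathcomp Require Import all_boot all_order all_algebra.
From mathcomp Require Import finmap.
From mathcomp Require Import all_classical all_reals all_analysis.

Set Implicit Arguments.
Unset Strict Implicit.
Unset Printing Implicit Defensive.
Import Order.TTheory GRing.Theory Num.Theory.
Local Open Scope classical_set_scope.
Local Open Scope ring_scope.

(* Algorithms are partial recursive functions on nat, presented as unary      *)
(* functions with the Cantor pairing (a bijection nat * nat -> nat) as a      *)
(* basic operation. Call invokes a subroutine supplied from outside, whose    *)
(* graph is the parameter sub of the semantics.                               *)

Definition pairn (a b : nat) : nat := Cantor.to_nat (a, b).
Definition unpairn (n : nat) : nat * nat := Cantor.of_nat n.

Inductive program : Type :=
| Zero | Succ | Left | Right
| Pair of program & program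
| Comp of program & program
| Rec of program & program
| Min of program
| Call.

Inductive computes (sub : nat -> nat -> Prop) : program -> nat -> nat -> Prop :=
| computes_zero n : computes sub Zero n 0
| computes_succ n : computes sub Succ n n.+1
| computes_left n : computes sub Left n (unpairn n).1
| computes_right n : computes sub Right n (unpairn n).2
| computes_pair f g n a b : computes sub f n a -> computes sub g n b ->
    computes sub (Pair f g) n (pairn a b)
| computes_comp f g n a b : computes sub g n a -> computes sub f a b ->
    computes sub (Comp f g) n b
| computes_rec0 f g x b : computes sub f x b -> computes sub (Rec f g) (pairn x 0) b
| computes_recS f g x n a b : computes sub (Rec f g) (pairn x n) a ->
    computes sub g (pairn x (pairn n a)) b ->
    computes sub (Rec f g) (pairn x n.+1) b
| computes_min f x n (c : nat -> nat) :
    (forall m, (m < n)%N -> computes sub f (pairn x m) (c m).+1) ->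
    computes sub f (pairn x n) 0 ->
    computes sub (Min f) x n
| computes_call n m : sub n m -> computes sub Call n m.

Definition run (p : program) : nat -> nat -> Prop :=
  computes (fun _ _ => False) p.

(* The algorithm p, using the algorithm q as a subroutine. *)
Definition run_with (q p : program) : nat -> nat -> Prop := computes (run q) p.

(* Finite objects are given to algorithms as numbers; the elements of a       *)
(* finite type are numbered by enum_rank.                                     *)

Definition code_seq (s : seq nat) : nat :=
  foldr (fun a c => (pairn a c).+1) 0%N s.

Definition code_elt (T : finType) (x : T) : nat := enum_rank x.

Definition code_set (T : finType) (A : {set T}) : nat :=
  code_seq [seq code_elt x | x <- enum A].

(* The number n denotes the nonnegative rational a / (b + 1), n = <a, b>. *)
Definition nnrat (R : realType) (n : nat) : {nonneg R} :=
  ((unpairn n).1%:R / (unpairn n).2.+1%:R)%:nng.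

Inductive comparison_op := Lt | Le | Eq | Ge | Gt.

Definition nat_of_op (o : comparison_op) : nat :=
  match o with Lt => 0 | Le => 1 | Eq => 2 | Ge => 3 | Gt => 4 end.

Definition op_of_nat (n : nat) : comparison_op :=
  match n with 0 => Lt | 1 => Le | 2 => Eq | 3 => Ge | _ => Gt end.

Lemma nat_of_opK : cancel nat_of_op op_of_nat. Proof. by case. Qed.

HB.instance Definition _ := Equality.copy comparison_op (can_type nat_of_opK).

Definition op_holds (R : realType) (o : comparison_op) (a b : R) : bool :=
  match o with
  | Lt => a < b | Le => a <= b | Eq => a == b | Ge => b <= a | Gt => b < a
  end.

Definition guard (X : finType) : Type := seq (X * comparison_op * nat).

(* (l, g, Y, l') *)
Definition edge (L X : finType) : Type := (L * guard X * {set X} * L)%type.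

HB.instance Definition _ (L X : finType) := Equality.on (edge L X).

Section edge_projections.
Variables (L X : finType) (e : edge L X).
Definition source : L := e.1.1.1.
Definition eguard : guard X := e.1.1.2.
Definition resets : {set X} := e.1.2.
Definition target : L := e.2.
End edge_projections.

(* All of a labelled stochastic timed automaton except its delay              *)
(* distributions, i.e. its finitary part.                                     *)
Record timed_automaton (AP : finType) := TimedAutomaton {
  loc : finType ;
  loc0 : loc ;
  clock : finType ;
  edges : seq (edge loc clock) ;
  edges_uniq : uniq edges ;
  weight : edge loc clock -> nat ;
  weight_gt0 : forall e, e \in edges -> (0 < weight e)%N ;
  label : loc -> {set AP}
}.

Section codes.
Variables (AP : finType) (A : timed_automaton AP).

Definition code_guard (g : guard (clock A)) : nat :=
  code_seq [seq pairn (code_elt k.1.1) (pairn (nat_of_op k.1.2) k.2) | k <- g].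

Definition code_edge (e : edge (loc A) (clock A)) : nat :=
  code_seq [:: code_elt (source e); code_guard (eguard e);
               code_set (resets e); code_elt (target e); weight e].

Definition code_ta : nat :=
  code_seq [:: #|loc A|; code_elt (loc0 A); #|clock A|; #|AP|;
               code_seq [seq code_edge e | e <- edges A];
               code_seq [seq code_set (label l) | l <- enum (loc A)]].

End codes.

(* Delays and clock values live in [0, +oo[, with the trace of the Borel      *)
(* sigma-algebra of R.                                                        *)
Definition half_line (R : realType) : Type := {nonneg R}.
HB.instance Definition _ (R : realType) := Choice.on (half_line R).
HB.instance Definition _ (R : realType) :=
  isPointed.Build (half_line R) (0%:nng : {nonneg R}).

Definition real_of (R : realType) (d : half_line R) : R :=
  (d : {nonneg R})%:num.

Definition nnreal (R : realType) := g_sigma_algebra_preimageType (@real_of R).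

(* I -> T with the product sigma-algebra. *)
Definition coordinate_sets (I : Type) d (T : measurableType d) :
    set (set (I -> T)) :=
  \bigcup_i preimage_set_system setT (fun f : I -> T => f i) measurable.

Definition product_space (I : Type) d (T : measurableType d) :=
  g_sigma_algebraType (@coordinate_sets I d T).

Section discrete_locations.
Variable AP : finType.

Definition location (A : timed_automaton AP) : Type := loc A.
HB.instance Definition _ A := Finite.on (location A).
HB.instance Definition _ A := isPointed.Build (location A) (loc0 A).
HB.instance Definition _ A := @isMeasurable.Build default_measure_display
  (location A) discrete_measurable discrete_measurable0
  discrete_measurableC discrete_measurableU.

End discrete_locations.

Definition valuation (R : realType) (AP : finType) (A : timed_automaton AP) :=
  product_space (clock A) (nnreal R).

Definition config (R : realType) (AP : finType) (A : timed_automaton AP) :=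
  (location A * valuation R A)%type.

Definition path_space (R : realType) (AP : finType) (A : timed_automaton AP) :=
  product_space nat (config R A).

Section semantics.
Variables (R : realType) (AP : finType) (A : timed_automaton AP).

Definition elapse (v : valuation R A) (d : nnreal R) : valuation R A :=
  fun x => ((v x : {nonneg R})%:num + (d : {nonneg R})%:num)%:nng.

Definition reset (Y : {set clock A}) (v : valuation R A) : valuation R A :=
  fun x => if x \in Y then (0%:nng : {nonneg R}) else v x.

Definition satisfies (v : valuation R A) (g : guard (clock A)) : bool :=
  all (fun k => op_holds k.1.2 (real_of (v k.1.1)) k.2%:R) g.

Definition enabled (e : edge (loc A) (clock A)) (c : config R A) : bool :=
  (source e == c.1) && satisfies c.2 (eguard e).

Definition wait (c : config R A) (d : nnreal R) : config R A :=
  (c.1, elapse c.2 d).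

Definition enabled_delays (c : config R A) : set (nnreal R) :=
  [set d | exists2 e, e \in edges A & enabled e (wait c d)].

Definition edge_prob (c : config R A) (e : edge (loc A) (clock A)) : R :=
  if enabled e c
  then (weight e)%:R / (\sum_(f <- edges A | enabled f c) weight f)%:R
  else 0.

Definition lebesgue_half_line (D : set (nnreal R)) : \bar R :=
  lebesgue_measure [set real_of d | d in D].

(* "Support I" is meant here as "I has full mass": since singletons of I may  *)
(* be Lebesgue-null, I need not be the topological support. In the degenerate *)
(* case I is finite, being Lebesgue-null and a finite union of intervals.     *)
Definition admissible (I : set (nnreal R)) (m : probability (nnreal R) R) :=
  [/\ m I = 1%E,
      (0 < lebesgue_half_line I)%E -> forall D, measurable D ->
        (m D = 0%E <-> lebesgue_half_line (D `&` I) = 0%E)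
    & lebesgue_half_line I = 0%E ->
        forall d, I d -> m [set d] = ((#|` fset_set I|)%:R^-1)%:E].

Definition full_support (m : probability (nnreal R) R) :=
  forall (d : nnreal R) (r : R), 0 < r ->
    (0 < m [set d' | `|real_of d' - real_of d| < r]%R)%E.

End semantics.

Record sta (R : realType) (AP : finType) := STA {
  ta :> timed_automaton AP ;
  delay_law : config R ta -> probability (nnreal R) R ;
  delay_lawP : forall c, admissible (enabled_delays c) (delay_law c)
}.

Section markov_chain.
Variables (R : realType) (AP : finType) (A : sta R AP).

Definition reactive :=
  (forall c : config R A, enabled_delays c = setT) /\
  exists m : location A -> probability (nnreal R) R,
    forall l, full_support (m l) /\
      forall (v : valuation R A) D, measurable D -> delay_law (l, v) D = m l D.

Definition sta_kernel (c : config R A) (B : set (config R A)) : \bar R :=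
  (\sum_(e <- edges A | source e == c.1)
    \int[delay_law c]_d
      (\1_B ((target e : location A), reset (resets e) (elapse c.2 d))
        * edge_prob (wait c d) e)%:E)%E.

(* P is the law of the Markov chain with initial distribution mu and kernel   *)
(* sta_kernel; it is unique since cylinders generate the sigma-algebra.       *)
Definition markov_law (mu : probability (config R A) R)
    (P : probability (path_space R A) R) :=
  (forall B, measurable B -> P [set w | B (w 0%N)] = mu B) /\
  forall n (B : nat -> set (config R A)), (forall i, measurable (B i)) ->
    P [set w | forall i, (i <= n.+1)%N -> B i (w i)] =
    (\int[P]_(w in [set w | forall i, (i <= n)%N -> B i (w i)])
      sta_kernel (w n) (B n.+1))%E.

Definition initial_config : config R A :=
  (loc0 A, (fun=> (0%:nng : {nonneg R})) : valuation R A).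

Definition initial_distribution : probability (config R A) R :=
  dirac initial_config.

Definition label_word (w : path_space R A) : nat -> {set AP} :=
  fun i => label (w i).1.

End markov_chain.

(* The transition relation, deterministic and complete, is a function. *)
Record muller (AP : finType) := Muller {
  mstate : finType ;
  minit : mstate ;
  mstep : mstate -> {set AP} -> mstate ;
  mfinal : {set {set mstate}}
}.

Section muller_automata.
Variables (AP : finType) (M : muller AP).

Fixpoint mrun (u : nat -> {set AP}) (n : nat) : mstate M :=
  if n is k.+1 then mstep (mrun u k) (u k) else minit M.

Definition accepts (u : nat -> {set AP}) : Prop :=
  finset (fun q => `[< forall n, exists2 k, (n <= k)%N & mrun u k = q >])
    \in mfinal M.

Definition code_muller : nat :=
  code_seq [:: #|mstate M|; code_elt (minit M);
    code_seq [seq pairn (code_elt t.1)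
                        (pairn (code_set t.2) (code_elt (mstep t.1 t.2)))
             | t <- enum {: mstate M * {set AP}}];
    code_seq [seq code_set F | F <- enum (mfinal M)]].

End muller_automata.

Definition muller_prob (R : realType) (AP : finType) (A : sta R AP)
    (P : probability (path_space R A) R) (M : muller AP) : \bar R :=
  P [set w | accepts M (label_word w)].

Section regions.
Variables (R : realType) (AP : finType) (A : timed_automaton AP).

Definition max_const : nat :=
  (\max_(e <- edges A) \max_(k <- eguard e) k.2)%N.

Definition frac_part (x : R) : R := x - (Num.floor x)%:~R.

Definition region_equiv (v v' : valuation R A) : Prop :=
  let a x := real_of (v x) in
  let a' x := real_of (v' x) in
  (forall x, (max_const%:R < a x /\ max_const%:R < a' x) \/
     (Num.floor (a x) = Num.floor (a' x) /\
      (a x \is a Num.int <-> a' x \is a Num.int))) /\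
  (forall x y, a x <= max_const%:R -> a y <= max_const%:R ->
     (frac_part (a x) <= frac_part (a y) <-> frac_part (a' x) <= frac_part (a' y))).

(* Every region contains a rational valuation, which serves as its finite     *)
(* name: a cell (l, q) names {l} x r, where r is the region of q.             *)
Definition cell : Type := (loc A * {ffun clock A -> nat})%type.

Definition rat_valuation (q : {ffun clock A -> nat}) : valuation R A :=
  fun x => nnrat R (q x).

Definition cell_set (c : cell) : set (config R A) :=
  [set g | g.1 = c.1 /\ region_equiv (rat_valuation c.2) g.2].

Definition code_cell (c : cell) : nat :=
  pairn (code_elt c.1) (code_seq [seq c.2 x | x <- enum (clock A)]).

End regions.

Section algorithmic_data.
Variables (R : realType) (AP : finType) (A : sta R AP).
Variable mu : probability (config R A) R.

(* mu is numerically amenable with respect to A when some q satisfies the     *)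
(* following. The query is c :: s, a sequence of k + 1 cells with k = size s, *)
(* and a rational e > 0.                                                      *)
Definition numerically_amenable_by (q : program) : Prop :=
  forall P, markov_law mu P ->
  forall (c : cell A) (s : seq (cell A)) (e : nat), 0 < (nnrat R e)%:num ->
    exists2 n, run q (pairn e (code_seq [seq code_cell b | b <- c :: s])) n &
      (`|(nnrat R n)%:num%:E -
         P [set w | forall i, (i <= size s)%N ->
                     cell_set (nth c (c :: s) i) (w i)]|
       <= (nnrat R e)%:num%:E)%E.

(* Which cells have positive mass: all that an almost-sure property can       *)
(* depend on as far as mu is concerned, and a finite datum.                   *)
Definition charged_cells (s : seq (cell A)) : Prop :=
  forall c : cell A, (0 < mu (cell_set c))%E <->
    exists2 b, b \in s & cell_set (R := R) b = cell_set c.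

End algorithmic_data.

(* Main.v *)
Require Import Defs.
From mathcomp Require Import all_boot all_order all_algebra.
From mathcomp Require Import all_classical all_reals all_analysis.
From mathcomp Require Import measurable_realfun.
From mathcomp Require Import zify ring lra.

(* Follow, along a run, the region of the configuration together with the state of the
   Muller automaton: these nodes form a finite graph, computable from the codes, whose
   edges are the transitions of positive probability. As delays do not depend on the
   clocks, every step waits longer than the maximal constant with a probability bounded
   below; each clock is then either reset or beyond all guards, so that the node alone
   determines the law of the future. Hence from such nodes any path of the graph is
   followed with a probability bounded below, and almost surely the run enters a bottom
   component and visits all of its nodes infinitely often. Almost-sure acceptance is
   therefore a reachability property of the graph. As for approximation, the
   probability that after k steps the node decides acceptance (it reaches only
   accepting, or only rejecting, bottom components) tends to 1, and the probabilities
   of the decided prefixes are finite sums of those that numerical amenability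
   provides; k is found by unbounded search. *)

Set Implicit Arguments.
Unset Strict Implicit.
Unset Printing Implicit Defensive.

(** * Computable functions *)

(** The delay law of a location has the null sets of Lebesgue measure, so delays that bring a clock
    to an integer up to the maximal constant can be ignored. For any other delay, the delays leading
    to the same region form an open interval, which full support charges; that it is nonempty
    depends on the region only. Positivity of a transition can therefore be tested at one rational
    point per region, with delays taken from a finite grid. The obstacle is that the mass of this
    interval is not bounded below over a region: it vanishes as a clock approaches an integer.
    Positive probabilities thus do not combine into uniform ones along a path of the graph. They do
    from a node all of whose configurations have the same future, and such nodes are entered at
    every step with a uniform probability. Graph problems are decided by bounded quantifiers over
    numbers; reachability quantifies over all edge-closed sets of nodes, so no traversal is
    programmed. The only unbounded search is for the prefix length, and its stopping test uses
    nothing but the approximate answers: with error e/4 on each of the two decided masses, it waits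
    for their sum to reach 1 - 3e/4. *)

Definition lft n := (unpairn n).1.
Definition rgt n := (unpairn n).2.

Lemma lftE a b : lft (pairn a b) = a.
Proof. by rewrite /lft /unpairn /pairn Cantor.cancel_of_to. Qed.

Lemma rgtE a b : rgt (pairn a b) = b.
Proof. by rewrite /rgt /unpairn /pairn Cantor.cancel_of_to. Qed.

Lemma pairnE n : pairn (lft n) (rgt n) = n.
Proof.
by rewrite /pairn /lft /rgt -surjective_pairing /unpairn Cantor.cancel_to_of.
Qed.

Lemma leq_pairn_r a b : b <= pairn a b.
Proof. by have := Cantor.to_nat_non_decreasing a b; rewrite /pairn; lia. Qed.

Lemma pairn_inj a b a' b' : pairn a b = pairn a' b' -> a = a' /\ b = b'.
Proof.
move=> E; split; first by rewrite -(lftE a b) E lftE.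
by rewrite -(rgtE a b) E rgtE.
Qed.

(** The program may not depend on [sub]: the same programs then serve in the decision procedures,
    run without subroutine, and in the approximation algorithm, which calls one. *)
Definition cpt (f : nat -> nat) := exists p, forall sub n, computes sub p n (f n).

Lemma eq_cpt f g : f =1 g -> cpt f -> cpt g.
Proof. by move=> fg [p Hp]; exists p => sub n; rewrite -fg. Qed.

Lemma cpt_comp f g : cpt f -> cpt g -> cpt (fun n => f (g n)).
Proof.
move=> [p Hp] [q Hq]; exists (Comp p q) => sub n.
exact: computes_comp (Hq _ _) (Hp _ _).
Qed.

Lemma cpt_pairn f g : cpt f -> cpt g -> cpt (fun n => pairn (f n) (g n)).
Proof.
by move=> [p Hp] [q Hq]; exists (Pair p q) => sub n; apply: computes_pair.
Qed.

Lemma cpt_lft f : cpt f -> cpt (fun n => lft (f n)).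
Proof.
by apply: cpt_comp; exists Left => sub n; apply: computes_left.
Qed.

Lemma cpt_rgt f : cpt f -> cpt (fun n => rgt (f n)).
Proof.
by apply: cpt_comp; exists Right => sub n; apply: computes_right.
Qed.

Lemma cpt_succ f : cpt f -> cpt (fun n => (f n).+1).
Proof.
by apply: cpt_comp; exists Succ => sub n; apply: computes_succ.
Qed.

(** No basic program is the identity, but pairing the two projections is, since the Cantor pairing
    is onto. *)
Lemma cpt_id : cpt (fun n => n).
Proof.
have [p Hp] : cpt (fun n => pairn (lft n) (rgt n)).
  apply: cpt_pairn.
    by exists Left => sub n; apply: computes_left.
  by exists Right => sub n; apply: computes_right.
by exists p => sub n; rewrite -[X in computes _ _ _ X]pairnE.
Qed.

Lemma cpt_cst c : cpt (fun=> c).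
Proof.
elim: c => [|c]; last exact: cpt_succ.
by exists Zero => sub n; apply: computes_zero.
Qed.

(** [Rec] receives the whole input as its parameter, so the loop body can consult it along with the
    index and the accumulator. All arithmetic and all bounded quantifiers below are such loops. *)
Lemma cpt_iteri (L B : nat -> nat) (S : nat -> nat -> nat -> nat) :
  cpt L -> cpt B -> cpt (fun m => S (lft m) (lft (rgt m)) (rgt (rgt m))) ->
  cpt (fun n => iteri (L n) (S n) (B n)).
Proof.
move=> [pL HL] [pB HB] [pS HS]; have [pI HI] := cpt_id.
exists (Comp (Rec pB pS) (Pair pI pL)) => sub n.
apply: computes_comp (computes_pair (HI _ _) (HL _ _)) _.
elim: (L n) => [|k IH] /=; first exact: computes_rec0.
apply: computes_recS IH _.
by have := HS sub (pairn n (pairn k (iteri k (S n) (B n)))); rewrite !(lftE, rgtE).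
Qed.

Ltac cpt_step := first
  [ assumption | apply cpt_id | apply cpt_cst
  | apply cpt_pairn | apply cpt_lft | apply cpt_rgt | apply cpt_succ
  | apply cpt_iteri ].

Lemma cpt_addn f g : cpt f -> cpt g -> cpt (fun n => f n + g n).
Proof.
move=> cf cg; apply: (@eq_cpt (fun n => iteri (g n) (fun _ a => a.+1) (f n))).
  by move=> n; elim: (g n) => [|k /= ->] //=; rewrite ?addn0 ?addnS.
by repeat cpt_step.
Qed.

Lemma cpt_predn f : cpt f -> cpt (fun n => (f n).-1).
Proof.
move=> cf; apply: (@eq_cpt (fun n => iteri (f n) (fun i _ => i) 0)).
  by move=> n; case: (f n).
by repeat cpt_step.
Qed.

Lemma cpt_subn f g : cpt f -> cpt g -> cpt (fun n => f n - g n).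
Proof.
move=> cf cg; apply: (@eq_cpt (fun n => iteri (g n) (fun _ a => a.-1) (f n))).
  by move=> n; elim: (g n) => [|k /= ->] //=; rewrite ?subn0 ?subnS.
apply: cpt_iteri => //; apply: cpt_predn; by repeat cpt_step.
Qed.

Lemma cpt_muln f g : cpt f -> cpt g -> cpt (fun n => f n * g n).
Proof.
move=> cf cg; apply: (@eq_cpt (fun n => iteri (g n) (fun _ a => a + f n) 0)).
  by move=> n; elim: (g n) => [|k /= ->] //=; rewrite ?muln0 ?mulnS 1?addnC.
apply: cpt_iteri => //; first exact: cpt_cst.
apply: cpt_addn; first by repeat cpt_step.
by apply: cpt_comp => //; repeat cpt_step.
Qed.

Lemma cpt_expn f g : cpt f -> cpt g -> cpt (fun n => f n ^ g n).
Proof.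
move=> cf cg; apply: (@eq_cpt (fun n => iteri (g n) (fun _ a => a * f n) 1)).
  by move=> n; elim: (g n) => [|k /= ->] //=; rewrite ?expn0 ?expnS 1?mulnC.
apply: cpt_iteri => //; first exact: cpt_cst.
apply: cpt_muln; first by repeat cpt_step.
by apply: cpt_comp => //; repeat cpt_step.
Qed.

Lemma cpt_andb (f g : nat -> bool) : cpt f -> cpt g -> cpt (fun n => f n && g n).
Proof.
move=> cf cg; apply: (@eq_cpt (fun n => f n * g n)); last exact: cpt_muln.
by move=> n; case: (f n); case: (g n).
Qed.

Lemma cpt_negb (f : nat -> bool) : cpt f -> cpt (fun n => ~~ f n).
Proof.
move=> cf; apply: (@eq_cpt (fun n => 1 - f n)); first by move=> n; case: (f n).
by apply: cpt_subn => //; apply: cpt_cst.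
Qed.

Lemma cpt_orb (f g : nat -> bool) : cpt f -> cpt g -> cpt (fun n => f n || g n).
Proof.
move=> cf cg; apply: (@eq_cpt (fun n => ~~ (~~ f n && ~~ g n))).
  by move=> n; case: (f n); case: (g n).
by apply: cpt_negb; apply: cpt_andb; apply: cpt_negb.
Qed.

Lemma cpt_implyb (f g : nat -> bool) : cpt f -> cpt g -> cpt (fun n => f n ==> g n).
Proof.
move=> cf cg; apply: (@eq_cpt (fun n => ~~ f n || g n)).
  by move=> n; case: (f n); case: (g n).
by apply: cpt_orb => //; apply: cpt_negb.
Qed.

Lemma cpt_leq f g : cpt f -> cpt g -> cpt (fun n => f n <= g n).
Proof.
move=> cf cg; apply: (@eq_cpt (fun n => 1 - (f n - g n))).
  by move=> n; case: (leqP (f n) (g n)); lia.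
by apply: cpt_subn; [apply: cpt_cst|apply: cpt_subn].
Qed.

Lemma cpt_eqn f g : cpt f -> cpt g -> cpt (fun n => f n == g n).
Proof.
move=> cf cg; apply: (@eq_cpt (fun n => (f n <= g n) && (g n <= f n))).
  by move=> n; rewrite eqn_leq.
by apply: cpt_andb; apply: cpt_leq.
Qed.

Lemma cpt_eqb (f g : nat -> bool) : cpt f -> cpt g -> cpt (fun n => f n == g n).
Proof.
move=> cf cg; apply: (@eq_cpt (fun n => nat_of_bool (f n) == g n)).
  by move=> n; case: (f n); case: (g n).
exact: cpt_eqn.
Qed.

Lemma cpt_if (b : nat -> bool) f g : cpt b -> cpt f -> cpt g ->
  cpt (fun n => if b n then f n else g n).
Proof.
move=> cb cf cg; apply: (@eq_cpt (fun n => b n * f n + (1 - b n) * g n)).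
  by move=> n; case: (b n); rewrite ?mul1n ?addn0.
by apply: cpt_addn; apply: cpt_muln => //; apply: cpt_subn => //; apply: cpt_cst.
Qed.

(** * Bounded quantifiers, sums and maxima; division *)

Definition all_below n (P : nat -> bool) := all P (iota 0 n).
Definition has_below n (P : nat -> bool) := has P (iota 0 n).
Definition bsum n (F : nat -> nat) := \sum_(0 <= i < n) F i.
Definition bmax n (F : nat -> nat) := \max_(0 <= i < n) F i.

Lemma all_belowP n (P : nat -> bool) : reflect (forall i, i < n -> P i) (all_below n P).
Proof.
apply: (iffP allP) => H i; first by move=> ltin; apply: H; rewrite mem_iota.
by rewrite mem_iota => /andP[_]; apply: H.
Qed.

Lemma has_belowP n (P : nat -> bool) : reflect (exists2 i, i < n & P i) (has_below n P).
Proof.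
apply: (iffP hasP) => -[i].
  by rewrite mem_iota => /andP[_ ltin]; exists i.
by exists i => //; rewrite mem_iota.
Qed.

Lemma cpt_all_below (L : nat -> nat) (P : nat -> nat -> bool) : cpt L ->
  cpt (fun m => P (lft m) (rgt m)) -> cpt (fun n => all_below (L n) (P n)).
Proof.
move=> cL cP.
apply: (@eq_cpt (fun n => iteri (L n) (fun i a => a * P n i) 1)) => [n|].
  rewrite /all_below; elim: (L n) => [|k IH] //; rewrite -addn1 iotaD all_cat /= addn1.
  by rewrite /= IH andbT; case: (all _ _); case: (P _ _).
apply: cpt_iteri => //; first exact: cpt_cst.
apply: cpt_muln; first by repeat cpt_step.
have : cpt (fun m => pairn (lft m) (lft (rgt m))) by repeat cpt_step.
by move=> /(cpt_comp cP); apply: eq_cpt => n; rewrite !(lftE, rgtE).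
Qed.

Lemma cpt_has_below (L : nat -> nat) (P : nat -> nat -> bool) : cpt L ->
  cpt (fun m => P (lft m) (rgt m)) -> cpt (fun n => has_below (L n) (P n)).
Proof.
move=> cL cP; apply: (@eq_cpt (fun n => ~~ all_below (L n) (fun i => ~~ P n i))) => [n|].
  rewrite /has_below /all_below -has_predC; congr nat_of_bool.
  by apply: eq_has => i /=; rewrite negbK.
by apply: cpt_negb; apply: cpt_all_below => //; apply: cpt_negb.
Qed.

Lemma cpt_bsum (L : nat -> nat) (F : nat -> nat -> nat) : cpt L ->
  cpt (fun m => F (lft m) (rgt m)) -> cpt (fun n => bsum (L n) (F n)).
Proof.
move=> cL cF.
apply: (@eq_cpt (fun n => iteri (L n) (fun i a => a + F n i) 0)) => [n|].
  by rewrite /bsum; elim: (L n) => [|k IH]; rewrite ?big_nil ?big_nat_recr //= IH.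
apply: cpt_iteri => //; first exact: cpt_cst.
apply: cpt_addn; first by repeat cpt_step.
have : cpt (fun m => pairn (lft m) (lft (rgt m))) by repeat cpt_step.
by move=> /(cpt_comp cF); apply: eq_cpt => n; rewrite !(lftE, rgtE).
Qed.

Lemma cpt_bmax (L : nat -> nat) (F : nat -> nat -> nat) : cpt L ->
  cpt (fun m => F (lft m) (rgt m)) -> cpt (fun n => bmax (L n) (F n)).
Proof.
move=> cL cF.
apply: (@eq_cpt (fun n => iteri (L n) (fun i a => a + (F n i - a)) 0)) => [n|].
  rewrite /bmax; elim: (L n) => [|k IH]; rewrite ?big_nil ?big_nat_recr //= IH.
  by rewrite -maxnE.
apply: cpt_iteri => //; first exact: cpt_cst.
apply: cpt_addn; first by repeat cpt_step.
apply: cpt_subn; last by repeat cpt_step.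
have : cpt (fun m => pairn (lft m) (lft (rgt m))) by repeat cpt_step.
by move=> /(cpt_comp cF); apply: eq_cpt => n; rewrite !(lftE, rgtE).
Qed.

(** The quotient counts the positive multiples of d up to m, and there are at most m of them; the
    guard on d reproduces [m %/ 0 = 0]. *)
Lemma divn_bsum m d : m %/ d = bsum m (fun i => (0 < d) && (i.+1 * d <= m)).
Proof.
rewrite /bsum; have [->|d0] := posnP d.
  by rewrite divn0 big1.
rewrite (eq_bigr (fun i => nat_of_bool (i < m %/ d))); last first.
  by move=> i _; rewrite /= leq_divRL.
rewrite -big_mkcond /= sum1_count.
have: m %/ d <= m by exact: leq_div.
move: (m %/ d) => q; rewrite /index_iota subn0 => qm.
rewrite -(subnKC qm) iotaD count_cat (@eq_in_count _ _ predT) => [|i]; last first.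
  by rewrite mem_iota.
rewrite count_predT size_iota (@eq_in_count _ _ pred0) ?count_pred0 ?addn0 // => i.
by rewrite mem_iota add0n => /andP[qi _] /=; rewrite ltnNge qi.
Qed.

Lemma cpt_divn f g : cpt f -> cpt g -> cpt (fun n => f n %/ g n).
Proof.
move=> cf cg; apply: (eq_cpt (fun n => esym (divn_bsum (f n) (g n)))).
have cl : cpt lft by apply: cpt_lft cpt_id.
have cgl : cpt (fun m => g (lft m)) by exact: cpt_comp.
have cfl : cpt (fun m => f (lft m)) by exact: cpt_comp.
apply: cpt_bsum => //; apply: cpt_andb.
  by apply: cpt_leq => //; apply: cpt_cst.
apply: cpt_leq => //; apply: cpt_muln => //; by repeat cpt_step.
Qed.

Lemma cpt_modn f g : cpt f -> cpt g -> cpt (fun n => f n %% g n).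
Proof.
move=> cf cg; apply: (@eq_cpt (fun n => f n - f n %/ g n * g n)).
  by move=> n; rewrite [X in X - _](divn_eq (f n) (g n)) addKn.
by apply: cpt_subn => //; apply: cpt_muln => //; apply: cpt_divn.
Qed.

Lemma cpt_dvdn f g : cpt f -> cpt g -> cpt (fun n => f n %| g n).
Proof. by move=> cf cg; apply: cpt_eqn (cpt_modn cg cf) (cpt_cst 0). Qed.

(** * Lists coded as numbers *)

Definition hdc c := lft c.-1.
Definition tlc k c := iter k (fun t => rgt t.-1) c.
Definition nthc c k := hdc (tlc k c).
(** A code is at least the length of its list ([size_code]), so [c] itself bounds the positions to
    visit. Position k lies in the list exactly when the k-th tail is nonzero: the code 0 of the
    empty list is its own tail. *)
Definition exl c (P : nat -> bool) := has_below c (fun k => (tlc k c != 0) && P (nthc c k)).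
Definition alll c (P : nat -> bool) := ~~ exl c (fun x => ~~ P x).
(** The list is built from its last entry, hence the reversed index. *)
Definition mkl n (F : nat -> nat) :=
  iteri n (fun i a => (pairn (F (n.-1 - i)) a).+1) 0.

Lemma tlc_code s k : tlc k (code_seq s) = code_seq (drop k s).
Proof.
elim: k s => [|k IH] s; first by rewrite drop0.
rewrite /tlc iterSr -/(tlc k _); case: s => [|x s] /=; last by rewrite rgtE IH.
by have -> : rgt 0 = code_seq [::] by []; rewrite IH.
Qed.

Lemma nthc_code s k : k < size s -> nthc (code_seq s) k = nth 0 s k.
Proof.
move=> lt_ks; rewrite /nthc tlc_code (drop_nth 0 lt_ks) /hdc /=.
exact: lftE.
Qed.

Lemma size_code s : size s <= code_seq s.
Proof. by elim: s => //= x s /leq_trans; apply; apply: leq_pairn_r. Qed.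

Lemma tlc_neq0 s k : (tlc k (code_seq s) != 0) = (k < size s).
Proof.
rewrite tlc_code; case: (ltnP k (size s)) => [/(drop_nth 0) ->|] //.
by move/drop_oversize => ->.
Qed.

Lemma exl_code s P : exl (code_seq s) P = has P s.
Proof.
apply/has_belowP/(has_nthP 0) => -[k].
  by rewrite tlc_neq0 => _ /andP[ks]; rewrite nthc_code //; exists k.
move=> ks Pk; exists k; first exact: leq_trans ks (size_code s).
by rewrite tlc_neq0 ks nthc_code.
Qed.

Lemma alll_code s P : alll (code_seq s) P = all P s.
Proof.
by rewrite /alll exl_code -all_predC; apply: eq_all => x /=; rewrite negbK.
Qed.

Lemma mkl_code n F : mkl n F = code_seq (mkseq F n).
Proof.
suff H k : k <= n -> iteri k (fun i a => (pairn (F (n.-1 - i)) a).+1) 0 =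
    code_seq (map F (iota (n - k) k)).
  by rewrite /mkl H // subnn.
elim: k => [|k IH] // kn; rewrite /= IH ?(ltnW kn) //.
have -> : n.-1 - k = n - k.+1 by lia.
by have -> : (n - k.+1).+1 = n - k by lia.
Qed.

Lemma cpt_tlc f g : cpt f -> cpt g -> cpt (fun n => tlc (f n) (g n)).
Proof.
move=> cf cg; apply: (@eq_cpt (fun n => iteri (f n) (fun _ t => rgt t.-1) (g n))).
  by move=> n; rewrite /tlc; elim: (f n) => //= k ->.
apply: cpt_iteri => //; apply: cpt_rgt; apply: cpt_predn; by repeat cpt_step.
Qed.

Lemma cpt_hdc f : cpt f -> cpt (fun n => hdc (f n)).
Proof. by move=> cf; apply: cpt_lft; apply: cpt_predn. Qed.

Lemma cpt_nthc f g : cpt f -> cpt g -> cpt (fun n => nthc (f n) (g n)).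
Proof. by move=> cf cg; apply: cpt_hdc; apply: cpt_tlc. Qed.

Lemma cpt_exl (L : nat -> nat) (P : nat -> nat -> bool) : cpt L ->
  cpt (fun m => P (lft m) (rgt m)) -> cpt (fun n => exl (L n) (P n)).
Proof.
move=> cL cP; apply: cpt_has_below => //.
have cl : cpt lft by apply: cpt_lft cpt_id.
have cr : cpt rgt by apply: cpt_rgt cpt_id.
have cLl : cpt (fun m => L (lft m)) by exact: cpt_comp.
apply: cpt_andb.
  apply: cpt_negb; apply: cpt_eqn; last exact: cpt_cst.
  exact: cpt_tlc.
have : cpt (fun m => pairn (lft m) (nthc (L (lft m)) (rgt m))).
  by apply: cpt_pairn => //; apply: cpt_nthc.
by move=> /(cpt_comp cP); apply: eq_cpt => n; rewrite !(lftE, rgtE).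
Qed.

Lemma cpt_alll (L : nat -> nat) (P : nat -> nat -> bool) : cpt L ->
  cpt (fun m => P (lft m) (rgt m)) -> cpt (fun n => alll (L n) (P n)).
Proof.
by move=> cL cP; apply: cpt_negb; apply: cpt_exl => //; apply: cpt_negb.
Qed.

Lemma cpt_mkl (L : nat -> nat) (F : nat -> nat -> nat) : cpt L ->
  cpt (fun m => F (lft m) (rgt m)) -> cpt (fun n => mkl (L n) (F n)).
Proof.
move=> cL cF; apply: cpt_iteri => //; first exact: cpt_cst.
apply: cpt_succ; apply: cpt_pairn; last by repeat cpt_step.
have : cpt (fun m => pairn (lft m) ((L (lft m)).-1 - lft (rgt m))).
  apply: cpt_pairn; first by repeat cpt_step.
  apply: cpt_subn; last by repeat cpt_step.
  by apply: cpt_predn; apply: cpt_comp => //; repeat cpt_step.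
by move=> /(cpt_comp cF); apply: eq_cpt => n; rewrite !(lftE, rgtE).
Qed.

Definition cpt2 (f : nat -> nat -> nat) := cpt (fun n => f (lft n) (rgt n)).
Definition cpt3 (f : nat -> nat -> nat -> nat) :=
  cpt (fun n => f (lft n) (lft (rgt n)) (rgt (rgt n))).
Definition cpt4 (f : nat -> nat -> nat -> nat -> nat) :=
  cpt (fun n => f (lft n) (lft (rgt n)) (lft (rgt (rgt n))) (rgt (rgt (rgt n)))).

Lemma cpt_app2 f g h : cpt2 f -> cpt g -> cpt h -> cpt (fun n => f (g n) (h n)).
Proof.
move=> cf cg ch; have := cpt_comp cf (cpt_pairn cg ch).
by apply: eq_cpt => n; rewrite !(lftE, rgtE).
Qed.

Lemma cpt_app3 f g h k : cpt3 f -> cpt g -> cpt h -> cpt k ->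
  cpt (fun n => f (g n) (h n) (k n)).
Proof.
move=> cf cg ch ck; have := cpt_comp cf (cpt_pairn cg (cpt_pairn ch ck)).
by apply: eq_cpt => n; rewrite !(lftE, rgtE).
Qed.

Lemma cpt_app4 f g h k l : cpt4 f -> cpt g -> cpt h -> cpt k -> cpt l ->
  cpt (fun n => f (g n) (h n) (k n) (l n)).
Proof.
move=> cf cg ch ck cl.
have := cpt_comp cf (cpt_pairn cg (cpt_pairn ch (cpt_pairn ck cl))).
by apply: eq_cpt => n; rewrite !(lftE, rgtE).
Qed.

Definition cpt5 (f : nat -> nat -> nat -> nat -> nat -> nat) :=
  cpt (fun n => f (lft n) (lft (rgt n)) (lft (rgt (rgt n))) (lft (rgt (rgt (rgt n))))
                  (rgt (rgt (rgt (rgt n))))).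

Lemma cpt_app5 f g h k l o : cpt5 f -> cpt g -> cpt h -> cpt k -> cpt l -> cpt o ->
  cpt (fun n => f (g n) (h n) (k n) (l n) (o n)).
Proof.
move=> cf cg ch ck cl co.
have := cpt_comp cf (cpt_pairn cg (cpt_pairn ch (cpt_pairn ck (cpt_pairn cl co)))).
by apply: eq_cpt => n; rewrite !(lftE, rgtE).
Qed.

Ltac cpt_base := lazymatch goal with
  | |- cpt (fun _ => ?c) => exact (cpt_cst c)
  | |- cpt (fun n => n) => exact cpt_id
  | |- cpt (fun n => pairn (@?f n) (@?g n)) => apply (@cpt_pairn f g)
  | |- cpt (fun n => lft (@?f n)) => apply (@cpt_lft f)
  | |- cpt lft => apply (cpt_lft cpt_id)
  | |- cpt (fun n => rgt (@?f n)) => apply (@cpt_rgt f)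
  | |- cpt rgt => apply (cpt_rgt cpt_id)
  | |- cpt (fun n => S (@?f n)) => apply (@cpt_succ f)
  | |- cpt (fun n => predn (@?f n)) => apply (@cpt_predn f)
  | |- cpt (fun n => addn (@?f n) (@?g n)) => apply (@cpt_addn f g)
  | |- cpt (fun n => subn (@?f n) (@?g n)) => apply (@cpt_subn f g)
  | |- cpt (fun n => muln (@?f n) (@?g n)) => apply (@cpt_muln f g)
  | |- cpt (fun n => expn (@?f n) (@?g n)) => apply (@cpt_expn f g)
  | |- cpt (fun n => divn (@?f n) (@?g n)) => apply (@cpt_divn f g)
  | |- cpt (fun n => modn (@?f n) (@?g n)) => apply (@cpt_modn f g)
  | |- cpt (fun n => nat_of_bool (dvdn (@?f n) (@?g n))) => apply (@cpt_dvdn f g)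
  | |- cpt (fun n => nat_of_bool (leq (@?f n) (@?g n))) => apply (@cpt_leq f g)
  | |- cpt (fun n => nat_of_bool (@eq_op bool (@?f n) (@?g n))) => apply (@cpt_eqb f g)
  | |- cpt (fun n => nat_of_bool (@eq_op _ (@?f n) (@?g n))) => first
        [apply (@cpt_eqn f g) | apply (@cpt_eqb f g)]
  | |- cpt (fun n => nat_of_bool (andb (@?f n) (@?g n))) => apply (@cpt_andb f g)
  | |- cpt (fun n => nat_of_bool (orb (@?f n) (@?g n))) => apply (@cpt_orb f g)
  | |- cpt (fun n => nat_of_bool (implb (@?f n) (@?g n))) => apply (@cpt_implyb f g)
  | |- cpt (fun n => nat_of_bool (negb (@?f n))) => apply (@cpt_negb f)
  | |- cpt (fun n => nat_of_bool (all_below (@?L n) (@?P n))) => apply (@cpt_all_below L P)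
  | |- cpt (fun n => nat_of_bool (has_below (@?L n) (@?P n))) => apply (@cpt_has_below L P)
  | |- cpt (fun n => nat_of_bool (exl (@?L n) (@?P n))) => apply (@cpt_exl L P)
  | |- cpt (fun n => nat_of_bool (alll (@?L n) (@?P n))) => apply (@cpt_alll L P)
  | |- cpt (fun n => bsum (@?L n) (@?F n)) => apply (@cpt_bsum L F)
  | |- cpt (fun n => bmax (@?L n) (@?F n)) => apply (@cpt_bmax L F)
  | |- cpt (fun n => mkl (@?L n) (@?F n)) => apply (@cpt_mkl L F)
  | |- cpt (fun n => iteri (@?L n) (@?S n) (@?B n)) => apply (@cpt_iteri L B S)
  | |- cpt (fun n => nthc (@?f n) (@?g n)) => apply (@cpt_nthc f g)
  | |- cpt (fun n => tlc (@?f n) (@?g n)) => apply (@cpt_tlc f g)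
  | |- cpt (fun n => hdc (@?f n)) => apply (@cpt_hdc f)
  end.

Ltac use1 F H := lazymatch goal with
  |- cpt (fun n => F (@?f n)) => apply (@cpt_comp F f H) end.
Ltac use2 F H := lazymatch goal with
  |- cpt (fun n => F (@?f n) (@?g n)) => apply (@cpt_app2 F f g H) end.
Ltac use3 F H := lazymatch goal with
  |- cpt (fun n => F (@?f n) (@?g n) (@?h n)) => apply (@cpt_app3 F f g h H) end.
Ltac use4 F H := lazymatch goal with
  |- cpt (fun n => F (@?f n) (@?g n) (@?h n) (@?k n)) => apply (@cpt_app4 F f g h k H) end.
Ltac use5 F H := lazymatch goal with
  |- cpt (fun n => F (@?f n) (@?g n) (@?h n) (@?k n) (@?l n)) =>
     apply (@cpt_app5 F f g h k l H) end.
Ltac use2b F H := lazymatch goal with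
  |- cpt (fun n => nat_of_bool (F (@?f n) (@?g n))) =>
     apply (@cpt_app2 (fun x y => nat_of_bool (F x y)) f g H) end.
Ltac use3b F H := lazymatch goal with
  |- cpt (fun n => nat_of_bool (F (@?f n) (@?g n) (@?h n))) =>
     apply (@cpt_app3 (fun x y z => nat_of_bool (F x y z)) f g h H) end.
Ltac use4b F H := lazymatch goal with
  |- cpt (fun n => nat_of_bool (F (@?f n) (@?g n) (@?h n) (@?k n))) =>
     apply (@cpt_app4 (fun x y z t => nat_of_bool (F x y z t)) f g h k H) end.
Ltac use5b F H := lazymatch goal with
  |- cpt (fun n => nat_of_bool (F (@?f n) (@?g n) (@?h n) (@?k n) (@?l n))) =>
     apply (@cpt_app5 (fun x y z t u => nat_of_bool (F x y z t u)) f g h k l H) end.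

(** A hook: it is rebound as further functions are proved computable, so that [cpt_go] treats them
    as primitives instead of unfolding them. *)
Ltac cpt_ext := fail.
Ltac cpt_go := cbv beta; 
  repeat (first [ assumption | cpt_base | cpt_ext | apply cpt_if ]; cbv beta).

(** * Programs that call a subroutine *)

(** Queries depend on the input and the index but not on the accumulator. This allows the answers
    [h] to be fixed beforehand, although [sub] is only a relation. *)
Lemma loop_with_calls (L B : nat -> nat) (Q : nat -> nat -> nat)
    (S : nat -> nat -> nat -> nat -> nat) :
  cpt L -> cpt B -> cpt2 Q -> cpt4 S ->
  exists p, forall (sub : nat -> nat -> Prop) (h : nat -> nat) n,
    (forall i, i < L n -> sub (Q n i) (h i)) ->
    computes sub p n (iteri (L n) (fun i a => S n i a (h i)) (B n)).
Proof.
move=> [pL HL] [pB HB] [pQ HQ] [pS HS]; have [pI HI] := cpt_id.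
have [pX HX] : cpt (fun m => pairn (lft m) (lft (rgt m))) by cpt_go.
have [pA HA] : cpt (fun m => lft m) by cpt_go.
have [pC HC] : cpt (fun m => lft (rgt m)) by cpt_go.
have [pD HD] : cpt (fun m => rgt (rgt m)) by cpt_go.
exists (Comp (Rec pB (Comp pS (Pair pA (Pair pC (Pair pD
         (Comp Call (Comp pQ pX))))))) (Pair pI pL)) => sub h n Hsub.
apply: computes_comp (computes_pair (HI _ _) (HL _ _)) _.
elim: {-2}(L n) (leqnn (L n)) => [|k IH] kL /=; first exact: computes_rec0.
apply: computes_recS (IH (ltnW kL)) _; set a := iteri _ _ _.
set m := pairn n _.
have cQ : computes sub (Comp pQ pX) m (Q n k).
  apply: computes_comp (HX _ _) _.
  by have := HQ sub (pairn n k); rewrite /m !(lftE, rgtE).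
have cK : computes sub (Comp Call (Comp pQ pX)) m (h k).
  by apply: computes_comp cQ (computes_call _); apply: Hsub.
apply: (computes_comp (computes_pair (HA _ _) (computes_pair (HC _ _)
  (computes_pair (HD _ _) cK)))).
have := HS sub (pairn n (pairn k (pairn a (h k)))).
by rewrite /m !(lftE, rgtE).
Qed.

(** [Min] looks for a zero, hence the negated test. It returns the index alone, so [p] is run once
    more there to produce the output. *)
Lemma search_with_calls (p : program) (t : nat -> nat -> bool) (o : nat -> nat -> nat) :
  cpt (fun n => t (lft n) (rgt n)) -> cpt2 o ->
  exists p', forall (sub : nat -> nat -> Prop) (W : nat -> nat -> nat) n,
    (forall k, computes sub p (pairn n k) (W n k)) ->
    (exists k, t (pairn n k) (W n k)) ->
    exists2 k, t (pairn n k) (W n k) & computes sub p' n (o (pairn n k) (W n k)).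
Proof.
move=> ct [po Ho]; have [pI HI] := cpt_id.
have [pt Ht] := cpt_negb ct.
pose pf := Comp pt (Pair pI p).
exists (Comp (Comp po (Pair pI p)) (Pair pI (Min pf))) => sub W n HW ex.
have cf k : computes sub pf (pairn n k) (~~ t (pairn n k) (W n k)).
  apply: computes_comp (computes_pair (HI _ _) (HW k)) _.
  by have := Ht sub (pairn (pairn n k) (W n k)); rewrite !(lftE, rgtE).
case: (ex_minnP ex) => k tk kmin; exists k => //.
have cm : computes sub (Min pf) n k.
  (* Before the first success the negated test has the value 1, the successor of the constant 0
     supplied here. *)
  apply: (@computes_min _ _ _ _ (fun=> 0)) => [m mk|]; last by have := cf k; rewrite tk.
  have := cf m; case: (boolP (t _ _)) => // tm.
  by have := kmin m tm; rewrite leqNgt mk.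
apply: computes_comp (computes_pair (HI _ _) cm) _.
apply: computes_comp (computes_pair (HI _ _) (HW k)) _.
by have := Ho sub (pairn (pairn n k) (W n k)); rewrite !(lftE, rgtE).
Qed.

(** * The product automaton on codes *)

Definition maxl c (F : nat -> nat) :=
  bmax c (fun k => if tlc k c != 0 then F (nthc c k) else 0).

Definition memc x c := exl c (fun y => y == x).

Lemma memc_code x s : memc x (code_seq s) = (x \in s).
Proof. by rewrite /memc exl_code; apply/hasP/idP => [[y ys /eqP <-]|]; [|exists x]. Qed.

Lemma maxl_code s F : maxl (code_seq s) F = \max_(x <- s) F x.
Proof.
apply/eqP; rewrite eqn_leq; apply/andP; split; apply/bigmax_leqP_seq.
  move=> k _ _; rewrite tlc_neq0; case: ifP => // ks.
  by rewrite nthc_code //; apply: leq_bigmax_seq => //; apply: mem_nth.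
move=> x /(nthP 0)[k ks <-] _; rewrite /maxl /bmax.
apply: (bigmaxn_sup_seq k) => //; last by rewrite tlc_neq0 ks nthc_code.
by rewrite mem_index_iota /=; apply: leq_trans ks (size_code s).
Qed.

Lemma cpt_maxl (L : nat -> nat) (F : nat -> nat -> nat) : cpt L ->
  cpt (fun m => F (lft m) (rgt m)) -> cpt (fun n => maxl (L n) (F n)).
Proof.
move=> cL cF; apply: cpt_bmax => //.
have cLl : cpt (fun m => L (lft m)) by apply: cpt_comp => //; cpt_go.
apply: cpt_if; [by cpt_go| |by cpt_go].
have : cpt (fun m => pairn (lft m) (nthc (L (lft m)) (rgt m))) by cpt_go.
by move=> /(cpt_comp cF); apply: eq_cpt => n; rewrite !(lftE, rgtE).
Qed.

Lemma cpt_memc f g : cpt f -> cpt g -> cpt (fun n => memc (f n) (g n)).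
Proof.
move=> cf cg; apply: cpt_exl => //.
have cfl : cpt (fun m => f (lft m)) by apply: cpt_comp => //; cpt_go.
by cpt_go.
Qed.

(* A valuation is coded by the list of the codes of its values, as in code_cell. *)
Definition numc q x := lft (nthc q x).
Definition denc q x := (rgt (nthc q x)).+1.

Definition opc o a b :=
  if o == 0 then a < b else if o == 1 then a <= b else if o == 2 then a == b
  else if o == 3 then b <= a else b < a.

(** The comparison of n / d with k becomes that of n with k d. *)
Definition satc q g :=
  alll g (fun k => opc (lft (rgt k)) (numc q (lft k)) (rgt (rgt k) * denc q (lft k))).

Definition genericc M X q :=
  all_below X (fun x => (numc q x <= M * denc q x) ==> ~~ (denc q x %| numc q x)).

(** For a value n / d, the integer part is the quotient of n by d, integrality is divisibility, and
    the fractional part is the remainder over d; [frac_lec] compares two of these by cross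
    multiplication. *)
Definition equivc_at M q q' x :=
  ((M * denc q x < numc q x) && (M * denc q' x < numc q' x)) ||
  ((numc q x %/ denc q x == numc q' x %/ denc q' x) &&
   ((denc q x %| numc q x) == (denc q' x %| numc q' x))).

Definition frac_lec q x y := (numc q x %% denc q x) * denc q y <= (numc q y %% denc q y) * denc q x.

Definition equivc M X q q' :=
  all_below X (equivc_at M q q') &&
  all_below X (fun x => all_below X (fun y => (numc q x <= M * denc q x) ==>
    ((numc q y <= M * denc q y) ==> (frac_lec q x y == frac_lec q' x y)))).

Lemma cpt_double f : cpt f -> cpt (fun n => (f n).*2).
Proof.
by move=> cf; apply: (@eq_cpt (fun n => f n + f n)) => [n|]; [rewrite addnn|cpt_go].
Qed.

Lemma cpt_numc f g : cpt f -> cpt g -> cpt (fun n => numc (f n) (g n)).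
Proof. by move=> cf cg; apply: cpt_lft; apply: cpt_nthc. Qed.

Lemma cpt_denc f g : cpt f -> cpt g -> cpt (fun n => denc (f n) (g n)).
Proof. by move=> cf cg; apply: cpt_succ; apply: cpt_rgt; apply: cpt_nthc. Qed.

Ltac ext_lists := lazymatch goal with
  | |- cpt (fun n => nat_of_bool (memc (@?f n) (@?g n))) => apply (@cpt_memc f g)
  | |- cpt (fun n => maxl (@?L n) (@?F n)) => apply (@cpt_maxl L F)
  | |- cpt (fun n => numc (@?f n) (@?g n)) => apply (@cpt_numc f g)
  | |- cpt (fun n => denc (@?f n) (@?g n)) => apply (@cpt_denc f g)
  | |- cpt (fun n => double (@?f n)) => apply (@cpt_double f)
  end.
Ltac cpt_ext ::= ext_lists.

Lemma cpt_opc : cpt3 (fun o a b => nat_of_bool (opc o a b)).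
Proof.
apply: (@eq_cpt (fun n => if lft n == 0 then nat_of_bool (lft (rgt n) < rgt (rgt n)) else
  if lft n == 1 then nat_of_bool (lft (rgt n) <= rgt (rgt n)) else
  if lft n == 2 then nat_of_bool (lft (rgt n) == rgt (rgt n)) else
  if lft n == 3 then nat_of_bool (rgt (rgt n) <= lft (rgt n)) else
  nat_of_bool (rgt (rgt n) < lft (rgt n)))); last by cpt_go.
by move=> n; rewrite /opc; do 4 (case: ifP => // _).
Qed.

Ltac cpt_ext ::= first [ext_lists | use3b opc cpt_opc].

Lemma cpt_satc : cpt2 (fun q g => nat_of_bool (satc q g)).
Proof.
by rewrite /cpt2 /satc; cpt_go.
Qed.

Lemma cpt_genericc : cpt3 (fun M X q => nat_of_bool (genericc M X q)).
Proof. by rewrite /cpt3 /genericc; cpt_go. Qed.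

Lemma cpt_equivc_at : cpt4 (fun M q q' x => nat_of_bool (equivc_at M q q' x)).
Proof. by rewrite /cpt4 /equivc_at; cpt_go. Qed.

Lemma cpt_frac_lec : cpt3 (fun q x y => nat_of_bool (frac_lec q x y)).
Proof. by rewrite /cpt3 /frac_lec; cpt_go. Qed.

Ltac cpt_ext ::= first [use4b equivc_at cpt_equivc_at | use3b frac_lec cpt_frac_lec | ext_lists].

Lemma cpt_equivc : cpt4 (fun M X q q' => nat_of_bool (equivc M X q q')).
Proof.
by rewrite /cpt4 /equivc; cpt_go.
Qed.

(* Below, a is the code of a timed automaton and m that of a Muller automaton;
   their product is explored through the states i = (location, clock values in
   multiples of 1/stepden, state of m), numbered in mixed radix. *)
Definition maxc a := maxl (nthc a 4) (fun e => maxl (nthc e 1) (fun k => rgt (rgt k))).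
(** With X the set of clocks, at most |X| distinct nonzero fractional parts occur together, so steps
    of 1/(|X| + 1) realise all their orderings. *)
Definition stepden a := (nthc a 2).+1.
(** Clock values go from 0 to the maximal constant plus 1; the latter stands for every value beyond
    that constant. *)
Definition radix a := (stepden a * (maxc a).+1).+1.
Definition nstates a m := nthc a 0 * (nthc m 0 * radix a ^ nthc a 2).
Definition locc a i := i %% nthc a 0.
Definition statec a m i := i %/ nthc a 0 %% nthc m 0.
Definition clockc a m i x := i %/ (nthc a 0 * nthc m 0) %/ radix a ^ x %% radix a.
Definition valc a m i := mkl (nthc a 2) (fun x => pairn (clockc a m i x) (nthc a 2)).

(* The delay is D / (2 stepden), so that it may end between two grid points. *)
Definition nextc a m i D Y := mkl (nthc a 2) (fun x =>
  if memc x Y then 0 else pairn ((clockc a m i x).*2 + D) (stepden a).*2.-1).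

Definition samec a m i j := [&& locc a i == locc a j, statec a m i == statec a m j &
  equivc (maxc a) (nthc a 2) (valc a m i) (valc a m j)].

(** Several grid points share a region. Keeping the least one makes the nodes occupied at a given
    time unique, so that probabilities of prefixes can be added. *)
Definition canonc a m i := all_below i (fun j => ~~ samec a m i j).

Definition stepc a m s l s' := memc (pairn s (pairn (nthc (nthc a 5) l) s')) (nthc m 2).

(** With M the maximal constant, delays up to M plus half a grid step suffice ([elapse_grid]), hence
    the strict bound 2 [stepden] M + 2 on [D]. Landing on an integer up to M is excluded because
    such delays have probability 0. The guard is tested before resetting, with 0, the code of the
    empty set, as reset set. *)
Definition firec a m i j e := [&& nthc e 0 == locc a i, nthc e 3 == locc a j &
  has_below (stepden a * maxc a).*2.+2 (fun D =>
    [&& genericc (maxc a) (nthc a 2) (nextc a m i D 0), satc (nextc a m i D 0) (nthc e 1) &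
        equivc (maxc a) (nthc a 2) (nextc a m i D (nthc e 2)) (valc a m j)])].

Definition edgec a m i j := [&& canonc a m j,
  stepc a m (statec a m i) (locc a i) (statec a m j) & exl (nthc a 4) (firec a m i j)].

Definition bit S i := S %/ 2 ^ i %% 2 == 1.

Definition closedc a m S := all_below (nstates a m) (fun i => bit S i ==>
  all_below (nstates a m) (fun j => edgec a m i j ==> bit S j)).

(** Reachability is membership in every edge-closed set that contains i; the sets are the numbers
    below 2 to the [nstates a m], read in binary. *)
Definition reachc a m i j :=
  all_below (2 ^ nstates a m) (fun S => closedc a m S ==> (bit S i ==> bit S j)).

Definition recc a m t := all_below (nstates a m) (fun u => reachc a m t u ==> reachc a m u t).

(** Meant for t in a bottom component, where the states of the Muller automaton met infinitely often
    are those of the nodes reachable from t. *)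
Definition acceptc a m t := exl (nthc m 3) (fun F => all_below (nthc m 0) (fun s =>
  memc s F == has_below (nstates a m) (fun u => reachc a m t u && (statec a m u == s)))).

Definition goodc a m i := all_below (nstates a m) (fun t =>
  reachc a m i t && recc a m t ==> acceptc a m t).

Definition badc a m i := all_below (nstates a m) (fun t =>
  reachc a m i t && recc a m t ==> ~~ acceptc a m t).

(** The rational point naming a cell need not be on the grid; the canonical node of its region is
    looked up. *)
Definition cell_goodc a m c := has_below (nstates a m) (fun i =>
  [&& canonc a m i, statec a m i == nthc m 1, locc a i == lft c,
      equivc (maxc a) (nthc a 2) (rgt c) (valc a m i) & goodc a m i]).

Definition surec n := alll (nthc n 2) (cell_goodc (nthc n 0) (nthc n 1)).

(** The Dirac mass at the initial configuration charges a single cell, named by the initial location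
    and zero clocks; the first decision problem thus becomes an instance of the second. *)
Definition initc n := code_seq [:: lft n; rgt n;
  code_seq [:: pairn (nthc (lft n) 1) (mkl (nthc (lft n) 2) (fun=> 0))]].

Ltac ext_valuations := first [ext_lists | use2b satc cpt_satc | use3b genericc cpt_genericc
  | use4b equivc cpt_equivc].
Ltac cpt_ext ::= ext_valuations.

Lemma cpt_maxc : cpt maxc. Proof. by rewrite /maxc; cpt_go. Qed.

Ltac cpt_ext ::= use1 maxc cpt_maxc.

Lemma cpt_radix : cpt radix.
Proof. by rewrite /radix /stepden; cpt_go. Qed.

Ltac cpt_ext ::= use1 radix cpt_radix.

Lemma cpt_nstates : cpt2 nstates.
Proof. by rewrite /cpt2 /nstates; cpt_go. Qed.

Lemma cpt_locc : cpt2 locc. Proof. by rewrite /cpt2 /locc; cpt_go. Qed.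
Lemma cpt_statec : cpt3 statec. Proof. by rewrite /cpt3 /statec; cpt_go. Qed.

Lemma cpt_clockc : cpt4 clockc.
Proof. by rewrite /cpt4 /clockc; cpt_go. Qed.

Ltac cpt_ext ::= first [use4 clockc cpt_clockc | ext_lists].

Lemma cpt_valc : cpt3 valc.
Proof. by rewrite /cpt3 /valc; cpt_go. Qed.

Lemma cpt_nextc : cpt5 nextc.
Proof.
by rewrite /cpt5 /nextc /stepden; cpt_go. Qed.

Ltac ext_states := first [ext_valuations | use1 maxc cpt_maxc | use2 nstates cpt_nstates
  | use2 locc cpt_locc | use3 statec cpt_statec | use3 valc cpt_valc | use5 nextc cpt_nextc].
Ltac cpt_ext ::= ext_states.

Lemma cpt_samec : cpt4 (fun a m i j => nat_of_bool (samec a m i j)).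
Proof. by rewrite /cpt4 /samec; cpt_go. Qed.

Ltac cpt_ext ::= use4b samec cpt_samec.

Lemma cpt_canonc : cpt3 (fun a m i => nat_of_bool (canonc a m i)).
Proof. by rewrite /cpt3 /canonc; cpt_go. Qed.

Ltac cpt_ext ::= ext_states.

Lemma cpt_stepc : cpt5 (fun a m s l s' => nat_of_bool (stepc a m s l s')).
Proof. by rewrite /cpt5 /stepc; cpt_go. Qed.

Lemma cpt_firec : cpt5 (fun a m i j e => nat_of_bool (firec a m i j e)).
Proof. by rewrite /cpt5 /firec /stepden; cpt_go. Qed.

Ltac cpt_ext ::= first [use3b canonc cpt_canonc | use5b stepc cpt_stepc
  | use5b firec cpt_firec | ext_states].

Lemma cpt_edgec : cpt4 (fun a m i j => nat_of_bool (edgec a m i j)).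
Proof. by rewrite /cpt4 /edgec; cpt_go. Qed.

Lemma cpt_bit : cpt2 (fun S i => nat_of_bool (bit S i)).
Proof. by rewrite /cpt2 /bit; cpt_go. Qed.

Ltac cpt_ext ::= first [use2b bit cpt_bit | use4b edgec cpt_edgec | ext_states].

Lemma cpt_closedc : cpt3 (fun a m S => nat_of_bool (closedc a m S)).
Proof.
by rewrite /cpt3 /closedc; cpt_go. Qed.

Ltac cpt_ext ::= first [use2b bit cpt_bit | use3b closedc cpt_closedc | ext_states].

Lemma cpt_reachc : cpt4 (fun a m i j => nat_of_bool (reachc a m i j)).
Proof.
by rewrite /cpt4 /reachc; cpt_go. Qed.

Ltac cpt_ext ::= first [use4b reachc cpt_reachc | ext_states].

Lemma cpt_recc : cpt3 (fun a m t => nat_of_bool (recc a m t)).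
Proof. by rewrite /cpt3 /recc; cpt_go. Qed.

Lemma cpt_acceptc : cpt3 (fun a m t => nat_of_bool (acceptc a m t)).
Proof. by rewrite /cpt3 /acceptc; cpt_go. Qed.

Ltac cpt_ext ::= first [use4b reachc cpt_reachc | use3b recc cpt_recc
  | use3b acceptc cpt_acceptc | ext_states].

Lemma cpt_goodc : cpt3 (fun a m i => nat_of_bool (goodc a m i)).
Proof. by rewrite /cpt3 /goodc; cpt_go. Qed.

Lemma cpt_badc : cpt3 (fun a m i => nat_of_bool (badc a m i)).
Proof. by rewrite /cpt3 /badc; cpt_go. Qed.

Ltac cpt_ext ::= first [use3b canonc cpt_canonc | use3b goodc cpt_goodc | ext_states].

Lemma cpt_cell_goodc : cpt3 (fun a m c => nat_of_bool (cell_goodc a m c)).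
Proof. by rewrite /cpt3 /cell_goodc; cpt_go. Qed.

Ltac cpt_ext ::= use3b cell_goodc cpt_cell_goodc.

Lemma cpt_surec : cpt (fun n => nat_of_bool (surec n)).
Proof. by rewrite /surec; cpt_go. Qed.

Lemma cpt_initc : cpt initc.
Proof. by rewrite /initc /=; cpt_go. Qed.

(** * Arithmetic of the approximation *)

(* Sequences of k + 1 states are numbered in base nstates a m. *)
Definition digit a m x i := x %/ nstates a m ^ i %% nstates a m.

(** The Muller components must follow the labels from the initial state. They are then determined by
    the cells, so every run prefix follows exactly one valid sequence, and a query may mention the
    cells only. *)
Definition validc a m k x := [&& all_below k.+1 (fun i => canonc a m (digit a m x i)),
  statec a m (digit a m x 0) == nthc m 1 &
  all_below k (fun i => stepc a m (statec a m (digit a m x i)) (locc a (digit a m x i))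
                         (statec a m (digit a m x i.+1)))].

Definition nseqs a m k := nstates a m ^ k.+1.

(** Each answer is requested within e/(4N), N being the number of sequences, so that a sum of at
    most N answers is within e/4. The predecessor is due to b coding the denominator b + 1. *)
Definition precision a m k e :=
  pairn (lft e) (4 * ((rgt e).+1 * nseqs a m k)).-1.

Definition queryc a m k e x := pairn (precision a m k e)
  (mkl k.+1 (fun i => pairn (locc a (digit a m x i)) (valc a m (digit a m x i)))).

Definition add_frac p q :=
  pairn (lft p * (rgt q).+1 + lft q * (rgt p).+1) ((rgt p).+1 * (rgt q).+1).-1.

Definition add_answer a m k x acc ans := pairn
  (if validc a m k x && goodc a m (digit a m x k) then add_frac (lft acc) ans else lft acc)
  (if validc a m k x && badc a m (digit a m x k) then add_frac (rgt acc) ans else rgt acc).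

(** The test says that the good and bad estimates g and b satisfy g + b + 3e/4 >= 1, a number n / (d
    + 1) being at least 1 when d < n. It succeeds as soon as the true masses add up to 1 - e/4, each
    estimate losing at most e/4. *)
Definition enough e acc :=
  let t := add_frac (add_frac (lft acc) (rgt acc)) (pairn (3 * lft e) (4 * (rgt e).+1).-1) in
  rgt t < lft t.

Ltac cpt_ext ::= ext_states.

Lemma cpt_nseqs : cpt3 nseqs. Proof. by rewrite /cpt3 /nseqs; cpt_go. Qed.

Lemma cpt_digit : cpt4 digit. Proof. by rewrite /cpt4 /digit; cpt_go. Qed.

Ltac cpt_ext ::= first [use4 digit cpt_digit | use3b canonc cpt_canonc
  | use5b stepc cpt_stepc | use3 nseqs cpt_nseqs | ext_states].

Lemma cpt_validc : cpt4 (fun a m k x => nat_of_bool (validc a m k x)).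
Proof. by rewrite /cpt4 /validc; cpt_go. Qed.

Lemma cpt_queryc : cpt5 queryc.
Proof.
by rewrite /cpt5 /queryc /precision; cpt_go. Qed.

Lemma cpt_add_frac : cpt2 add_frac. Proof. by rewrite /cpt2 /add_frac; cpt_go. Qed.

Ltac cpt_ext ::= first [use4 digit cpt_digit | use4b validc cpt_validc
  | use3b goodc cpt_goodc | use3b badc cpt_badc | use2 add_frac cpt_add_frac].

(** There being six arguments, they are packed into a list. *)
Lemma cpt_add_answer :
  cpt (fun n => add_answer (nthc n 0) (nthc n 1) (nthc n 2) (nthc n 3) (nthc n 4) (nthc n 5)).
Proof.
by rewrite /add_answer; cpt_go. Qed.

Lemma cpt_enough : cpt2 (fun e acc => nat_of_bool (enough e acc)).
Proof.
by rewrite /cpt2 /enough; cpt_go. Qed.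

Import Order.TTheory GRing.Theory Num.Theory.
Local Open Scope ring_scope.

(** * Regions *)

Section regions_of_functions.
Variables (R : realType) (X : finType) (M : nat).
Implicit Types a b c : X -> R.

Definition req a b : Prop :=
  (forall x, (M%:R < a x /\ M%:R < b x) \/
     (Num.floor (a x) = Num.floor (b x) /\
      (a x \is a Num.int <-> b x \is a Num.int))) /\
  (forall x y, a x <= M%:R -> a y <= M%:R ->
     (frac_part (a x) <= frac_part (a y) <-> frac_part (b x) <= frac_part (b y))).

Definition in_unit (n : nat) (x : R) := (n%:R <= x) && (x < n.+1%:R).

(** Region equivalence for nonnegative values, with integer parts given as natural numbers subject
    to linear inequalities, so that [lra] applies. *)
Definition nreq a b : Prop :=
  (forall x, (M%:R < a x /\ M%:R < b x) \/
     exists n : nat, [/\ in_unit n (a x), in_unit n (b x) & (a x = n%:R <-> b x = n%:R)]) /\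
  (forall x y (m n : nat), a x <= M%:R -> a y <= M%:R ->
     in_unit m (a x) -> in_unit n (a y) ->
     (a x - m%:R <= a y - n%:R <-> b x - m%:R <= b y - n%:R)).

Lemma in_unit_ex (x : R) : 0 <= x -> exists n, in_unit n x.
Proof. by move=> /truncn_itv H; exists (Num.truncn x). Qed.

Lemma in_unit_floor (n : nat) (x : R) : in_unit n x -> Num.floor x = n.
Proof.
move=> H; apply: floor_def; rewrite -pmulrn (_ : n%:Z + 1 = n.+1%:Z) -?pmulrn //.
by lia.
Qed.

Lemma floor_in_unit (n : nat) (x : R) : 0 <= x -> Num.floor x = n -> in_unit n x.
Proof.
by move=> /in_unit_ex[m xm]; rewrite (in_unit_floor xm) => -[<-].
Qed.

Lemma in_unit_inj (m n : nat) (x : R) : in_unit m x -> in_unit n x -> m = n.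
Proof. by move=> /in_unit_floor E /in_unit_floor; rewrite E => -[]. Qed.

Lemma in_unit_int (n : nat) (x : R) : in_unit n x -> x \is a Num.int <-> x = n%:R.
Proof.
move=> xn; rewrite intrEfloor (in_unit_floor xn) -pmulrn.
by split => [/eqP|->].
Qed.

Lemma in_unit_frac (n : nat) (x : R) : in_unit n x -> frac_part x = x - n%:R.
Proof. by move=> xn; rewrite /frac_part (in_unit_floor xn) -pmulrn. Qed.

Lemma req_nreq a b : (forall x, 0 <= a x) -> (forall x, 0 <= b x) ->
  req a b <-> nreq a b.
Proof.
move=> a0 b0; split=> -[H1 H2]; split => [x|x y].
- have [|[Ef Ei]] := H1 x; first by left.
  right; have [n an] := in_unit_ex (a0 x); exists n.
  have bn : in_unit n (b x) by apply: floor_in_unit; rewrite // -Ef (in_unit_floor an).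
  by split=> //; rewrite -(in_unit_int an) -(in_unit_int bn).
- move=> m n ax ay am an.
  have same z k : a z <= M%:R -> in_unit k (a z) -> in_unit k (b z).
    move=> az ak; have [[az' _]|[Ef _]] := H1 z; first by lra.
    by apply: floor_in_unit; rewrite // -Ef (in_unit_floor ak).
  have := H2 x y ax ay; rewrite (in_unit_frac am) (in_unit_frac an).
  by rewrite (in_unit_frac (same _ _ ax am)) (in_unit_frac (same _ _ ay an)).
- have [|[n [an bn E]]] := H1 x; first by left.
  right; rewrite (in_unit_floor an) (in_unit_floor bn).
  by rewrite (in_unit_int an) (in_unit_int bn).
- move=> ax ay; have [m am] := in_unit_ex (a0 x); have [n an] := in_unit_ex (a0 y).
  have same z k : a z <= M%:R -> in_unit k (a z) -> in_unit k (b z).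
    move=> az ak; have [[az' _]|[l [al bl _]]] := H1 z; first by lra.
    by rewrite (in_unit_inj ak al).
  have := H2 x y m n ax ay am an; rewrite (in_unit_frac am) (in_unit_frac an).
  by rewrite (in_unit_frac (same _ _ ax am)) (in_unit_frac (same _ _ ay an)).
Qed.

Lemma req_refl a : req a a. Proof. by split => [x|//]; right. Qed.

(** Integer part and integrality decide whether a value exceeds [M]; hence this is a property of the
    region, on which symmetry and transitivity of [req] rest. *)
Lemma int_le_nat (x : R) :
  x <= M%:R <-> (Num.floor x < M)%R \/ (Num.floor x = M /\ x \is a Num.int).
Proof.
split => [xM|].
  have : (Num.floor x <= M)%R.
    by have := le_floor xM; rewrite [M%:R]pmulrn intrKfloor.
  rewrite le_eqVlt => /orP[/eqP E|]; [right|by left].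
  split => //; rewrite intrEfloor E -pmulrn; apply/eqP/le_anti; rewrite xM andbT.
  by have := floor_le x; rewrite E -pmulrn.
case=> [|[E]]; first by rewrite floor_lt_int -pmulrn => /ltW.
by rewrite intrEfloor E -pmulrn => /eqP <-.
Qed.

Lemma req_le a b x : req a b -> a x <= M%:R <-> b x <= M%:R.
Proof.
case=> /(_ x) [[h1 h2] _|[E1 E2] _]; first by lra.
by rewrite !int_le_nat E1 E2.
Qed.

Lemma req_sym a b : req a b -> req b a.
Proof.
move=> ab; have [H1 H2] := ab; split => [x|x y bx by_].
  have [[? ?]|[E1 E2]] := H1 x; [by left|right].
  by split; [rewrite E1|split=> h; apply/E2].
by rewrite -H2 //; apply/(req_le _ ab).
Qed.

Lemma req_trans a b c : req a b -> req b c -> req a c.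
Proof.
move=> ab bc; have [H1 H2] := ab; have [H3 H4] := bc; split => [x|x y ax ay].
  have [[ax bx]|[E1 E2]] := H1 x.
    left; split => //; rewrite ltNge; apply/negP => cx.
    by have := (req_le x bc).2 cx; lra.
  have [[bx cx]|[E3 E4]] := H3 x; last by right; rewrite E1 E2.
  left; split => //; rewrite ltNge; apply/negP => ax.
  by have := (req_le x ab).1 ax; lra.
by rewrite H2 // H4 //; apply/(req_le _ ab).
Qed.

Lemma req_beyond a b : (forall x, a x = b x \/ M%:R < a x /\ M%:R < b x) -> req a b.
Proof.
move=> ab; split => [x|x y ax ay].
  by case: (ab x) => [->|?]; [right|left].
by case: (ab x) => [->|[]]; [case: (ab y) => [->//|[]]; lra|lra].
Qed.

(** A comparison with an integer sees only the unit interval [n, n + 1) containing x and whether x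
    is its left end. *)
Lemma op_holds_in_unit (o : comparison_op) (n k : nat) (x : R) : in_unit n x ->
  op_holds o x k%:R = match o with
    | Lt => (n < k)%N | Le => (n < k)%N || ((n == k) && (x == n%:R))
    | Eq => (n == k) && (x == n%:R) | Ge => (k <= n)%N
    | Gt => (k < n)%N || ((n == k) && (x != n%:R)) end.
Proof.
move=> /[dup] xn /andP[n_le lt_n].
have lt_k : (x < k%:R) = (n < k)%N.
  apply/idP/idP => [xk|nk].
    by rewrite -(ltr_nat R); apply: le_lt_trans xk.
  by apply: lt_le_trans lt_n _; rewrite ler_nat.
have eq_k : (x == k%:R) = (n == k) && (x == n%:R).
  apply/eqP/andP => [E|[/eqP -> /eqP //]].
  have nk : n = k by apply: in_unit_inj xn _; rewrite E /in_unit lexx ltr_nat /=.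
  by rewrite E nk.
case: o => //=; first by rewrite le_eqVlt eq_k lt_k orbC.
  by rewrite leNgt lt_k -leqNgt.
rewrite lt_neqAle leNgt lt_k -leqNgt eq_sym eq_k leq_eqVlt (eq_sym k).
by case: (eqVneq n k) => [->|] /=; rewrite ?ltnn ?orbF ?andbT.
Qed.

Lemma req_op a b x (o : comparison_op) (k : nat) : (forall x, 0 <= a x) -> (forall x, 0 <= b x) ->
  (k <= M)%N -> req a b -> op_holds o (a x) k%:R = op_holds o (b x) k%:R.
Proof.
move=> a0 b0 kM /(req_nreq a0 b0)[/(_ x) H _].
have [[ax bx]|[n [an bn E]]] := H.
  have kMR : k%:R <= M%:R :> R by rewrite ler_nat.
  have ka : k%:R < a x by lra.
  have kb : k%:R < b x by lra.
  case: o => /=; [rewrite !ltNge !ltW //| rewrite !leNgt ka kb //|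
    by rewrite !gt_eqF|by rewrite !ltW|by rewrite ka kb].
rewrite !(op_holds_in_unit o k an) !(op_holds_in_unit o k bn).
have -> // : (a x == n%:R) = (b x == n%:R) by apply/eqP/eqP => /E.
Qed.

Lemma req_reset a b (Y : {set X}) : (forall x, 0 <= a x) -> (forall x, 0 <= b x) ->
  req a b -> req (fun x => if x \in Y then 0 else a x) (fun x => if x \in Y then 0 else b x).
Proof.
move=> a0 b0 /(req_nreq a0 b0)[H1 H2]; apply/req_nreq.
- by move=> x; case: ifP.
- by move=> x; case: ifP.
have u0 n : in_unit n (0 : R) -> n = 0%N.
  by move=> n0; apply: in_unit_inj n0 _; rewrite /in_unit lexx ltr01.
have agree x : a x <= M%:R -> forall n, in_unit n (a x) ->
    in_unit n (b x) /\ (a x = n%:R <-> b x = n%:R).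
  move=> ax n an; have [[ax' _]|[l [al bl E]]] := H1 x; first by lra.
  by rewrite (in_unit_inj an al).
split => [x|x y m n].
  case: ifP => // _; right; exists 0%N; split => //; by rewrite /in_unit lexx ltr01.
case: ifP => _ ax; case: ifP => _ ay am an.
- by rewrite (u0 _ am) (u0 _ an).
(* A reset clock has fractional part 0, below that of any other clock in both valuations. *)
- rewrite (u0 _ am) subr0; have [bn _] := agree y ay n an.
  by move: an bn => /andP[? _] /andP[? _]; split => _; lra.
(* Conversely, a clock is below a reset one only when its value is an integer, which the region
   determines. *)
- rewrite (u0 _ an) subr0; have [bm E] := agree x ax m am.
  move: am bm => /andP[h1 _] /andP[h2 _]; split => h.
    by have /E -> : a x = m%:R by [lra]; rewrite subrr.
  by have /E -> : b x = m%:R by [lra]; rewrite subrr.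
- exact: H2.
Qed.

Definition generic a (d : R) := forall x, a x + d <= M%:R -> a x + d \isn't a Num.int.

Lemma exists_max (s : seq R) : exists2 l, l = 0 \/ l \in s & 0 <= l /\ {in s, forall u, u <= l}.
Proof.
elim: s => [|u s [l ls [l0 sl]]]; first by exists 0; [left|].
have [ul|lu] := leP u l.
  exists l; first by case: ls => [->|ls]; [left|right; rewrite in_cons ls orbT].
  by split => // v; rewrite in_cons => /predU1P[->//|]; apply: sl.
exists u; first by right; rewrite mem_head.
split; first exact: ltW (le_lt_trans l0 lu).
by move=> v; rewrite in_cons => /predU1P[->//|/sl vl]; apply: le_trans vl (ltW lu).
Qed.

Lemma exists_gap (s : seq R) (l : R) : {in s, forall u, l < u} ->
  exists2 r, 0 < r & {in s, forall u, l + r < u}.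
Proof.
elim: s => [|u s IH] H; first by exists 1.
have [v vs|r r0 Hr] := IH; first by apply: H; rewrite in_cons vs orbT.
have lu : l < u by apply: H; rewrite mem_head.
exists (Num.min r ((u - l) / 2)) => [|v].
  by rewrite lt_min r0 /=; lra.
rewrite in_cons => /predU1P[->|vs].
  have : Num.min r ((u - l) / 2) <= (u - l) / 2 by rewrite ge_min lexx orbT.
  by lra.
have : Num.min r ((u - l) / 2) <= r by rewrite ge_min lexx.
by have := Hr v vs; lra.
Qed.

(* The delays d' that bring b to the region of a + d form an open interval: since
   fractional parts are ordered alike in a and b, the lower bounds required by the
   clocks are below the upper bounds. *)
Lemma elapse_window a b (d : R) : (forall x, 0 <= a x) -> (forall x, 0 <= b x) -> 0 <= d ->
  req a b -> generic a d ->
  exists l (U : X -> nat),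
    [/\ 0 <= l <= M%:R, l = 0 \/ exists x (k : nat), l = k%:R - b x,
       forall x, a x + d <= M%:R -> l < (U x)%:R - b x &
       forall d', l < d' -> (forall x, a x + d <= M%:R -> d' < (U x)%:R - b x) ->
         req (fun x => a x + d) (fun x => b x + d')].
Proof.
move=> a0 b0 d0 rab gen; have [H1 H2] := (req_nreq a0 b0).1 rab.
have bM x : a x <= M%:R -> b x <= M%:R by move/(req_le x rab).
have ad0 x : 0 <= a x + d by rewrite addr_ge0.
pose n x := Num.truncn (a x).
have an x : in_unit (n x) (a x) by exact: truncn_itv.
have bn x : a x <= M%:R -> in_unit (n x) (b x).
  by move=> ax; have [[ax' _]|[l [al bl E]]] := H1 x; [lra|rewrite (in_unit_inj (an x) al)].
pose m x := Num.truncn (a x + d).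
have am x : in_unit (m x) (a x + d) by exact: truncn_itv.
have am_lt x : a x + d <= M%:R -> (m x)%:R < a x + d.
  move=> adM; have /andP[h _] := am x; rewrite lt_neqAle h andbT; apply/eqP => E.
  by have /negP := gen x adM; apply; apply/(in_unit_int (am x)).
(* The integer that clock x has to exceed after the delay: the one just passed, or [M] if the clock
   ends beyond it. *)
pose k x := if a x + d <= M%:R then m x else M.
have k_le x : (k x)%:R <= a x + d.
  rewrite /k; case: (leP (a x + d)) => h; last exact: ltW.
  by have /andP[] := am x.
have key x y : a x <= M%:R -> a y + d <= M%:R -> (k x)%:R - b x < (m y).+1%:R - b y.
  move=> ax ady; have ay : a y <= M%:R by lra.
  have := H2 x y (n x) (n y) ax ay (an x) (an y).
  have /andP[] := an x; have /andP[] := an y.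
  have /andP[] := bn x ax; have /andP[] := bn y ay.
  have := k_le x; have /andP[_] := am y.
  (* Compare i = k x - n x with j = (m y).+1 - n y. If i < j, the inequality holds whatever the
     fractional parts. If i = j, it says that y has a smaller fractional part than x in b; the delay
     d shows this in a, and the orders agree. The case i > j contradicts the existence of d. *)
  have [lt1|[eq1|gt1]] : (k x + n y < (m y).+1 + n x)%N \/
      (k x + n y = (m y).+1 + n x)%N \/ ((m y).+1 + n x < k x + n y)%N by lia.
  - have : (k x).+1%:R + (n y)%:R <= (m y).+1%:R + (n x)%:R :> R.
      by rewrite -!natrD ler_nat.
    rewrite -!natr1; lra.
  - have : (k x)%:R + (n y)%:R = (m y).+1%:R + (n x)%:R :> R.
      by rewrite -!natrD eq1.
    rewrite -!natr1 => E h1 h2 h3 h4 h5 h6 h7 h8 h9 h10 [_ h11].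
    rewrite ltNge; apply/negP => h.
    by have : a x - (n x)%:R <= a y - (n y)%:R by [apply: h11; lra]; lra.
  - have : (m y).+2%:R + (n x)%:R <= (k x)%:R + (n y)%:R :> R.
      by rewrite -!natrD ler_nat.
    rewrite -!natr1; lra.
(* Clocks beyond [M] in a are so in b as well and impose no lower bound. *)
have [l ls [l0 lmax]] := exists_max [seq (k x)%:R - b x | x <- enum X & a x <= M%:R].
have lk x : a x <= M%:R -> (k x)%:R - b x <= l.
  by move=> ax; apply: lmax; apply: map_f; rewrite mem_filter ax mem_enum.
have lex : l = 0 \/ exists2 x, a x <= M%:R & l = (k x)%:R - b x.
  case: ls => [|/mapP[x]]; first by left.
  by rewrite mem_filter => /andP[ax _] E; right; exists x.
exists l, (fun x => (m x).+1); split.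
- rewrite l0 /=; case: lex => [->|[x ax ->]]; first exact: ler0n.
  have : (k x)%:R <= M%:R :> R.
    rewrite ler_nat /k; case: leP => // adM.
    by rewrite -(ler_nat R); exact: ltW (lt_le_trans (am_lt x adM) adM).
  by have := b0 x; lra.
- by case: lex => [|[x ax ->]]; [left|right; exists x, (k x)].
- move=> y ady; case: lex => [->|[x ax ->]]; last exact: key.
  have ay : a y <= M%:R by lra.
  have /andP[_] := bn y ay.
  have : (n y)%:R <= (m y)%:R :> R by rewrite ler_nat; apply: le_truncn; lra.
  rewrite -!natr1; lra.
move=> d' ld' ud'.
have d'0 : 0 <= d' by exact/ltW/(le_lt_trans l0).
have inb x : a x + d <= M%:R -> in_unit (m x) (b x + d') /\ b x + d' <> (m x)%:R.
  move=> adx; have := ud' x adx; have := lk x; rewrite /k adx => h1 h2.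
  have ax : a x <= M%:R by lra.
  have {}h1 := h1 ax; split; last by move=> E; lra.
  by rewrite /in_unit; apply/andP; split; lra.
apply/req_nreq; [by []|by move=> x; rewrite addr_ge0|].
split => [x|x y i j ax ay ai aj].
  have [adM|adM] := leP (a x + d) M%:R.
    right; exists (m x); have [h1 h2] := inb x adM; split => //.
    by split => h; [have := am_lt x adM; lra|].
  left; split => //; have [ax|] := leP (a x) M%:R.
    by have := lk x ax; rewrite /k (leNgt (a x + d)) adM /=; lra.
  have [bx h|] := leP (b x) M%:R; last by lra.
  by have := (req_le x rab).2 bx; lra.
rewrite (in_unit_inj ai (am x)) (in_unit_inj aj (am y)).
have ax' : a x <= M%:R by lra.
have ay' : a y <= M%:R by lra.
have := H2 x y (n x) (n y) ax' ay' (an x) (an y).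
have /andP[] := an x; have /andP[] := an y.
have /andP[] := bn x ax'; have /andP[] := bn y ay'.
(* The clock that crossed more integers ends with the smaller fractional part; if both crossed
   equally many, their initial order persists. *)
have [lt1|[eq1|gt1]] : (m x + n y < m y + n x)%N \/
    (m x + n y = m y + n x)%N \/ (m y + n x < m x + n y)%N by lia.
- have : (m x).+1%:R + (n y)%:R <= (m y)%:R + (n x)%:R :> R.
    by rewrite -!natrD ler_nat.
  by rewrite -!natr1 => E h1 h2 h3 h4 h5 h6 h7 h8 _; split => h; lra.
- have : (m x)%:R + (n y)%:R = (m y)%:R + (n x)%:R :> R.
    by rewrite -!natrD eq1.
  rewrite -!natr1 => E h1 h2 h3 h4 h5 h6 h7 h8 [h9 h10].
  by split => h; [have := h9 _|have := h10 _]; lra.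
- have : (m y).+1%:R + (n x)%:R <= (m x)%:R + (n y)%:R :> R.
    by rewrite -!natrD ler_nat.
  by rewrite -!natr1 => E h1 h2 h3 h4 h5 h6 h7 h8 _; split => _; lra.
Qed.

(** An open window contains a ball, which is what [full_support] charges. The radius depends on b
    and has no positive lower bound over the region. *)
Lemma elapse_ball a b (d : R) : (forall x, 0 <= a x) -> (forall x, 0 <= b x) -> 0 <= d ->
  req a b -> generic a d ->
  exists d0 r, [/\ 0 <= d0, 0 < r & forall d', `|d' - d0| < r ->
    req (fun x => a x + d) (fun x => b x + d')].
Proof.
move=> a0 b0 d0 rab gen; have [l [U [/andP[l0 _] _ lU H]]] := elapse_window a0 b0 d0 rab gen.
have [|r r0 Hr] := @exists_gap [seq (U x)%:R - b x | x <- enum X & a x + d <= M%:R] l.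
  by move=> u /mapP[x]; rewrite mem_filter => /andP[adx _] ->; apply: lU.
exists (l + r / 2), (r / 2); split; [lra|lra|move=> d'].
rewrite ltr_norml => /andP[h1 h2]; apply: H => [|x adx]; first lra.
have : l + r < (U x)%:R - b x by apply: Hr; apply: map_f; rewrite mem_filter adx mem_enum.
by lra.
Qed.

(** From a grid point all ends of the window are multiples L/K of the grid step, so the delay half a
    step above its lower end works: this is D = 2L + 1 in units of 1/(2K), and the lower end is at
    most [M]. *)
Lemma elapse_grid a (v : X -> nat) (K : nat) (d : R) : (forall x, 0 <= a x) -> (0 < K)%N ->
  0 <= d -> req a (fun x => (v x)%:R / K%:R) -> generic a d ->
  exists2 D : nat, (D <= (K * M).*2.+1)%N &
    req (fun x => a x + d) (fun x => (v x)%:R / K%:R + D%:R / (K.*2)%:R).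
Proof.
move=> a0 K0 d0 rab gen.
have KR : 0 < K%:R :> R by rewrite ltr0n.
have b0 x : 0 <= (v x)%:R / K%:R :> R by rewrite divr_ge0.
have [l [U [/andP[l0 lM] lex lU H]]] := elapse_window a0 b0 d0 rab gen.
have [L El] : exists L : nat, l = L%:R / K%:R.
  case: lex => [->|[x [k E]]]; first by exists 0%N; rewrite mul0r.
  have E' : l = (k%:R * K%:R - (v x)%:R) / K%:R by rewrite E mulrBl mulfK ?gt_eqF.
  have vk : (v x <= k * K)%N.
    rewrite -(ler_nat R) natrM -subr_ge0.
    by have := l0; rewrite E' pmulr_lge0 ?invr_gt0.
  by exists (k * K - v x)%N; rewrite E' natrB // natrM.
have dE : (L.*2.+1)%:R / (K.*2)%:R = l + (K.*2)%:R^-1 :> R.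
  rewrite El -!muln2 -addn1 natrD !natrM; field; rewrite gt_eqF //.
have K2 : 0 < (K.*2)%:R^-1 :> R by rewrite invr_gt0 ltr0n double_gt0.
exists L.*2.+1.
  rewrite ltnS leq_double; move: lM; rewrite El ler_pdivrMr // -natrM ler_nat.
  by rewrite mulnC.
rewrite dE; apply: H => [|x adx]; first lra.
have := lU x adx.
have Ux : (U x)%:R - (v x)%:R / K%:R = ((U x)%:R * K%:R - (v x)%:R) / K%:R :> R.
  by rewrite mulrBl mulfK ?gt_eqF.
rewrite Ux El !ltr_pdivlMr // mulfVK ?gt_eqF // => h.
have h' : (L + v x < U x * K)%N by rewrite -(ltr_nat R) natrD natrM; lra.
have : (L.+1 + v x)%:R <= (U x * K)%:R :> R by rewrite ler_nat.
rewrite natrD natrM -natr1 mulrDl mulfVK ?gt_eqF // => h2.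
have : (K.*2)%:R^-1 * K%:R < 1 :> R.
  rewrite mulrC ltr_pdivrMr ?ltr0n ?double_gt0 // mul1r ltr_nat.
  by rewrite -addnn -[X in (X < _)%N]addn0 ltn_add2l.
lra.
Qed.

Lemma req_reset_or_beyond a b : (forall x, 0 <= a x) -> (forall x, 0 <= b x) -> req a b ->
  (forall x, a x = 0 \/ M%:R < a x) -> forall x, b x = a x \/ M%:R < a x /\ M%:R < b x.
Proof.
move=> a0 b0 rab H x; have [E|ax] := H x.
  have [[h _]|[n [an bn En]]] := ((req_nreq a0 b0).1 rab).1 x.
    by have := ler0n R M; lra.
  have n0 : n = 0%N by apply: in_unit_inj an _; rewrite E /in_unit lexx ltr01.
  by left; rewrite E; rewrite n0 E in En; apply/En.
right; split=> //; rewrite ltNge; apply/negP => /(req_le x rab).2; lra.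
Qed.

(** Replace each fractional part by its rank [r x] among the positive ones: ranks are below K = |X|
    + 1, are ordered as the fractional parts and vanish with them. Clocks beyond [M] are put at [M]
    + 1. *)
Lemma grid_representation a : (forall x, 0 <= a x) ->
  exists2 v : X -> nat, forall x, (v x <= #|X|.+1 * M.+1)%N &
    req a (fun x => (v x)%:R / #|X|.+1%:R).
Proof.
move=> a0; set K := #|X|.+1.
have KR : 0 < K%:R :> R by rewrite ltr0n.
pose n x := Num.truncn (a x); pose f x := a x - (n x)%:R.
have an x : in_unit (n x) (a x) by exact: truncn_itv.
have f0 x : 0 <= f x by have /andP[] := an x; rewrite /f; lra.
pose r x := #|[set y | 0 < f y <= f x]|.
have rK x : (r x < K)%N by rewrite ltnS; apply: max_card.
have r_gt0 x : (0 < r x)%N = (0 < f x).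
  apply/card_gt0P/idP => [[y]|fx].
    by rewrite inE => /andP[h1 h2]; apply: lt_le_trans h2.
  by exists x; rewrite inE fx lexx.
have r_le x y : (r x <= r y)%N = (f x <= f y).
  apply/idP/idP => [|fxy]; last first.
    by apply/subset_leq_card/fintype.subsetP => z; rewrite !inE => /andP[-> /le_trans]; apply.
  move=> h; rewrite leNgt; apply/negP => fyx; move: h; apply/negP; rewrite -ltnNge.
  apply: proper_card; apply/properP; split.
    by apply/fintype.subsetP => z; rewrite !inE => /andP[-> /le_trans]; apply; apply: ltW.
  by exists x; rewrite !inE ?lexx ?andbT ?(le_lt_trans (f0 y)) // -ltNge.
pose v x := if a x <= M%:R then (K * n x + r x)%N else (K * M.+1)%N.
have vE x : a x <= M%:R -> (v x)%:R / K%:R = (n x)%:R + (r x)%:R / K%:R :> R.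
  by move=> ax; rewrite /v ax natrD natrM mulrDl mulrAC divff ?mul1r // gt_eqF.
have rK1 x : (0 <= (r x)%:R / K%:R :> R) && ((r x)%:R / K%:R < 1 :> R).
  by rewrite divr_ge0 //= ltr_pdivrMr // mul1r ltr_nat.
have vn x : a x <= M%:R -> in_unit (n x) ((v x)%:R / K%:R : R).
  by move=> ax; rewrite vE // /in_unit -natr1; have /andP[h1 h2] := rK1 x; apply/andP; split; lra.
exists v => [x|].
  rewrite /v; case: ifP => // ax.
  have : (n x <= M)%N.
    rewrite -(ler_nat R); have /andP[h _] := an x; exact: le_trans ax.
  have := rK x; rewrite /K; nia.
have v0 x : 0 <= (v x)%:R / K%:R :> R by rewrite divr_ge0.
apply/(req_nreq a0 v0).
split => [x|x y i j ax ay ai aj].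
  have [ax|ax] := leP (a x) M%:R.
    right; exists (n x); split => //; first exact: vn.
    rewrite vE //; have := r_gt0 x; rewrite /f; have := rK1 x => /andP[h1 _].
    split => E.
      have : (r x == 0)%N by rewrite -leqn0 leqNgt r_gt0 /f E subrr ltxx.
      by move=> /eqP ->; rewrite mul0r addr0.
    have rx0 : (r x)%:R / K%:R = 0 :> R by lra.
    have : (r x == 0)%N.
      by move/eqP: rx0; rewrite mulf_eq0 invr_eq0 pnatr_eq0 (gt_eqF KR) orbF.
    by rewrite -leqn0 leqNgt r_gt0 /f -leNgt; have /andP[] := an x; lra.
  left; split => //; rewrite /v leNgt ax /= natrM mulrAC divff ?mul1r ?gt_eqF //.
  by rewrite ltr_nat.
rewrite (in_unit_inj ai (an x)) (in_unit_inj aj (an y)).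
rewrite -/(f x) -/(f y) -r_le !vE // ![(n _)%:R + _]addrC !addrK.
by rewrite ler_pM2r ?invr_gt0 // ler_nat.
Qed.

End regions_of_functions.

(** * Decoding *)

Lemma all_below_enum (T : finType) (P : nat -> bool) :
  all_below #|T| P = [forall x : T, P (code_elt x)].
Proof.
apply/all_belowP/forallP => [H x|H i lti]; first by apply: H; exact: ltn_ord.
by have := H (enum_val (Ordinal lti)); rewrite /code_elt enum_valK.
Qed.

Lemma memc_set (T : finType) (S : {set T}) x : memc (code_elt x) (code_set S) = (x \in S).
Proof.
rewrite /code_set memc_code mem_map ?mem_enum // => y z /ord_inj; exact: enum_rank_inj.
Qed.

Section rational_arithmetic.
Variable R : realType.
Implicit Types n d k M : nat.

Lemma frac_le n d k : (0 < d)%N -> (n%:R / d%:R <= k%:R :> R) = (n <= k * d)%N.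
Proof. by move=> d0; rewrite ler_pdivrMr ?ltr0n // -natrM ler_nat. Qed.

Lemma frac_in_unit n d : (0 < d)%N -> in_unit (n %/ d) (n%:R / d%:R : R).
Proof.
move=> d0; rewrite /in_unit ler_pdivlMr ?ltr0n // ltr_pdivrMr ?ltr0n // -!natrM.
by rewrite ler_nat ltr_nat leq_divM ltn_ceil.
Qed.

Lemma frac_nat n d k : (0 < d)%N -> (n%:R / d%:R == k%:R :> R) = (n == k * d)%N.
Proof.
move=> d0; have dn : d%:R != 0 :> R by rewrite pnatr_eq0 -lt0n.
by rewrite (can2_eq (mulfVK dn) (mulfK dn)) -natrM eqr_nat.
Qed.

Lemma frac_int n d : (0 < d)%N -> (n%:R / d%:R == (n %/ d)%:R :> R) = (d %| n)%N.
Proof. by move=> d0; rewrite frac_nat // eq_sym -dvdn_eq. Qed.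

Lemma frac_sub n d : (0 < d)%N -> n%:R / d%:R - (n %/ d)%:R = (n %% d)%:R / d%:R :> R.
Proof.
move=> d0; rewrite {1}(divn_eq n d) natrD natrM mulrDl mulfK ?gt_eqF ?ltr0n //.
by rewrite addrAC subrr add0r.
Qed.

Lemma frac_le2 n d n' d' : (0 < d)%N -> (0 < d')%N ->
  (n%:R / d%:R <= n'%:R / d'%:R :> R) = (n * d' <= n' * d)%N.
Proof.
move=> d0 d'0; rewrite ler_pdivrMr ?ltr0n // mulrAC ler_pdivlMr ?ltr0n //.
by rewrite -!natrM ler_nat.
Qed.

End rational_arithmetic.

Section valuations.
Variables (R : realType) (AP : finType) (A : timed_automaton AP).
Implicit Types q : {ffun clock A -> nat}.

Definition code_val q := code_seq [seq q x | x <- enum (clock A)].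

Lemma nthc_val q x : nthc (code_val q) (code_elt x) = q x.
Proof.
have lt_x : (code_elt x < size (enum (clock A)))%N by rewrite -cardE; exact: ltn_ord.
have := @nthc_code [seq q x | x <- enum (clock A)] (code_elt x).
by rewrite size_map => /(_ lt_x) ->; rewrite (nth_map x) // nth_enum_rank.
Qed.

Definition clk (v : valuation R A) x : R := real_of (v x).

Lemma clk_ge0 v x : 0 <= clk v x. Proof. by rewrite /clk /real_of. Qed.

Lemma region_equivE v v' : region_equiv v v' = req (max_const A) (clk v) (clk v').
Proof. by []. Qed.

Lemma clk_rat q x : clk (rat_valuation R q) x =
  (numc (code_val q) (code_elt x))%:R / (denc (code_val q) (code_elt x))%:R.
Proof. by rewrite /numc /denc nthc_val. Qed.

(** Both directions go through [nreq], the natural numbers in it being the Euclidean quotients. *)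
Lemma equivcP q q' : reflect (region_equiv (rat_valuation R q) (rat_valuation R q'))
  (equivc (max_const A) #|clock A| (code_val q) (code_val q')).
Proof.
set M := max_const A.
have ge0 p x : 0 <= clk (rat_valuation R p) x by apply: clk_ge0.
rewrite region_equivE; apply: (iffP idP) => [H|H].
  apply/req_nreq => //; move: H; rewrite /equivc !all_below_enum.
  move=> /andP[/forallP H1 /forallP H2]; split => [x|x y i j].
    rewrite !clk_rat; have /orP[/andP[h1 h2]|/andP[/eqP h1 /eqP h2]] := H1 x.
      by left; rewrite !ltNge !frac_le // -!ltnNge.
    right; exists (numc (code_val q) (code_elt x) %/ denc (code_val q) (code_elt x))%N.
    split; [exact: frac_in_unit|rewrite h1; exact: frac_in_unit|].
    split => /eqP h; apply/eqP; first by rewrite h1 frac_int // -h2 -(frac_int R).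
    by rewrite frac_int // h2 -(frac_int R) // -h1.
  rewrite !clk_rat !frac_le // => hx hy hi hj.
  have same (z : clock A) k :
      (numc (code_val q) (code_elt z) <= M * denc (code_val q) (code_elt z))%N ->
      in_unit k ((numc (code_val q) (code_elt z))%:R / (denc (code_val q) (code_elt z))%:R : R) ->
      k = (numc (code_val q) (code_elt z) %/ denc (code_val q) (code_elt z))%N /\
      k = (numc (code_val q') (code_elt z) %/ denc (code_val q') (code_elt z))%N.
    move=> hz /(fun h => in_unit_inj h (frac_in_unit R _ (ltn0Sn _))) ->; split => //.
    have /orP[/andP[h1 h2]|/andP[/eqP h1 _]] := H1 z => //.
    by rewrite leqNgt h1 in hz.
  have [i1 i2] := same x i hx hi; have [j1 j2] := same y j hy hj.
  rewrite {1}i1 {1}j1 i2 j2 !frac_sub // !frac_le2 //.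
  have := H2 x; rewrite all_below_enum => /forallP/(_ y); rewrite hx hy /= => /eqP.
  by rewrite /frac_lec => ->.
have [H1 H2] := (req_nreq _ (ge0 q) (ge0 q')).1 H.
have le_ge (z : clock A) :
    (numc (code_val q) (code_elt z) <= M * denc (code_val q) (code_elt z))%N =
    (clk (rat_valuation R q) z <= M%:R) by rewrite clk_rat frac_le.
rewrite /equivc !all_below_enum; apply/andP; split; apply/forallP => x.
  rewrite /equivc_at; have := H1 x; rewrite !clk_rat => -[[]|[n [h1 h2 h3]]].
    by rewrite !ltNge !frac_le // -!ltnNge => -> ->.
  apply/orP; right.
  have E1 := in_unit_inj h1 (frac_in_unit R _ (ltn0Sn _)).
  have E2 := in_unit_inj h2 (frac_in_unit R _ (ltn0Sn _)).
  rewrite -E1 -[X in (_ == X)%N]E2 eqxx /=; apply/eqP.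
  rewrite -(frac_int R) // -[RHS](frac_int R) // -E1 -E2.
  by apply/eqP/eqP => /h3.
rewrite all_below_enum; apply/forallP => y; apply/implyP => hx; apply/implyP => hy.
have := H2 x y (numc (code_val q) (code_elt x) %/ denc (code_val q) (code_elt x))%N
   (numc (code_val q) (code_elt y) %/ denc (code_val q) (code_elt y))%N.
rewrite -!le_ge => /(_ hx hy); rewrite !clk_rat => /(_ _ _)/[dup].
have same (z : clock A) :
    (numc (code_val q) (code_elt z) <= M * denc (code_val q) (code_elt z))%N ->
    (numc (code_val q) (code_elt z) %/ denc (code_val q) (code_elt z) =
     numc (code_val q') (code_elt z) %/ denc (code_val q') (code_elt z))%N.
  move=> hz; have := H1 z; rewrite !clk_rat => -[[]|[n [h1 h2 _]]].
    by rewrite ltNge frac_le // hz.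
  rewrite -(in_unit_inj h1 (frac_in_unit R _ (ltn0Sn _))).
  exact: (in_unit_inj h2 (frac_in_unit R _ (ltn0Sn _))).
move=> /(_ (frac_in_unit R _ (ltn0Sn _)) (frac_in_unit R _ (ltn0Sn _))) + _.
rewrite !frac_sub // (same x) // (same y) // !frac_sub // !frac_le2 //.
by rewrite /frac_lec => h; apply/eqP; apply/idP/idP => /h.
Qed.

Lemma opcE o n d k : (0 < d)%N -> opc (nat_of_op o) n (k * d) = op_holds o (n%:R / d%:R : R) k%:R.
Proof.
move=> d0; case: o => /=; rewrite /opc /=.
- by rewrite ltNge ler_pdivlMr ?ltr0n // -natrM ler_nat -ltnNge.
- by rewrite frac_le.
- by rewrite frac_nat.
- by rewrite ler_pdivlMr ?ltr0n // -natrM ler_nat.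
- by rewrite ltNge frac_le // -ltnNge.
Qed.

Lemma satcE q (g : guard (clock A)) :
  satc (code_val q) (code_guard g) = satisfies (rat_valuation R q) g.
Proof.
rewrite /satc /code_guard alll_code all_map /satisfies; apply: eq_all => -[[x o] k] /=.
by rewrite !(lftE, rgtE) opcE // -clk_rat.
Qed.

Lemma genericcP q : reflect
  (forall x, clk (rat_valuation R q) x <= (max_const A)%:R ->
     clk (rat_valuation R q) x \isn't a Num.int)
  (genericc (max_const A) #|clock A| (code_val q)).
Proof.
rewrite /genericc all_below_enum; apply: (iffP forallP) => H x.
  rewrite clk_rat frac_le // => h; have := H x; rewrite h /=; apply: contra => hi.
  by rewrite -(frac_int R) //; apply/eqP/(in_unit_int (frac_in_unit R _ _)).
apply/implyP => h; have := H x; rewrite !clk_rat frac_le // => /(_ h).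
by apply: contra => hd; apply/(in_unit_int (frac_in_unit R _ _)) => //; apply/eqP; rewrite frac_int.
Qed.

End valuations.

Section product_states.
Variables (AP : finType) (A : timed_automaton AP) (M : muller AP).
Notation a := (code_ta A).
Notation m := (code_muller M).

Lemma nlocE : nthc a 0 = #|loc A|. Proof. by rewrite nthc_code. Qed.
Lemma init_locE : nthc a 1 = code_elt (loc0 A). Proof. by rewrite nthc_code. Qed.
Lemma nclockE : nthc a 2 = #|clock A|. Proof. by rewrite nthc_code. Qed.
Lemma edgesE : nthc a 4 = code_seq [seq code_edge e | e <- edges A].
Proof. by rewrite nthc_code. Qed.
Lemma labelsE : nthc a 5 = code_seq [seq code_set (label l) | l <- enum (loc A)].
Proof. by rewrite nthc_code. Qed.
Lemma nstateE : nthc m 0 = #|mstate M|. Proof. by rewrite nthc_code. Qed.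
Lemma init_stateE : nthc m 1 = code_elt (minit M). Proof. by rewrite nthc_code. Qed.
Lemma transE : nthc m 2 = code_seq [seq pairn (code_elt t.1)
    (pairn (code_set t.2) (code_elt (mstep t.1 t.2))) | t <- enum {: mstate M * {set AP}}].
Proof. by rewrite nthc_code. Qed.
Lemma finalE : nthc m 3 = code_seq [seq code_set F | F <- enum (mfinal M)].
Proof. by rewrite nthc_code. Qed.

Lemma edge_sourceE (e : edge (loc A) (clock A)) : nthc (code_edge e) 0 = code_elt (source e).
Proof. by rewrite nthc_code. Qed.
Lemma edge_guardE (e : edge (loc A) (clock A)) : nthc (code_edge e) 1 = code_guard (eguard e).
Proof. by rewrite nthc_code. Qed.
Lemma edge_resetsE (e : edge (loc A) (clock A)) : nthc (code_edge e) 2 = code_set (resets e).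
Proof. by rewrite nthc_code. Qed.
Lemma edge_targetE (e : edge (loc A) (clock A)) : nthc (code_edge e) 3 = code_elt (target e).
Proof. by rewrite nthc_code. Qed.

Lemma maxcE : maxc a = max_const A.
Proof.
rewrite /maxc edgesE maxl_code big_map /max_const; apply: eq_bigr => e _.
rewrite edge_guardE maxl_code big_map; apply: eq_bigr => k _.
by rewrite !rgtE.
Qed.

Lemma guard_le_max (e : edge (loc A) (clock A)) k :
  e \in edges A -> k \in eguard e -> (k.2 <= max_const A)%N.
Proof.
move=> eA kg; rewrite /max_const; apply: (bigmaxn_sup_seq e) => //.
by apply: (bigmaxn_sup_seq k).
Qed.

Lemma loc_gt0 : (0 < #|loc A|)%N. Proof. by apply/card_gt0P; exists (loc0 A). Qed.
Lemma state_gt0 : (0 < #|mstate M|)%N. Proof. by apply/card_gt0P; exists (minit M). Qed.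

Definition loc_at i : loc A := nth (loc0 A) (enum (loc A)) (locc a i).
Definition state_at i : mstate M := nth (minit M) (enum (mstate M)) (statec a m i).
Definition grid_at i : clock A -> nat := fun x => clockc a m i (code_elt x).
Definition val_at i : {ffun clock A -> nat} := [ffun x => pairn (grid_at i x) #|clock A|].
Definition cell_at i : cell A := (loc_at i, val_at i).

Lemma code_elt_nth (T : finType) (x0 : T) k : (k < #|T|)%N -> code_elt (nth x0 (enum T) k) = k.
Proof.
move=> kT; rewrite /code_elt -{1}[k]/(nat_of_ord (Ordinal kT)).
by rewrite -enum_val_nth enum_valK.
Qed.

Lemma code_elt_inj (T : finType) : injective (@code_elt T).
Proof. by move=> x y /ord_inj /enum_rank_inj. Qed.

Lemma code_loc_at i : code_elt (loc_at i) = locc a i.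
Proof. by rewrite /loc_at code_elt_nth // /locc nlocE ltn_mod loc_gt0. Qed.

Lemma code_state_at i : code_elt (state_at i) = statec a m i.
Proof. by rewrite /state_at code_elt_nth // /statec nstateE ltn_mod state_gt0. Qed.

Lemma mkl_enum (T : finType) (F : nat -> nat) (f : T -> nat) :
  (forall x, F (code_elt x) = f x) -> mkl #|T| F = code_seq [seq f x | x <- enum T].
Proof.
move=> Ff; rewrite mkl_code; congr code_seq; apply: (@eq_from_nth _ 0%N) => [|k].
  by rewrite size_mkseq size_map -cardE.
rewrite size_mkseq => kT; rewrite nth_mkseq //.
have x0 : T by apply: (enum_val (Ordinal kT)).
by rewrite (nth_map x0) -?cardE // -Ff code_elt_nth.
Qed.

Lemma valcE i : valc a m i = code_val (val_at i).
Proof.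
rewrite /valc nclockE; apply: mkl_enum => x; by rewrite ffunE.
Qed.

Lemma code_cell_at i : code_cell (cell_at i) = pairn (locc a i) (valc a m i).
Proof. by rewrite /code_cell /= code_loc_at valcE. Qed.

Definition next_val i (D : nat) (Y : {set clock A}) : {ffun clock A -> nat} :=
  [ffun x => if x \in Y then 0%N else pairn ((grid_at i x).*2 + D) (#|clock A|.+1).*2.-1].

Lemma nextcE i D Y : nextc a m i D (code_set Y) = code_val (next_val i D Y).
Proof.
rewrite /nextc /stepden nclockE; apply: mkl_enum => x.
by rewrite ffunE memc_set.
Qed.

Lemma nextc0E i D : nextc a m i D 0 = code_val (next_val i D finset.set0).
Proof. by rewrite -nextcE /code_set enum_set0. Qed.

Lemma stepcE i (l : loc A) (s' : mstate M) :
  stepc a m (statec a m i) (code_elt l) (code_elt s') = (s' == mstep (state_at i) (label l)).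
Proof.
rewrite /stepc labelsE transE.
have -> : nthc (code_seq [seq code_set (label l0) | l0 <- enum (loc A)]) (code_elt l) =
    code_set (label l).
  have := @nthc_code [seq code_set (label l0) | l0 <- enum (loc A)] (code_elt l).
  rewrite size_map -cardE => -> //; last exact: ltn_ord.
  by rewrite (nth_map l) -?cardE ?nth_enum_rank //; exact: ltn_ord.
rewrite memc_code -code_state_at; apply/mapP/eqP => [[[s U] _ /=]|E].
  move=> /pairn_inj[/code_elt_inj -> /pairn_inj[EU /code_elt_inj ->]].
  congr mstep; apply/setP => x; by rewrite -!memc_set EU.
by exists (state_at i, label l); rewrite ?mem_enum // E.
Qed.

Lemma radixE : radix a = (#|clock A|.+1 * (max_const A).+1).+1.
Proof. by rewrite /radix /stepden maxcE nclockE. Qed.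

Lemma ltn_mixed (n k x y : nat) : (x < n)%N -> (y < k)%N -> (x + n * y < n * k)%N.
Proof.
move=> xn yk; apply: (@leq_trans (n * y.+1)); first by rewrite mulnS ltn_add2r.
by rewrite leq_mul2l yk orbT.
Qed.

(** Serves three times: for the clock values of a state, for sets of states as bit vectors, and for
    sequences of states. *)
Lemma mixed_radix (g X : nat) (v : nat -> nat) : (forall x, (x < X)%N -> (v x < g)%N) ->
  exists2 c : nat, (c < g ^ X)%N & forall x, (x < X)%N -> (c %/ g ^ x %% g = v x)%N.
Proof.
elim: X v => [|X IH] v Hv; first by exists 0%N.
have [c cX Hc] := IH (fun x => v x.+1) (fun x xX => Hv x.+1 xX).
have g0 : (0 < g)%N by apply: leq_ltn_trans (Hv 0%N _).
exists (v 0 + g * c)%N => [|[|x] xX].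
- have := Hv 0%N (ltn0Sn X); rewrite expnS; nia.
- by rewrite divn1 addnC mulnC modnMDl ?modn_small //; apply: Hv.
by rewrite expnS divnMA [(g * c)%N]mulnC divnDMl // (divn_small (Hv 0%N (ltn0Sn X))) add0n Hc.
Qed.

Lemma state_number (l : loc A) (s : mstate M) (v : clock A -> nat) :
  (forall x, (v x < radix a)%N) ->
  exists i, [/\ (i < nstates a m)%N, loc_at i = l, state_at i = s & grid_at i = v].
Proof.
move=> Hv.
pose v' k := if insub k is Some o then v (enum_val (o : 'I_#|clock A|)) else 0%N.
have v'E x : v' (code_elt x) = v x.
  by rewrite /v' /code_elt valK enum_rankK.
have [|c cX Hc] := @mixed_radix (radix a) #|clock A| v'.
  by move=> x xX; rewrite /v' insubT; apply: Hv.
have lL : (code_elt l < #|loc A|)%N by exact: ltn_ord.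
have sS : (code_elt s < #|mstate M|)%N by exact: ltn_ord.
(* Lowest digit the location, then the Muller state, then the clock values. *)
pose i := (code_elt l + #|loc A| * (code_elt s + #|mstate M| * c))%N.
have L0 := loc_gt0; have S0 := state_gt0.
have il : locc a i = code_elt l.
  by rewrite /locc nlocE /i addnC mulnC modnMDl ?modn_small.
have iL : (i %/ #|loc A| = code_elt s + #|mstate M| * c)%N.
  by rewrite /i mulnC divnDMl // divn_small.
have is_ : statec a m i = code_elt s.
  by rewrite /statec nlocE nstateE iL addnC mulnC modnMDl ?modn_small.
exists i; split.
- by rewrite /nstates nlocE nstateE nclockE; do 2 apply: ltn_mixed => //.
- by apply: code_elt_inj; rewrite code_loc_at.
- by apply: code_elt_inj; rewrite code_state_at.
- apply: funext => x; rewrite /grid_at /clockc nlocE nstateE divnMA iL.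
  by rewrite [(#|mstate M| * c)%N]mulnC divnDMl // (divn_small sS) add0n Hc ?v'E // ltn_ord.
Qed.

End product_states.

Arguments loc_at {AP} A i.
Arguments state_at {AP} A M i.
Arguments grid_at {AP} A M i x.
Arguments val_at {AP} A M i.
Arguments cell_at {AP} A M i.
Arguments next_val {AP} A M i D Y.

Local Open Scope classical_set_scope.
Local Open Scope ring_scope.

(** * The kernel *)

Lemma measurable_real_of (R : realType) : measurable_fun setT (@real_of R : nnreal R -> R).
Proof. by move=> _ Y mY; rewrite setTI; exists Y => //; rewrite setTI. Qed.

Lemma measurable_fun_nnreal (R : realType) d (T : measurableType d) (f : T -> nnreal R) :
  measurable_fun setT (fun t => real_of (f t)) -> measurable_fun setT f.
Proof. by move=> mf _ _ [Y mY <-]; rewrite !setTI; have := mf measurableT Y mY; rewrite setTI. Qed.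

Lemma measurable_fun_product (I : Type) d d' (T : measurableType d) (T' : measurableType d')
    (f : T -> product_space I T') :
  (forall i, measurable_fun setT (fun t => f t i)) -> measurable_fun setT f.
Proof.
move=> mf; pose G : set (set (product_space I T')) := @coordinate_sets I d' T'.
apply: (measurability G) => //.
move=> _ [_ [i _ [B mB <-]] <-]; rewrite !setTI.
by have := mf i measurableT B mB; rewrite setTI.
Qed.

Section one_step.
Variables (R : realType) (AP : finType) (A : timed_automaton AP).

Definition jump (e : edge (loc A) (clock A)) (c : config R A) : config R A :=
  (target e : location A, reset (resets e) c.2).

Lemma measurable_clock x : measurable_fun setT (fun c : config R A => real_of (c.2 x)).
Proof.
apply: (measurableT_comp (@measurable_real_of R)).
apply: (measurableT_comp (f := fun v : valuation R A => v x)); last exact: measurable_snd.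
by move=> _ B mB; rewrite setTI; apply: sub_sigma_algebra; exists x => //; exists B; rewrite ?setTI.
Qed.

Lemma measurable_loc l : measurable [set c : config R A | c.1 = l].
Proof.
have := @measurable_fst _ _ (location A) (valuation R A) measurableT [set l].
by rewrite setTI; apply.
Qed.

Lemma measurable_config d (T : measurableType d) (f : T -> config R A) :
  (forall l, measurable [set t | (f t).1 = l]) ->
  (forall x, measurable_fun setT (fun t => real_of ((f t).2 x))) -> measurable_fun setT f.
Proof.
move=> m1 m2; apply/measurable_fun_pairP; split.
  move=> _ B _; rewrite setTI.
  have -> : (fst \o f) @^-1` B = \bigcup_(l in B) [set t | (f t).1 = l].
    by apply/seteqP; split => t /=; [move=> Bt; exists (f t).1|move=> [l Bl /= ->]].
  by apply: fin_bigcup_measurable => //; apply: (@finite_finset (loc A)).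
by apply: measurable_fun_product => x; apply: measurable_fun_nnreal; apply: m2.
Qed.

Lemma measurable_satisfies (g : guard (clock A)) :
  measurable [set c : config R A | satisfies c.2 g].
Proof.
elim: g => [|[[x o] k] g IH]; first by rewrite (_ : mkset _ = setT) //; apply/seteqP.
have -> : [set c : config R A | satisfies c.2 ((x, o, k) :: g)] =
    [set c | op_holds o (real_of (c.2 x)) k%:R] `&` [set c | satisfies c.2 g].
  by apply/seteqP; split => c /=; [move/andP|move/andP].
apply: measurableI => //.
have mx := measurable_clock x.
have mk : measurable_fun setT (fun _ : config R A => k%:R : R) by exact: measurable_cst.
have mb (f : config R A -> bool) : measurable_fun setT f -> measurable [set c | f c].
  by move=> mf; have := mf measurableT [set true] I; rewrite setTI.
case: o => /=; apply: mb.
- exact: measurable_fun_ltr.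
- exact: measurable_fun_ler.
- exact: measurable_fun_eqr.
- exact: measurable_fun_ler.
- exact: measurable_fun_ltr.
Qed.

Lemma measurable_enabled e : measurable [set c : config R A | enabled e c].
Proof.
have -> : [set c : config R A | enabled e c] =
   [set c | c.1 = source e] `&` [set c | satisfies c.2 (eguard e)].
  apply/seteqP; split => c /=; first by move=> /andP[/eqP ->].
  by move=> [E ?]; apply/andP; rewrite E eqxx.
apply: measurableI; [exact: measurable_loc|exact: measurable_satisfies].
Qed.

Lemma measurable_jump e : measurable_fun setT (jump e).
Proof.
apply: measurable_config => [l|x].
  have [<-|ne] := eqVneq (target e) l.
    by rewrite (_ : mkset _ = setT) //; apply/seteqP.
  rewrite (_ : mkset _ = set0) //; apply/seteqP; split => c //= E.
  by rewrite E eqxx in ne.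
rewrite /jump /reset /=; case: (x \in resets e) => //.
exact: measurable_clock.
Qed.

Lemma measurable_wait :
  measurable_fun setT (fun p : config R A * nnreal R => wait p.1 p.2).
Proof.
apply: measurable_config => [l|x] /=.
  have := @measurable_fst _ _ (config R A) (nnreal R) measurableT _ (measurable_loc l).
  by rewrite setTI.
apply: measurable_funD.
  by apply: (measurableT_comp (measurable_clock x)); exact: measurable_fst.
by apply: (measurableT_comp (@measurable_real_of R)); exact: measurable_snd.
Qed.

Lemma measurable_wait1 (c : config R A) : measurable_fun setT (wait c).
Proof. exact: measurable_fun_pair2 measurable_wait. Qed.

Lemma measurable_edge_prob e : measurable_fun setT (fun c : config R A => edge_prob c e).
Proof.
have mb (f : config R A -> bool) : measurable [set c | f c] -> measurable_fun setT f.
  by move=> mf; apply: (measurable_fun_bool true); rewrite setTI.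
(* edge_prob depends only on which edges are enabled, that is, on code. *)
pose code (c : config R A) : {ffun 'I_(size (e :: edges A)) -> bool} :=
  [ffun i : 'I_(size (e :: edges A)) => enabled (tnth (in_tuple (e :: edges A)) i) c].
(* The default 0 is taken only on patterns that no configuration realises. *)
pose val (z : {ffun 'I_(size (e :: edges A)) -> bool}) : R :=
  xget 0 [set p | exists c, code c = z /\ edge_prob c e = p].
have valE c : edge_prob c e = val (code c).
  rewrite /val; case: xgetP => [p _ [c' [Ecc' <-]]|/(_ (edge_prob c e))]; last first.
    by case; exists c.
  have en f : f \in e :: edges A -> enabled f c' = enabled f c.
    move=> /(@tnthP _ _ (in_tuple (e :: edges A)))[i ->].
    by have /ffunP/(_ i) := Ecc'; rewrite !ffunE.
  rewrite /edge_prob en ?mem_head //; congr (if _ then _ / (_ )%:R else _).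
  rewrite big_seq_cond [RHS]big_seq_cond; apply: eq_bigl => f.
  by case: (boolP (f \in edges A)) => //= fA; rewrite en // in_cons fA orbT.
move=> _ Y _; rewrite setTI.
have -> : (fun c : config R A => edge_prob c e) @^-1` Y =
    \bigcup_(z in [set z | Y (val z)]) [set c | code c = z].
  apply/seteqP; split => c /=; first by rewrite valE => Yc; exists (code c).
  by move=> [z Yz /= E]; rewrite valE E.
apply: fin_bigcup_measurable => // z _.
have -> : [set c | code c = z] =
    \bigcap_(i in [set: 'I_(size (e :: edges A))]) [set c | code c i = z i].
  apply/seteqP; split => c /=; first by move=> E i _ /=; rewrite E.
  by move=> H; apply/ffunP => i; exact: (H i I).
apply: fin_bigcap_measurable => // i _.
have := measurable_enabled (tnth (in_tuple (e :: edges A)) i).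
case: (z i) => me.
  by move: me; congr measurable; apply/seteqP; split => c /=; rewrite ffunE.
have := measurableC me; congr measurable; apply/seteqP; split => c /=; rewrite ffunE.
  by move/negP/negbTE.
by move=> ->.
Qed.

End one_step.

Lemma indic_01 (R : realType) (T : Type) (B : set T) x : (0 <= \1_B x :> R) && (\1_B x <= 1 :> R).
Proof. by rewrite indicE; case: (x \in B); rewrite ?lexx ?ler01. Qed.

Section reactive_kernel.
Variables (R : realType) (AP : finType) (A : sta R AP).
Variable (m : location A -> probability (nnreal R) R).
Hypothesis all_enabled : forall c : config R A, enabled_delays c = setT.
Hypothesis m_supp : forall l, full_support (m l).
Hypothesis m_law : forall l (v : valuation R A) D, measurable D -> delay_law (l, v) D = m l D.

(** The probability of landing in B once the delay has elapsed; the kernel is its mean over the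
    delay ([sta_kernelE]). *)
Definition jump_mass (B : set (config R A)) (c : config R A) : R :=
  \sum_(e <- edges A) \1_B (jump e c) * edge_prob c e.

Lemma edge_prob_ge0 (c : config R A) e : 0 <= edge_prob c e.
Proof. by rewrite /edge_prob; case: ifP => // _; apply: divr_ge0. Qed.

Lemma edge_prob_disabled (c : config R A) e : ~~ enabled e c -> edge_prob c e = 0.
Proof. by rewrite /edge_prob => /negbTE ->. Qed.

(** This is reactivity at delay 0. Without it the edge probabilities at [c] would sum to 0. *)
Lemma exists_enabled (c : config R A) : exists2 e, e \in edges A & enabled e c.
Proof.
have : enabled_delays c (0%:nng : {nonneg R}) by rewrite all_enabled.
move=> [e eA en]; exists e => //; move: en; congr (_ && _); apply: eq_all => k.
by rewrite /real_of /= addr0.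
Qed.

Lemma sum_edge_prob (c : config R A) : \sum_(e <- edges A) edge_prob c e = 1.
Proof.
have [f fA en] := exists_enabled c.
rewrite /edge_prob -big_mkcond /= -mulr_suml -natr_sum divff // pnatr_eq0 -lt0n.
rewrite big_mkcond (big_rem f) //= en.
by apply: ltn_addr; apply: weight_gt0.
Qed.

Definition total_weight : nat := \sum_(e <- edges A) weight e.

Lemma edge_prob_lb (c : config R A) e : e \in edges A -> enabled e c ->
  (total_weight%:R : R)^-1 <= edge_prob c e.
Proof.
move=> eA en; rewrite /edge_prob en.
have e0 := weight_gt0 eA.
have le_w : (\sum_(f <- edges A | enabled f c) weight f <= total_weight)%N.
  by rewrite big_mkcond /=; apply: leq_sum => f _; case: ifP.
have gt_w : (0 < \sum_(f <- edges A | enabled f c) weight f)%N.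
  by rewrite big_mkcond (big_rem e) //= en; apply: ltn_addr.
have gt_t : (0 < total_weight)%N by apply: leq_trans le_w.
rewrite ler_pdivlMr ?ltr0n // mulrC ler_pdivrMr ?ltr0n //.
rewrite -natrM ler_nat; apply: leq_trans le_w _.
by rewrite leq_pmull.
Qed.

Lemma total_weight_gt0 : (0 < total_weight)%N.
Proof.
have [f fA _] := exists_enabled (initial_config A).
rewrite /total_weight (big_rem f) //=.
by apply: ltn_addr; apply: weight_gt0.
Qed.

Lemma jump_mass_ge0 B c : 0 <= jump_mass B c.
Proof.
apply: sumr_ge0 => e _; apply: mulr_ge0; last exact: edge_prob_ge0.
by have /andP[] := indic_01 R B (jump e c).
Qed.

Lemma jump_mass_le B B' c : B `<=` B' -> jump_mass B c <= jump_mass B' c.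
Proof.
move=> BB'; apply: ler_sum => e _; apply: ler_wpM2r; first exact: edge_prob_ge0.
rewrite !indicE ler_nat; case: (boolP (_ \in B)) => //; rewrite inE => /BB' ?.
by rewrite mem_set.
Qed.

Lemma jump_mass1 B c : (forall e, e \in edges A -> enabled e c -> B (jump e c)) ->
  jump_mass B c = 1.
Proof.
move=> H; rewrite -(sum_edge_prob c) /jump_mass big_seq [RHS]big_seq; apply: eq_bigr => e eA.
have [en|/edge_prob_disabled ->] := boolP (enabled e c); last by rewrite mulr0.
by rewrite indicE mem_set ?mul1r //; apply: H.
Qed.

Lemma jump_mass_lb B c e : e \in edges A -> enabled e c -> B (jump e c) ->
  (total_weight%:R : R)^-1 <= jump_mass B c.
Proof.
move=> eA en Be; rewrite /jump_mass (big_rem e) //= indicE mem_set // mul1r.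
apply: le_trans (edge_prob_lb eA en) _; rewrite lerDl; apply: sumr_ge0 => f _.
by apply: mulr_ge0; [by have /andP[] := indic_01 R B (jump f c)|exact: edge_prob_ge0].
Qed.

Lemma measurable_jump_mass B : measurable B -> measurable_fun setT (jump_mass B).
Proof.
move=> mB; apply: measurable_sum => e; apply: measurable_funM.
  apply: (measurableT_comp (f := \1_B : config R A -> R)); first exact: measurable_indic.
  exact: measurable_jump.
exact: measurable_edge_prob.
Qed.

Lemma measurable_jump_mass_wait B (c : config R A) : measurable B ->
  measurable_fun setT (fun d => jump_mass B (wait c d)).
Proof.
move=> mB; apply: measurableT_comp (measurable_jump_mass mB) _.
exact: measurable_wait1.
Qed.

(** The sum may be extended to all edges, those leaving another location being disabled. *)
Lemma sta_kernelE (c : config R A) B : measurable B ->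
  sta_kernel c B = (\int[m c.1]_d (jump_mass B (wait c d))%:E)%E.
Proof.
move=> mB; transitivity (\int[delay_law c]_d (jump_mass B (wait c d))%:E)%E; last first.
  apply: eq_measure_integral => D mD _; case: (c) => l v; exact: m_law.
rewrite /sta_kernel /jump_mass.
under [RHS]eq_integral do rewrite -sumEFin.
rewrite ge0_integral_sum //=; first last.
- by move=> e d _; rewrite lee_fin mulr_ge0 ?edge_prob_ge0.
- move=> e; apply/measurable_EFinP; apply: measurable_funM.
    apply: (measurableT_comp (f := \1_B : config R A -> R)); first exact: measurable_indic.
    by apply: (measurableT_comp (@measurable_jump R AP A e)); exact: measurable_wait1.
  by apply: (measurableT_comp (@measurable_edge_prob R AP A e)); exact: measurable_wait1.
rewrite big_mkcond; apply: eq_bigr => e _; case: ifP => // ne.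
rewrite integral0_eq // => d _; rewrite edge_prob_disabled ?mulr0 //.
by rewrite /enabled /= ne.
Qed.

Lemma sta_kernel_ge0 (c : config R A) B : measurable B -> (0 <= sta_kernel c B)%E.
Proof.
move=> mB; rewrite sta_kernelE //; apply: integral_ge0 => d _.
by rewrite lee_fin jump_mass_ge0.
Qed.

Lemma sta_kernel_le (c : config R A) B B' : measurable B -> measurable B' -> B `<=` B' ->
  (sta_kernel c B <= sta_kernel c B')%E.
Proof.
move=> mB mB' BB'; rewrite !sta_kernelE //; apply: ge0_le_integral => //.
- by move=> d _; rewrite lee_fin jump_mass_ge0.
- by apply/measurable_EFinP; apply: measurable_jump_mass_wait.
- by apply/measurable_EFinP; apply: measurable_jump_mass_wait.
- by move=> d _; rewrite lee_fin jump_mass_le.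
Qed.

Lemma sta_kernel_lb (c : config R A) B (D : set (nnreal R)) (r : R) : measurable B ->
  measurable D -> 0 <= r -> (forall d, D d -> r <= jump_mass B (wait c d)) ->
  (r%:E * m c.1 D <= sta_kernel c B)%E.
Proof.
move=> mB mD r0 HD; rewrite sta_kernelE // -integral_cst //.
apply: (@le_trans _ _ (\int[m c.1]_(d in D) (jump_mass B (wait c d))%:E)%E).
  apply: ge0_le_integral => //.
  by apply/measurable_EFinP; apply: measurable_funTS; exact: measurable_jump_mass_wait.
apply: ge0_subset_integral => //.
- by apply/measurable_EFinP; apply: measurable_jump_mass_wait.
- by move=> d _; rewrite lee_fin jump_mass_ge0.
Qed.

(** The delay law depends on the location only: Fubini applies for each fixed law, and the finitely
    many locations are glued. *)
Lemma measurable_sta_kernel B : measurable B ->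
  measurable_fun setT (fun c : config R A => sta_kernel c B).
Proof.
move=> mB.
pose F l (c : config R A) : \bar R := (\int[m l]_d (jump_mass B (wait c d))%:E)%E.
have mF l : measurable_fun setT (F l).
  pose f (p : config R A * nnreal R) : \bar R := (jump_mass B (wait p.1 p.2))%:E.
  apply: (@measurable_fun_fubini_tonelli_F _ _ _ _ _ (m l) f).
    apply/measurable_EFinP; apply: (measurableT_comp (measurable_jump_mass mB)).
    exact: measurable_wait.
  by move=> p; rewrite lee_fin jump_mass_ge0.
move=> _ Y mY; rewrite setTI.
have -> : (fun c : config R A => sta_kernel c B) @^-1` Y =
    \bigcup_(l in [set: location A]) ([set c | c.1 = l] `&` (F l @^-1` Y)).
  apply/seteqP; split => c /=; first by rewrite sta_kernelE // => Yc; exists c.1.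
  by move=> [l _ [/= E]]; rewrite sta_kernelE // E.
apply: fin_bigcup_measurable => [|l _]; first exact: (@finite_finset (loc A)).
apply: measurableI; first exact: measurable_loc.
by have := mF l measurableT Y mY; rewrite setTI.
Qed.

(** Full support would not exclude atoms. They are excluded by [delay_lawP]: all delays being
    enabled, a set of positive Lebesgue measure, the law has the Lebesgue null sets. *)
Lemma null_delay l (x : R) : m l [set d : nnreal R | real_of d = x] = 0%E.
Proof.
set D : set (nnreal R) := [set d | _].
have mD : measurable D.
  have := @measurable_real_of R measurableT [set x] (measurable_set1 x).
  by rewrite setTI.
pose v0 := (initial_config A).2.
rewrite -(m_law l v0 mD).
have [_ + _] := delay_lawP (l, v0).
rewrite all_enabled => /(_ _ D mD) ->.
  rewrite setIT /lebesgue_half_line; apply/eqP.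
  rewrite eq_le measure_ge0 andbT -(lebesgue_measure_set1 x).
  (* The set is empty when x is negative. *)
  have [ex|nex] := pselect (exists d, D d).
    apply: le_measure; rewrite ?inE //.
      rewrite (_ : [set _ | _ in _] = [set x]) //; apply/seteqP; split => y /=.
        by move=> [d Dd <-].
      by move=> ->; have [d Dd] := ex; exists d.
    by move=> y [d Dd <-].
  rewrite (_ : [set _ | _ in _] = set0) ?measure0 ?measure_ge0 //.
  by apply/seteqP; split => y //= [d Dd _]; apply: nex; exists d.
rewrite /lebesgue_half_line (_ : [set _ | _ in _] = [set` `[0%R, +oo[]); last first.
  apply/seteqP; split => y /=.
    by move=> [d _ <-]; rewrite in_itv /= andbT /real_of.
  rewrite in_itv /= andbT => y0; exists (NngNum y0) => //.
by rewrite lebesgue_measure_itv /= ltry addye.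
Qed.

Lemma measurable_ball_half_line (d0 r : R) : measurable [set d : nnreal R | `|real_of d - d0| < r].
Proof.
have := @measurable_real_of R measurableT `]d0 - r, d0 + r[%classic (measurable_itv _).
rewrite setTI; congr measurable; apply/seteqP; split => d /=; rewrite in_itv /= ltr_distl //.
Qed.

Lemma ball_pos l (d0 r : R) : 0 <= d0 -> 0 < r ->
  (0 < m l [set d : nnreal R | `|real_of d - d0| < r]%R)%E.
Proof. by move=> d00 r0; exact: (@m_supp l (NngNum d00) r r0). Qed.

End reactive_kernel.

(** * The region graph *)

Section region_graph.
Variables (R : realType) (AP : finType) (A : timed_automaton AP) (M : muller AP).
Notation a := (code_ta A).
Notation m := (code_muller M).
Notation Mx := (max_const A).
Notation cell_of i := (cell_set (R := R) (cell_at A M i)).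
Implicit Types (c : config R A) (d : nnreal R).

Lemma clk_wait c d x : clk (wait c d).2 x = clk c.2 x + real_of d.
Proof. by []. Qed.

Lemma clk_jump e c x : clk (jump e c).2 x = if x \in resets e then 0 else clk c.2 x.
Proof. by rewrite /clk /jump /reset /=; case: ifP. Qed.

Lemma clk_val_at i x : clk (rat_valuation R (val_at A M i)) x =
  (grid_at A M i x)%:R / #|clock A|.+1%:R.
Proof. by rewrite /clk /rat_valuation /real_of /= ffunE -/(lft _) -/(rgt _) lftE rgtE. Qed.

Lemma clk_next_val i D Y x : clk (rat_valuation R (next_val A M i D Y)) x =
  if x \in Y then 0 else (grid_at A M i x)%:R / #|clock A|.+1%:R + D%:R / (#|clock A|.+1).*2%:R.
Proof.
rewrite /clk /rat_valuation /real_of /= ffunE -/(lft _) -/(rgt _).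
case: ifP => _; first by rewrite (_ : lft 0 = 0%N) // mul0r.
rewrite lftE rgtE prednK ?double_gt0 // natrD -!muln2 !natrM mulrDl.
congr (_ + _); rewrite invfM mulrACA divff ?mulr1 //.
Qed.

Lemma satisfies_equiv (e : edge (loc A) (clock A)) (v v' : valuation R A) : e \in edges A ->
  region_equiv v v' -> satisfies v (eguard e) = satisfies v' (eguard e).
Proof.
move=> eA vv'; apply: eq_in_all => k kg.
by apply: (req_op _ _ _ _ (guard_le_max eA kg) vv') => x; apply: clk_ge0.
Qed.

Lemma edgecP i j : reflect
  [/\ canonc a m j, state_at A M j = mstep (state_at A M i) (label (loc_at A i)) &
   exists e D, [/\ e \in edges A, source e = loc_at A i, target e = loc_at A j,
     (D <= (#|clock A|.+1 * Mx).*2.+1)%N & [/\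
     (forall x, clk (rat_valuation R (next_val A M i D finset.set0)) x <= Mx%:R ->
       clk (rat_valuation R (next_val A M i D finset.set0)) x \isn't a Num.int),
     satisfies (rat_valuation R (next_val A M i D finset.set0)) (eguard e) &
     region_equiv (rat_valuation R (next_val A M i D (resets e)))
                  (rat_valuation R (val_at A M j))]]]
  (edgec a m i j).
Proof.
rewrite /edgec -(code_loc_at A i) -(code_state_at A M j) stepcE.
apply: (iffP and3P) => [[cj /eqP sj]|[cj sj [e [D [eA es et DM [Dg Ds Dr]]]]]].
  rewrite edgesE exl_code has_map => /hasP[e eA /=].
  rewrite /firec edge_sourceE edge_targetE edge_guardE edge_resetsE.
  rewrite -(code_loc_at A i) -(code_loc_at A j) !(inj_eq (@code_elt_inj _)).
  move=> /and3P[/eqP es /eqP et /has_belowP[D DM]].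
  rewrite nextc0E nextcE valcE maxcE nclockE => /and3P[/(genericcP R) Dg Ds /(equivcP R) Dr].
  split => //; exists e, D; split => //.
    by move: DM; rewrite /stepden maxcE nclockE ltnS.
  by split => //; rewrite -satcE.
split => //; first exact/eqP.
rewrite edgesE exl_code has_map; apply/hasP; exists e => //=.
rewrite /firec edge_sourceE edge_targetE edge_guardE edge_resetsE.
rewrite -(code_loc_at A i) -(code_loc_at A j) !(inj_eq (@code_elt_inj _)) es et !eqxx /=.
apply/has_belowP; exists D; first by rewrite /stepden maxcE nclockE ltnS.
rewrite nextc0E nextcE valcE maxcE nclockE; apply/and3P; split.
- exact/(genericcP R).
- by rewrite (satcE R).
- exact/(equivcP R).
Qed.

Lemma samecP i j : reflect
  [/\ loc_at A i = loc_at A j, state_at A M i = state_at A M j &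
      region_equiv (rat_valuation R (val_at A M i)) (rat_valuation R (val_at A M j))]
  (samec a m i j).
Proof.
rewrite /samec -!(code_loc_at A) -!(code_state_at A M) !(inj_eq (@code_elt_inj _)).
rewrite !valcE maxcE nclockE.
by apply: (iffP and3P) => -[/eqP ? /eqP ? /(equivcP R) ?].
Qed.

(** The rounding of the clocks to the grid gives some node; the least node equivalent to it is
    canonical. *)
Lemma canonical_state c (s : mstate M) : exists i,
  [/\ (i < nstates a m)%N, canonc a m i, state_at A M i = s & cell_of i c].
Proof.
have [v vM cv] := @grid_representation R (clock A) Mx (clk c.2) (@clk_ge0 _ _ _ c.2).
have [x|i0 [i0N i0l i0s i0v]] := @state_number _ A M c.1 s v.
  by rewrite radixE ltnS.
have ci0 : cell_of i0 c.
  split => //=; rewrite region_equivE; apply: req_sym; apply: req_trans cv _.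
  by apply: req_beyond => x; left; rewrite clk_val_at i0v.
have [i [same_i imin]] : exists i, samec a m i0 i /\ forall j, samec a m i0 j -> (i <= j)%N.
  have ex : exists i, samec a m i0 i by exists i0; apply/samecP; split => //; exact: req_refl.
  by case: (ex_minnP ex) => i h1 h2; exists i; split.
have [li si ri] := samecP _ _ same_i.
exists i; split.
- apply: leq_ltn_trans i0N; apply: imin; apply/samecP; split => //; exact: req_refl.
- apply/all_belowP => j ji; apply/negP => /samecP[lj sj rj].
  have /imin : samec a m i0 j.
    apply/samecP; split; [by rewrite li|by rewrite si|exact: req_trans ri rj].
  by rewrite leqNgt ji.
- by rewrite -si.
- move: ci0 => [/= lc h]; split; first by rewrite /= lc li.
  exact: req_trans (req_sym ri) h.
Qed.

Lemma canonical_unique i j c : canonc a m i -> canonc a m j ->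
  state_at A M i = state_at A M j -> cell_of i c -> cell_of j c -> i = j.
Proof.
move=> ci cj sij [/= li ri] [/= lj rj].
have same : samec a m i j.
  by apply/samecP; split => //; [rewrite -li|apply: req_trans ri (req_sym rj)].
have same' : samec a m j i.
  by apply/samecP; split => //; [rewrite -lj|apply: req_trans rj (req_sym ri)].
have [ij|ji|//] := ltngtP i j.
  by have /all_belowP/(_ i ij) := cj; rewrite same'.
by have /all_belowP/(_ j ji) := ci; rewrite same.
Qed.

(** [elapse_grid] moves the delay from [c] to the grid point naming its cell; guards, genericity and
    resets follow since they respect regions. *)
Lemma step_edge i j c d e : e \in edges A -> cell_of i c ->
  generic Mx (clk c.2) (real_of d) -> enabled e (wait c d) -> canonc a m j ->
  state_at A M j = mstep (state_at A M i) (label (loc_at A i)) ->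
  cell_of j (jump e (wait c d)) -> edgec a m i j.
Proof.
move=> eA [/= li ri] gen /andP[/eqP se sat] cj sj [/= lj rj].
have v0 := @clk_ge0 R AP A.
have gv : req Mx (clk c.2) (fun x => (grid_at A M i x)%:R / #|clock A|.+1%:R).
  apply: req_trans (req_sym ri) _; apply: req_beyond => x; left; exact: clk_val_at.
have d0 : 0 <= real_of d by rewrite /real_of.
have [D DM rD] := elapse_grid (v0 c.2) (ltn0Sn _) d0 gv gen.
have nE x : clk (rat_valuation R (next_val A M i D finset.set0)) x =
    (grid_at A M i x)%:R / #|clock A|.+1%:R + D%:R / (#|clock A|.+1).*2%:R.
  by rewrite clk_next_val inE.
have rD' : req Mx (clk (wait c d).2) (clk (rat_valuation R (next_val A M i D finset.set0))).
  by apply: req_trans rD _; apply: req_beyond => x; left; rewrite nE.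
apply/edgecP; split => //; exists e, D; split => //; first by rewrite se.
split.
- move=> x hx; have hx' := (req_le x rD').2 hx.
  have [[h _]|[_ E]] := rD'.1 x; first by rewrite ltNge hx' in h.
  by apply/negP => /E; apply/negP/gen.
- by rewrite -(satisfies_equiv eA rD').
- rewrite region_equivE; apply: req_trans (req_sym rj).
  have h := req_reset (resets e) (v0 _) (v0 _) (req_sym rD').
  apply: req_trans (req_trans h _).
    by apply: req_beyond => x; left; rewrite clk_next_val nE.
  by apply: req_beyond => x; left; exact: esym (clk_jump e (wait c d) x).
Qed.

(** Converse of [step_edge]: a single grid delay yields, at every configuration of the cell, a whole
    ball of delays firing the same edge. *)
Lemma edge_ball i j c : edgec a m i j -> cell_of i c -> exists e (d0 r : R),
  [/\ e \in edges A, 0 <= d0, 0 < r & forall d, `|real_of d - d0| < r ->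
     enabled e (wait c d) /\ cell_of j (jump e (wait c d))].
Proof.
move=> /edgecP[cj sj [e [D [eA se te DM [gen sat rj]]]]] [/= li ri].
have v0 := @clk_ge0 R AP A.
have nE x : clk (rat_valuation R (next_val A M i D finset.set0)) x =
    clk (rat_valuation R (val_at A M i)) x + D%:R / (#|clock A|.+1).*2%:R.
  by rewrite clk_next_val inE clk_val_at.
have D0 : 0 <= D%:R / (#|clock A|.+1).*2%:R :> R by rewrite divr_ge0.
have gen' : generic Mx (clk (rat_valuation R (val_at A M i))) (D%:R / (#|clock A|.+1).*2%:R).
  by move=> x; rewrite -nE; apply: gen.
have [d0 [r [d00 r0 H]]] := elapse_ball (v0 _) (v0 c.2) D0 ri gen'.
exists e, d0, r; split => // d /H rd.
have rd' : req Mx (clk (rat_valuation R (next_val A M i D finset.set0))) (clk (wait c d).2).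
  by apply: req_trans rd; apply: req_beyond => x; left; rewrite nE.
split.
  by rewrite /enabled /= se li eqxx /= -(satisfies_equiv eA rd').
split; first by rewrite /= te.
rewrite /= region_equivE; apply: req_trans (req_sym rj) _.
have := req_reset (resets e) (v0 _) (v0 _) rd' => h.
apply: req_trans (req_trans h _).
  by apply: req_beyond => x; left; rewrite clk_next_val inE; exact: clk_next_val.
by apply: req_beyond => x; left; exact: esym (clk_jump e (wait c d) x).
Qed.

(* Beyond the maximal constant, the value of a clock does not affect the future. *)
Definition beyond_equiv c c' := c.1 = c'.1 /\
  forall x, clk c.2 x = clk c'.2 x \/ Mx%:R < clk c.2 x /\ Mx%:R < clk c'.2 x.

Lemma beyond_equiv_sym c c' : beyond_equiv c c' -> beyond_equiv c' c.
Proof. by move=> [l H]; split => // x; case: (H x) => [->|[]]; [left|right]. Qed.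

Lemma beyond_equiv_cell i c c' : beyond_equiv c c' -> cell_of i c -> cell_of i c'.
Proof.
move=> [l H] [/= li ri]; split; first by rewrite /= -l.
exact: req_trans ri (req_beyond H).
Qed.

Lemma beyond_equiv_wait c c' d : beyond_equiv c c' -> beyond_equiv (wait c d) (wait c' d).
Proof.
have d0 : 0 <= real_of d by rewrite /real_of.
move=> [l H]; split => // x; rewrite !clk_wait.
by case: (H x) => [->|[h1 h2]]; [left|right; lra].
Qed.

Lemma beyond_equiv_jump e c c' : beyond_equiv c c' -> beyond_equiv (jump e c) (jump e c').
Proof. by move=> [l H]; split => // x; rewrite !clk_jump; case: ifP => _; [left|]. Qed.

Lemma beyond_equiv_enabled e c c' : e \in edges A -> beyond_equiv c c' ->
  enabled e c = enabled e c'.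
Proof.
move=> eA [l H]; rewrite /enabled l; congr (_ && _).
exact: satisfies_equiv eA (req_beyond H).
Qed.

Definition memoryless c := forall x, clk c.2 x = 0 \/ Mx%:R < clk c.2 x.

Lemma memoryless_jump e c d : Mx%:R < real_of d -> memoryless (jump e (wait c d)).
Proof.
move=> dM x; rewrite clk_jump clk_wait; case: ifP => _; [by left|right].
by have := clk_ge0 c.2 x; lra.
Qed.

Lemma memoryless_cell i c c' : cell_of i c -> cell_of i c' -> memoryless c -> beyond_equiv c c'.
Proof.
move=> [/= li ri] [/= li' ri'] mc; split; first by rewrite li li'.
have rcc' := req_trans (req_sym ri) ri'.
have v0 := @clk_ge0 R AP A => x.
by case: (req_reset_or_beyond (v0 _) (v0 _) rcc' mc x) => [->|]; [left|right].
Qed.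

(** Conditions on the named point [u] are either true or false. Once they are decided, [nreq] leaves
    a finite conjunction of linear conditions on the clocks. *)
Lemma measurable_cell (b : cell A) : measurable (cell_set (R := R) b).
Proof.
case: b => l q.
have mx := @measurable_clock R AP A.
have mitv x (I : interval R) : measurable [set c : config R A | clk c.2 x \in I].
  have := mx x measurableT [set` I] (measurable_itv _); rewrite setTI.
  by [].
set u := clk (rat_valuation R q).
have u0 x : 0 <= u x by apply: clk_ge0.
pose n x := Num.truncn (u x).
have un x : in_unit (n x) (u x) by exact: truncn_itv.
have itvE k x : [set c : config R A | in_unit k (clk c.2 x)] =
    [set c : config R A | clk c.2 x \in `[k%:R, k.+1%:R[].
  by apply/seteqP; split => c /=; rewrite in_itv.
pose C1 x := [set c : config R A | Mx%:R < u x /\ Mx%:R < clk c.2 x] `|`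
  ([set c | in_unit (n x) (clk c.2 x)] `&`
   [set c | u x = (n x)%:R <-> clk c.2 x = (n x)%:R]).
have mC1 x : measurable (C1 x).
  apply: measurableU.
    have [h|h] := ltP Mx%:R (u x).
      rewrite (_ : mkset _ = [set c : config R A | clk c.2 x \in `]Mx%:R, +oo[]) //.
      by apply/seteqP; split => c /=; rewrite in_itv /= andbT => // -[].
    by rewrite (_ : mkset _ = set0) //; apply/seteqP; split => c // -[].
  apply: measurableI; first by rewrite itvE.
  have m1 : measurable [set c : config R A | clk c.2 x = (n x)%:R].
    have := mx x measurableT [set (n x)%:R] (measurable_set1 _); rewrite setTI.
    by [].
  have [h|h] := pselect (u x = (n x)%:R).
    rewrite (_ : mkset _ = [set c : config R A | clk c.2 x = (n x)%:R]) //.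
    by apply/seteqP; split => c /=; tauto.
  rewrite (_ : mkset _ = ~` [set c : config R A | clk c.2 x = (n x)%:R]); first exact: measurableC.
  by apply/seteqP; split => c /=; tauto.
pose C2 x y := if (u x <= Mx%:R) && (u y <= Mx%:R) then
    [set c : config R A | u x - (n x)%:R <= u y - (n y)%:R <->
       clk c.2 x - (n x)%:R <= clk c.2 y - (n y)%:R] else setT.
have mC2 x y : measurable (C2 x y).
  rewrite /C2; case: ifP => // _.
  have m1 : measurable [set c : config R A | clk c.2 x - (n x)%:R <= clk c.2 y - (n y)%:R].
    have mle : measurable_fun setT (fun c : config R A =>
        clk c.2 x - (n x)%:R <= clk c.2 y - (n y)%:R).
      by apply: measurable_fun_ler; apply: measurable_funB => //; apply: mx.
    have := mle measurableT [set true] I; rewrite setTI.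
    by [].
  have [h|h] := pselect (u x - (n x)%:R <= u y - (n y)%:R).
    rewrite (_ : mkset _ = [set c : config R A | clk c.2 x - (n x)%:R <= clk c.2 y - (n y)%:R]) //.
    by apply/seteqP; split => c /=; tauto.
  rewrite (_ : mkset _ = ~` [set c : config R A | clk c.2 x - (n x)%:R <= clk c.2 y - (n y)%:R]).
    exact: measurableC.
  by apply/seteqP; split => c /=; tauto.
have -> : cell_set (R := R) (l, q) = [set c | c.1 = l] `&`
    (\bigcap_(x in [set: clock A]) C1 x `&`
     \bigcap_(p in [set: clock A * clock A]) C2 p.1 p.2).
  apply/seteqP; split => c.
    move=> [/= -> /(req_nreq _ u0 (@clk_ge0 _ _ _ c.2))[H1 H2]]; split => //; split.
      move=> x _; case: (H1 x) => [|[k [k1 k2 k3]]]; [by left|right].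
      by rewrite (in_unit_inj (un x) k1).
    move=> [x y] _; rewrite /C2 /=; case: ifP => // /andP[hx hy].
    exact: H2.
  move=> [/= lc [H1 H2]]; split; first exact: lc.
  apply/(req_nreq _ u0 (@clk_ge0 _ _ _ c.2)).
  split => [x|x y i j hx hy ui uj].
    case: (H1 x I) => [[]|[h1 h2]]; first by left.
    by right; exists (n x).
  have := H2 (x, y) I; rewrite /C2 /= hx hy /=.
  by rewrite (in_unit_inj (un x) ui) (in_unit_inj (un y) uj).
apply: measurableI; first exact: measurable_loc.
by apply: measurableI; apply: fin_bigcap_measurable.
Qed.

End region_graph.

(** * Markov chains over a finite graph *)

Lemma measurable_coordinate (I : Type) d (T : measurableType d) (i : I) (B : set T) :
  measurable B -> measurable [set w : product_space I T | B (w i)].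
Proof.
move=> mB; apply: sub_sigma_algebra; exists i => //.
by exists B => //; rewrite setTI.
Qed.

Section history.
Context (R : realType) d (T : measurableType d).
Context (P : probability (product_space nat T) R) (K : T -> set T -> \bar R).
Hypothesis K_meas : forall B, measurable B -> measurable_fun setT (K ^~ B).
Hypothesis K_ge0 : forall x B, measurable B -> (0 <= K x B)%E.

Notation path := (product_space nat T).

Definition cylinders n : set (set path) :=
  [set F | exists2 B : nat -> set T, (forall i, measurable (B i)) &
     F = [set w | forall i, (i <= n)%N -> B i (w i)]].

(** The past up to time n, coordinate n included. *)
Definition hist n : set (set path) := <<s cylinders n >>.

Lemma hist_sigma n : sigma_algebra setT (hist n).
Proof. exact: smallest_sigma_algebra. Qed.

Lemma hist0 n : hist n set0. Proof. by case: (hist_sigma n). Qed.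

Lemma histC n F : hist n F -> hist n (~` F).
Proof. by move=> hF; rewrite -setTD; case: (hist_sigma n) => _ HC _; apply: HC. Qed.

Lemma hist_bigcup n (F : nat -> set path) :
  (forall i, hist n (F i)) -> hist n (\bigcup_i F i).
Proof. by move=> hF; case: (hist_sigma n) => _ _ HU; apply: HU. Qed.

Lemma histU n F G : hist n F -> hist n G -> hist n (F `|` G).
Proof.
move=> hF hG; rewrite -bigcup2E; apply: hist_bigcup => -[|[|i]] //=.
exact: hist0.
Qed.

Lemma histI n F G : hist n F -> hist n G -> hist n (F `&` G).
Proof.
by move=> hF hG; rewrite -[F `&` G]setCK setCI; apply: histC; apply: histU; apply: histC.
Qed.

Lemma histD n F G : hist n F -> hist n G -> hist n (F `\` G).
Proof. by move=> hF hG; apply: histI => //; apply: histC. Qed.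

Lemma histT n : hist n setT.
Proof. by rewrite -setC0; apply: histC; exact: hist0. Qed.

Lemma hist_fin n (I : finType) (F : I -> set path) :
  (forall i, hist n (F i)) -> hist n [set w | exists i, F i w].
Proof.
move=> hF.
suff H (s : seq I) : hist n [set w | exists2 i, i \in s & F i w].
  have := H (enum I); congr hist; apply/seteqP; split => w /= [i].
    by exists i.
  by exists i => //; rewrite mem_enum.
elim: s => [|i s IH].
  have -> : [set w | exists2 i, i \in [::] & F i w] = set0.
    by apply/seteqP; split => w // [].
  exact: hist0.
have -> : [set w | exists2 j, j \in i :: s & F j w] =
    F i `|` [set w | exists2 j, j \in s & F j w].
  apply/seteqP; split => w /=.
    by move=> [j]; rewrite in_cons => /predU1P[->|js]; [left|right; exists j].
  by move=> [Fi|[j js Fj]]; [exists i; rewrite ?mem_head|exists j; rewrite // in_cons js orbT].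
exact: histU.
Qed.

Lemma hist_coord n i (B : set T) : (i <= n)%N -> measurable B ->
  hist n [set w | B (w i)].
Proof.
move=> le_in mB; apply: sub_sigma_algebra.
exists (fun j => if j == i then B else setT) => [j|]; first by case: eqP.
apply/seteqP; split => w /=; first by move=> Bw j _; case: eqP => // ->.
by move=> /(_ i le_in); rewrite eqxx.
Qed.

Lemma hist_leq m n : (m <= n)%N -> hist m `<=` hist n.
Proof.
move=> le_mn; apply: smallest_sub; first exact: hist_sigma.
move=> _ [B mB ->]; apply: sub_sigma_algebra.
exists (fun j => if (j <= m)%N then B j else setT) => [j|]; first by case: ifP.
apply/seteqP; split => w /= H i; first by move=> _; case: ifP => //; apply: H.
by move=> im; have := H i (leq_trans im le_mn); rewrite im.
Qed.

Lemma hist_measurable n F : hist n F -> measurable F.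
Proof.
apply: smallest_sub; first exact: smallest_sigma_algebra.
move=> _ [B mB ->].
have -> : [set w : path | forall i, (i <= n)%N -> B i (w i)] =
    \bigcap_i (if (i <= n)%N then [set w : path | B i (w i)] else setT).
  apply/seteqP; split => w /= H i; first by move=> _; case: ifP => // /H.
  by move=> le_in; have := H i I; rewrite le_in.
apply: bigcapT_measurable => i; case: ifP => // _; exact: measurable_coordinate.
Qed.

Lemma measurable_K n B : measurable B ->
  measurable_fun (setT : set path) (fun w : path => K (w n) B).
Proof.
move=> mB; apply: (measurableT_comp (K_meas mB)).
by move=> _ Y mY; rewrite setTI; exact: measurable_coordinate.
Qed.

Hypothesis markov : forall n (B : nat -> set T), (forall i, measurable (B i)) ->
  P [set w | forall i, (i <= n.+1)%N -> B i (w i)] =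
  (\int[P]_(w in [set w | forall i, (i <= n)%N -> B i (w i)]) K (w n) (B n.+1))%E.

(** The Markov property is given for cylinders, which are stable under intersection. The sets [G]
    satisfying it form a Dynkin system, complements being handled by subtracting finite masses. *)
Lemma markov_hist n F B : hist n F -> measurable B ->
  P (F `&` [set w | B (w n.+1)]) = (\int[P]_(w in F) K (w n) B)%E.
Proof.
move=> hF mB; set E := [set w : path | B (w n.+1)].
have mE : measurable E by exact: measurable_coordinate.
pose H := [set G | measurable G /\ P (G `&` E) = (\int[P]_(w in G) K (w n) B)%E].
suff : hist n `<=` H by move=> /(_ _ hF)[].
have cylI : setI_closed (cylinders n).
  move=> _ _ [B1 mB1 ->] [B2 mB2 ->].
  exists (fun i => B1 i `&` B2 i) => [i|]; first exact: measurableI.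
  apply/seteqP; split => w /=.
    by move=> [H1 H2] i /[dup] /H1 ? /H2 ?.
  by move=> H12; split => i /H12[].
have mK D : measurable D -> measurable_fun D (fun w : path => K (w n) B).
  by move=> mD; apply: measurable_funTS; exact: measurable_K.
have HT : H setT.
  split => //; have := @markov n (fun i => if i == n.+1 then B else setT).
  rewrite eqxx (_ : [set w | forall i, (i <= n)%N -> _] = setT); last first.
    by apply/seteqP; split => w // _ i /= le_in; rewrite ltn_eqF.
  move=> <-; last by move=> i; case: eqP.
  congr (P _); apply/seteqP; split => w /=.
    by move=> [_ Ew] i _; case: eqP => // ->.
  by move=> /(_ n.+1 (leqnn _)); rewrite eqxx.
apply: (lambda_system_subset cylI) => //; last 1 first.
- move=> _ [B' mB' ->]; split.
    by apply: (@hist_measurable n); apply: sub_sigma_algebra; exists B'.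
  have := @markov n (fun i => if i == n.+1 then B else B' i).
  rewrite eqxx => markB.
  rewrite (_ : [set w | _] `&` E =
      [set w | forall i, (i <= n.+1)%N -> (if i == n.+1 then B else B' i) (w i)]).
    rewrite markB; last by move=> i; case: eqP.
    congr integral; apply/seteqP; split => w /= Hw i le_in; have := Hw i le_in;
      by rewrite ltn_eqF.
  apply/seteqP; split => w /=.
    move=> [H1 Ew] i; case: eqP => [->//|/eqP ne]; rewrite leq_eqVlt (negbTE ne).
    exact: H1.
  move=> Hw; split; last by have := Hw _ (leqnn _); rewrite eqxx.
  by move=> i le_in; have := Hw i (leqW le_in); rewrite ltn_eqF.
apply/dynkin_lambda_system; split => //.
- move=> G [mG PG]; split; first exact: measurableC.
  case: HT => _; rewrite -(setUv G) setIUl measureU; last 3 first.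
  + exact: measurableI.
  + by apply: measurableI => //; apply: measurableC.
  + by rewrite setIACA setICr set0I.
  rewrite ge0_integral_setU //=; last 4 first.
  + exact: measurableC.
  + by rewrite setUv; apply: mK.
  + by move=> w _; apply: K_ge0.
  + by apply/disj_setPS; rewrite setICr.
  rewrite -PG => /(congr1 (fun a => a - P (G `&` E))%E).
  have fin : P (G `&` E) \is a fin_num by apply: fin_num_measure; exact: measurableI.
  by rewrite addeAC subee // add0e addeAC subee // add0e.
- move=> G tG HG; split; first by apply: bigcupT_measurable => i; case: (HG i).
  have mG i : measurable (G i) by case: (HG i).
  rewrite setI_bigcupl measure_semi_bigcup; last 3 first.
  + by move=> i; apply: measurableI.
  + by apply: trivIset_setIr.
  + by apply: bigcupT_measurable => i; apply: measurableI.
  rewrite ge0_integral_bigcup //=.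
  + by apply: eq_eseriesr => i _; case: (HG i).
  + by apply: mK; apply: bigcupT_measurable.
  + by move=> w _; apply: K_ge0.
Qed.


(** * A finite memory updated along the run *)

Context (Q : finType) (q0 : Q) (step : Q -> T -> Q).
Hypothesis step_meas : forall q q', measurable [set x | step q x = q'].

Fixpoint tracked (w : path) n : Q :=
  if n is k.+1 then step (tracked w k) (w k) else q0.

Definition meas_family (D : Q -> set T) := forall q, measurable (D q).

Definition at_time n (D : Q -> set T) : set path := [set w | D (tracked w n) (w n)].

Definition from_time n (D : Q -> set T) : set path :=
  [set w | exists2 k, (n <= k)%N & at_time k D w].

Lemma hist_tracked_le n q : hist n [set w | tracked w n = q].
Proof.
elim: n q => [|n IH] q /=.
  have [->|ne] := eqVneq q0 q.
    by rewrite (_ : mkset _ = setT); [exact: histT|apply/seteqP].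
  rewrite (_ : mkset _ = set0); first exact: hist0.
  by apply/seteqP; split => w //= E; rewrite E eqxx in ne.
have -> : [set w | step (tracked w n) (w n) = q] =
    [set w | exists q', ([set w | tracked w n = q'] `&`
                         [set w | [set x | step q' x = q] (w n)]) w].
  apply/seteqP; split => w /=; first by move=> E; exists (tracked w n).
  by move=> [q' [-> ]].
apply: hist_fin => q'; apply: histI; last exact: hist_coord.
exact: hist_leq (leqnSn n) _ (IH q').
Qed.

Lemma hist_tracked n q : hist n [set w | tracked w n.+1 = q].
Proof.
have -> : [set w | tracked w n.+1 = q] =
    [set w | exists q', ([set w | tracked w n = q'] `&`
                         [set w | [set x | step q' x = q] (w n)]) w].
  apply/seteqP; split => w /=; first by move=> E; exists (tracked w n).
  by move=> [q' [-> ]].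
apply: hist_fin => q'; apply: histI; last exact: hist_coord.
exact: hist_tracked_le.
Qed.

Lemma hist_at n m D : (m <= n)%N -> meas_family D -> hist n (at_time m D).
Proof.
move=> le_mn mD.
have -> : at_time m D =
    [set w | exists q, ([set w | tracked w m = q] `&` [set w | D q (w m)]) w].
  apply/seteqP; split => w /=; first by move=> E; exists (tracked w m).
  by rewrite /at_time /= => -[q [-> ]].
apply: hist_fin => q; apply: histI; last exact: hist_coord.
apply: (hist_leq le_mn). exact: hist_tracked_le.
Qed.

Lemma measurable_at n D : meas_family D -> measurable (at_time n D).
Proof. by move=> mD; apply: (@hist_measurable n); apply: hist_at. Qed.

Lemma measurable_from n D : meas_family D -> measurable (from_time n D).
Proof. by move=> mD; apply: bigcup_measurable => k _; apply: measurable_at. Qed.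

Lemma measure_split_tracked n (F : set path) : measurable F ->
  P F = (\sum_(q : Q) P (F `&` [set w | tracked w n = q]))%E.
Proof.
move=> mF; rewrite fsbig_seq ?index_enum_uniq // -measure_fin_bigcup //.
- congr (P _); apply/seteqP; split => w; last by move=> [q _ []].
  by move=> Fw; exists (tracked w n) => //=; rewrite mem_index_enum.
- by move=> q q' _ _ [w [[_ /= <-] [_ /= <-]]].
- move=> q _; apply: measurableI => //; apply: (@hist_measurable n).
  exact: hist_tracked_le.
Qed.

(** The target depends on the memory at n + 1. Slicing by its value, known at time n, leaves a fixed
    target on each slice, to which [markov_hist] applies. *)
Lemma step_lower_bound n F (D : Q -> set T) (r : R) :
  hist n F -> meas_family D -> 0 <= r ->
  (forall w, F w -> (r%:E <= K (w n) (D (step (tracked w n) (w n))))%E) ->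
  (r%:E * P F <= P (F `&` at_time n.+1 D))%E.
Proof.
move=> hF mD r0 HF.
have mF := hist_measurable hF.
have mFD : measurable (F `&` at_time n.+1 D) by apply: measurableI => //; apply: measurable_at.
rewrite (measure_split_tracked n.+1 mF) (measure_split_tracked n.+1 mFD).
rewrite ge0_sume_distrr; last by move=> q _; exact: measure_ge0.
apply: lee_sum => q _; set Fq := F `&` [set w | tracked w n.+1 = q].
have hFq : hist n Fq by apply: histI => //; apply: hist_tracked.
have -> : F `&` at_time n.+1 D `&` [set w | tracked w n.+1 = q] =
    Fq `&` [set w | D q (w n.+1)].
  apply/seteqP; split => w; rewrite /Fq /at_time /=.
    by move=> [[Fw Dw] E]; rewrite E in Dw.
  by move=> [[Fw E] Dw]; rewrite -E in Dw.
have mFq := hist_measurable hFq.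
rewrite (markov_hist hFq (mD q)) -integral_cst //.
apply: ge0_le_integral => //.
- by apply: measurable_funTS; exact: measurable_K.
- by move=> w [Fw /= qE]; have := HF w Fw; rewrite qE.
Qed.

(* From D, the process enters U at some time with a probability that is
   bounded below, whatever the past. *)
Definition hits (D U : Q -> set T) := exists2 r : R, 0 < r &
  forall n F, hist n F -> F `<=` at_time n D -> (r%:E * P F <= P (F `&` from_time n U))%E.

Lemma hits_here D U : (forall q, D q `<=` U q) -> hits D U.
Proof.
move=> DU; exists 1 => // n F _ FD; rewrite mul1e (_ : F `&` _ = F) //.
by rewrite setIidl // => w Fw; exists n => //; apply/DU/FD.
Qed.

Lemma hits_sub D D' U : (forall q, D q `<=` D' q) -> hits D' U -> hits D U.
Proof.
move=> DD' [r r0 H]; exists r => // n F hF FD; apply: H => // w Fw.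
exact/DD'/FD.
Qed.

Lemma hits_into D U U' : meas_family U -> meas_family U' ->
  (forall q, U q `<=` U' q) -> hits D U -> hits D U'.
Proof.
move=> mU mU' UU' [r r0 H]; exists r => // n F hF FD; apply: le_trans (H n F hF FD) _.
have mF := hist_measurable hF.
apply: le_measure; rewrite ?inE; try by apply: measurableI => //; apply: measurable_from.
by move=> w [Fw [k nk Uk]]; split => //; exists k => //; apply: UU'.
Qed.

Lemma hits_step D D' U (r : R) : meas_family D' -> meas_family U -> 0 < r ->
  (forall q x, D q x -> (r%:E <= K x (D' (step q x)))%E) -> hits D' U -> hits D U.
Proof.
move=> mD' mU r0 HD [r' r'0 H]; exists (r' * r); first exact: mulr_gt0.
move=> n F hF FD; have mF := hist_measurable hF.
have hF' : hist n.+1 (F `&` at_time n.+1 D').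
  by apply: histI; [apply: hist_leq (leqnSn n) _ hF|apply: hist_at].
have lb : (r%:E * P F <= P (F `&` at_time n.+1 D'))%E.
  apply: step_lower_bound => //; first exact: ltW.
  by move=> w Fw; apply: HD; apply: FD.
rewrite EFinM -muleA; apply: (@le_trans _ _ (r'%:E * P (F `&` at_time n.+1 D'))%E).
  by apply: lee_wpmul2l => //; rewrite lee_fin ltW.
apply: le_trans (H _ _ hF' _) _; first by move=> w [].
have mF' := hist_measurable hF'.
apply: le_measure; rewrite ?inE; try by apply: measurableI => //; apply: measurable_from.
by move=> w [[Fw _] [k nk Uk]]; split => //; exists k => //; apply: ltnW.
Qed.

(** Since the bound in [hits] holds whatever the past, the past can be split according to [D1] and
    the smaller rate kept. *)
Lemma hitsU D1 D2 U : meas_family D1 -> meas_family U ->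
  hits D1 U -> hits D2 U -> hits (fun q => D1 q `|` D2 q) U.
Proof.
move=> mD1 mU [r1 r10 H1] [r2 r20 H2].
exists (Order.min r1 r2); first by rewrite lt_min r10.
move=> n F hF FD.
set F1 := F `&` at_time n D1; set F2 := F `\` at_time n D1.
have h1 : hist n F1 by apply: histI => //; apply: hist_at.
have h2 : hist n F2 by apply: histD => //; apply: hist_at.
have m1 := hist_measurable h1; have m2 := hist_measurable h2.
have mfU := measurable_from n mU.
have F12 : F = F1 `|` F2 by rewrite /F1 /F2 setUIDK.
have d12 : F1 `&` F2 = set0 by rewrite /F1 /F2 setDE setIACA setICr setI0.
rewrite F12 setIUl measureU // measureU; first last.
- by rewrite setIACA d12 set0I.
- exact: measurableI.
- exact: measurableI.
rewrite ge0_muleDr; first last; [exact: measure_ge0|exact: measure_ge0|].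
apply: leeD.
  apply: le_trans (H1 n F1 h1 _); last by move=> w [].
  by apply: lee_wpmul2r; rewrite ?measure_ge0 // lee_fin ge_min lexx.
apply: le_trans (H2 n F2 h2 _); last first.
  by move=> w [Fw nD]; have [//|] := FD w Fw.
by apply: lee_wpmul2r; rewrite ?measure_ge0 // lee_fin ge_min lexx orbT.
Qed.

Lemma hits_bigcup (I : finType) (D : I -> Q -> set T) U : (forall i, meas_family (D i)) ->
  meas_family U -> (forall i, hits (D i) U) -> hits (fun q => [set x | exists i, D i q x]) U.
Proof.
move=> mD mU HD.
suff H (s : seq I) : hits (fun q => [set x | exists2 i, i \in s & D i q x]) U.
  apply: hits_sub (H (enum I)) => q x /= [i Dx].
  by exists i => //; rewrite mem_enum.
elim: s => [|i s IH]; first by apply: hits_here => q x [].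
apply: hits_sub (hitsU (mD i) mU (HD i) IH) => q x /= [j].
rewrite in_cons => /predU1P[->|js] Dx; first by left.
by right; exists j.
Qed.

(** No waiting time is estimated. [A j] is the event of staying in C without meeting U from n to n +
    j, and [B] the intersection of the [A j]. As [C] is almost surely never left, it is enough that
    [B] be null. *)
Lemma eventually_hits C U n : meas_family C -> meas_family U ->
  (forall m, P (at_time m C `\` at_time m.+1 C) = 0%E) -> hits C U ->
  P (at_time n C `\` from_time n U) = 0%E.
Proof.
move=> mC mU Ccl [r r0 H].
pose a k := at_time (n + k) C `\` at_time (n + k) U.
pose A j : set path := \bigcap_(k in [set k | (k <= j)%N]) a k.
have ha k : hist (n + k) (a k) by apply: histD; apply: hist_at.
have mat_ m D := @measurable_at m D.
have mfr m D := @measurable_from m D.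
have ma k : measurable (a k) by apply: (@hist_measurable (n + k)).
have hA j : hist (n + j) (A j).
  elim: j => [|j IH].
    rewrite (_ : A 0%N = a 0%N) //; apply/seteqP; split => w.
      by apply.
    by move=> aw k; rewrite /= leqn0 => /eqP ->.
  rewrite (_ : A j.+1 = A j `&` a j.+1); last first.
    apply/seteqP; split => w.
      by move=> Aw; split => [k /= kj|]; apply: Aw => //=; apply: leqW.
    by move=> [Aw aw] k /=; rewrite leq_eqVlt => /predU1P[->//|]; apply: Aw.
  apply: histI; last exact: ha.
  by apply: hist_leq IH; rewrite addnS.
have mA j : measurable (A j) by apply: (@hist_measurable (n + j)).
pose B := \bigcap_j A j.
have mB : measurable B by apply: bigcapT_measurable.
have cvgA : P \o A @ \oo --> P B.
  apply: nonincreasing_cvg_mu => //; first by rewrite ltey_eq fin_num_measure.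
  apply/nonincreasing_seqP => j; apply/subsetPset => w Aw k /= kj.
  by apply: Aw => /=; apply: leqW.
(* After [A j], U is met with conditional probability at least r, and a run that meets it is outside
   [B]. In the limit the right-hand side is P B - P B = 0. *)
have leAB j : (r%:E * P B <= P (A j) - P B)%E.
  have BA : B `<=` A j by move=> w /(_ j I).
  rewrite -[X in (_ - P X)%E](setIidr BA) -measureD //; last by rewrite ltey_eq fin_num_measure.
  apply: (@le_trans _ _ (r%:E * P (A j))%E).
    apply: lee_wpmul2l; first by rewrite lee_fin ltW.
    by apply: le_measure; rewrite ?inE.
  apply: le_trans (H _ _ (hA j) _) _; first by move=> w /(_ j (leqnn j))[].
  apply: le_measure; rewrite ?inE; [by apply: measurableI => //; apply: mfr|exact: measurableD|].
  move=> w [Aw [k jk Uk]]; split => // Bw.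
  have := Bw (k - n)%N I (k - n)%N (leqnn _).
  by rewrite /a subnKC ?(leq_trans (leq_addr j n)) // => -[].
have PB0 : P B = 0%E.
  have finB : P B \is a fin_num by exact: fin_num_measure.
  have : (r%:E * P B <= P B - P B)%E.
    apply: (@cvge_to_ge _ \oo _ _ (fun j => (P (A j) - P B)%E)); last exact: nearW.
    apply: cvgeB => //; first by rewrite fin_num_adde_defl // fin_numN.
    exact: cvg_cst.
  rewrite subee // => rB; apply/eqP; rewrite eq_le measure_ge0 andbT.
  by rewrite -(@lee_pmul2l _ r%:E) // mule0.
apply/eqP; rewrite eq_le measure_ge0 andbT.
pose N m := at_time m C `\` at_time m.+1 C.
have sub : at_time n C `\` from_time n U `<=` B `|` \bigcup_m N m.
  move=> w [Cw nU]; have [|nN] := pselect ((\bigcup_m N m) w); first by right.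
  left => j _ k _; split; last by move=> Uk; apply: nU; exists (n + k)%N => //; exact: leq_addr.
  elim: k => [|k IH]; first by rewrite addn0.
  by rewrite addnS; apply: contrapT => nC; apply: nN; exists (n + k)%N.
have mN m : measurable (N m) by apply: measurableD; apply: mat_.
apply: (@le_trans _ _ (P (B `|` \bigcup_m N m))).
  apply: le_measure; rewrite ?inE //.
  - by apply: measurableD; [apply: mat_|apply: mfr].
  - by apply: measurableU => //; apply: bigcupT_measurable.
have -> : P (B `|` \bigcup_m N m) = 0%E; last by [].
have mBN : measurable (B `|` \bigcup_m N m).
  by apply: measurableU => //; apply: bigcupT_measurable.
apply: (negligibleP P mBN).1; apply: negligibleU; first exact: (negligibleP P mB).2.
by apply: negligible_bigcup => m; exact: (negligibleP P (mN m)).2 (Ccl m).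
Qed.

(** * Recurrence in a finite graph of cells *)

Section finite_abstraction.
Context (V : finType) (st : V -> Q) (ins : V -> set T) (e : rel V) (reg : pred V).
Context (eqv : T -> T -> Prop) (p : R).
Hypothesis ins_meas : forall i, measurable (ins i).
Hypothesis e_step : forall i j x, e i j -> ins i x -> st j = step (st i) x.
Hypothesis e_total : forall i x, ins i x ->
  (1 <= K x [set y | exists2 j, e i j & ins j y])%E.
Hypothesis p_gt0 : 0 < p.
Hypothesis e_reg : forall i x, ins i x ->
  (p%:E <= K x [set y | exists2 j, e i j && reg j & ins j y])%E.
(** Positivity of K towards [ins j] together with continuity from below, which is spelled out
    because K is not assumed to be a measure. *)
Hypothesis e_pos : forall i j x, e i j -> ins i x ->
  forall B : nat -> set T, (forall m, measurable (B m)) -> nondecreasing_seq B ->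
  \bigcup_m B m = ins j -> exists m, (0 < K x (B m))%E.
Hypothesis K_le : forall x B B', measurable B -> measurable B' -> B `<=` B' ->
  (K x B <= K x B')%E.
Hypothesis eqv_K : forall x y B, eqv x y -> measurable B ->
  (forall a b, eqv a b -> B a -> B b) -> K x B = K y B.
Hypothesis eqv_ins : forall i x y, eqv x y -> ins i x -> ins i y.
Hypothesis reg_eqv : forall i x y, reg i -> ins i x -> ins i y -> eqv x y.

Definition node i : Q -> set T := fun q => [set x | q = st i /\ ins i x].
Definition nodes (S : pred V) : Q -> set T :=
  fun q => [set x | exists2 i, S i & node i q x].

Lemma measurable_guarded (b : Prop) (B : set T) : measurable B -> measurable [set x | b /\ B x].
Proof.
move=> mB; have [Hb|Hb] := pselect b.
  by rewrite (_ : mkset _ = B) //; apply/seteqP; split => x // [].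
by rewrite (_ : mkset _ = set0) //; apply/seteqP; split => x // [].
Qed.

Lemma meas_node i : meas_family (node i).
Proof. by move=> q; apply: measurable_guarded. Qed.

Lemma measurable_finU (I : finType) (S : pred I) (B : I -> set T) :
  (forall i, measurable (B i)) -> measurable [set x | exists2 i, S i & B i x].
Proof.
move=> mB; have -> : [set x | exists2 i, S i & B i x] =
    \bigcup_(i in [set i | S i]) B i by [].
by apply: fin_bigcup_measurable.
Qed.

Lemma meas_nodes S : meas_family (nodes S).
Proof. by move=> q; apply: measurable_finU => i; apply: meas_node. Qed.

(* The states of i from which the next ones may be followed along s, each with
   probability at least 1/(m+1); for m large they include any given state of i. *)
Fixpoint core (m : nat) (i : V) (s : seq V) : set T :=
  if s is j :: s' then ins i `&` [set x | ((m.+1%:R^-1)%:E <= K x (core m j s'))%E]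
  else ins i.

Lemma core_meas m i s : measurable (core m i s).
Proof.
elim: s i => [|j s IH] i //=; apply: measurableI => //.
have := K_meas (IH j) measurableT (emeasurable_itv `[(m.+1%:R^-1)%:E, +oo[).
rewrite setTI; congr measurable; apply/seteqP; split => x /=.
  by rewrite in_itv /= andbT.
by rewrite in_itv /= andbT.
Qed.

Lemma core_ins m i s : core m i s `<=` ins i.
Proof. by case: s => [|j s] //= x []. Qed.

Lemma core_le m m' i s : (m <= m')%N -> core m i s `<=` core m' i s.
Proof.
move=> mm'; elim: s i => [|j s IH] i //= x [ix Kx]; split => //=.
apply: le_trans (le_trans Kx _).
  by rewrite lee_fin lef_pV2 ?posrE ?ltr0n // ler_nat.
by apply: K_le => //; apply: core_meas.
Qed.

(** By induction the cores of the tail exhaust [ins j], so some core has positive kernel mass from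
    x. A larger m also meets the threshold 1/(m + 1), cores being increasing in m. *)
Lemma core_cover i s x : path.path e i s -> ins i x -> exists m, core m i s x.
Proof.
elim: s i x => [|j s IH] i x /=; first by exists 0%N.
move=> /andP[eij pjs] ix.
have [m0 Km0] : exists m, (0 < K x (core m j s))%E.
  apply: (e_pos eij ix) => [m||]; first exact: core_meas.
    by move=> a b ab; apply/subsetPset; apply: core_le.
  apply/seteqP; split => [y [m _]|y jy]; first exact: core_ins.
  by have [m my] := IH j y pjs jy; exists m.
have [m1 Km1] : exists m, ((m.+1%:R^-1)%:E <= K x (core m0 j s))%E.
  case E : (K x (core m0 j s)) => [r| |]; last by rewrite E in Km0.
    have r0 : 0 < r by rewrite E lte_fin in Km0.
    exists (Num.truncn r^-1); rewrite lee_fin invf_ple ?posrE ?ltr0n //.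
    exact/ltW/truncnS_gt.
  by exists 0%N; rewrite leey.
exists (maxn m0 m1) => //; split => //=.
apply: le_trans (le_trans Km1 _).
  by rewrite lee_fin lef_pV2 ?posrE ?ltr0n // ler_nat ltnS leq_maxr.
by apply: K_le; [exact: core_meas|exact: core_meas|apply: core_le; exact: leq_maxl].
Qed.

Lemma core_eqv m i s x y : eqv x y -> core m i s x -> core m i s y.
Proof.
elim: s i x y => [|j s IH] i x y xy /=; first exact: eqv_ins.
move=> [ix Kx]; split; first exact: eqv_ins ix.
by rewrite -(eqv_K xy) //; [exact: core_meas|move=> a b; apply: IH].
Qed.

Lemma hits_core m i s : path.path e i s ->
  hits (fun q => [set x | q = st i /\ core m i s x]) (node (last i s)).
Proof.
elim: s i => [|j s IH] i /=; first by move=> _; apply: hits_here => q x.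
move=> /andP[eij pjs].
apply: (hits_step (D' := fun q => [set x | q = st j /\ core m j s x])
                  (r := m.+1%:R^-1)); last exact: IH.
- by move=> q; apply/measurable_guarded/core_meas.
- exact: meas_node.
- by rewrite invr_gt0 ltr0n.
- move=> q x /= [-> [ix Kx]]; apply: le_trans Kx _.
  apply: K_le; first exact: core_meas.
    exact/measurable_guarded/core_meas.
  by move=> y jy /=; split => //; rewrite (e_step eij ix).
Qed.

(** One state of the node lies in some core, and cores are invariant under [eqv], so the core is the
    whole node: here positivity becomes uniform. *)
Lemma hits_regular i t : reg i -> connect e i t -> hits (node i) (node t).
Proof.
move=> ri /connectP[s pis ->].
have [[x ix]|nex] := pselect (exists x, ins i x); last first.
  by apply: hits_here => q x [_ ix]; case: nex; exists x.
have [m mx] := core_cover pis ix.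
apply: hits_sub (hits_core m pis) => q y [-> iy] /=; split => //.
exact: core_eqv (reg_eqv ri ix iy) mx.
Qed.

Definition recurrent t := [forall u, connect e t u ==> connect e u t].

Lemma recurrentP t : reflect (forall u, connect e t u -> connect e u t) (recurrent t).
Proof. exact: 'forall_implyP. Qed.

(** A reachable node with the fewest descendants: a descendant has no fewer, hence the same ones. *)
Lemma connect_recurrent i : exists2 t, connect e i t & recurrent t.
Proof.
have [t it tmin] := arg_minnP (fun t => #|connect e t|) (connect0 e i).
exists t => //; apply/recurrentP => u tu.
have sub : connect e u \subset connect e t.
  by apply/fintype.subsetP => v; apply: connect_trans tu.
have [_] := subset_leqif_card sub; rewrite eqn_leq subset_leq_card //=.
by rewrite (tmin u (connect_trans it tu)) => /esym /fintype.subsetP; apply; apply: connect0.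
Qed.

Lemma nodes_closed (S : pred V) n : (forall i j, S i -> e i j -> S j) ->
  P (at_time n (nodes S) `\` at_time n.+1 (nodes S)) = 0%E.
Proof.
move=> Scl; set F := at_time n _; set G := at_time n.+1 _.
have mF : measurable F by apply: measurable_at; apply: meas_nodes.
have mG : measurable G by apply: measurable_at; apply: meas_nodes.
have : (1%:E * P F <= P (F `&` G))%E.
  apply: step_lower_bound => //; first by apply: hist_at => //; apply: meas_nodes.
    exact: meas_nodes.
  move=> w [i Si [-> ix]]; apply: le_trans (e_total ix) _; apply: K_le.
  - exact: measurable_finU.
  - exact: meas_nodes.
  - move=> y [j eij jy]; exists j; first exact: Scl eij.
    by split => //; rewrite (e_step eij ix).
rewrite mul1e => leF; have eqF : P (F `&` G) = P F.
  apply/eqP; rewrite eq_le leF andbT; apply: le_measure; rewrite ?inE //.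
  exact: measurableI.
transitivity (P F - P (F `&` G))%E; last by rewrite eqF subee // fin_num_measure.
by apply: measureD => //; rewrite ltey_eq fin_num_measure.
Qed.

(** Non-regular nodes are bypassed: one step leads to a regular node with probability at least [p],
    and there are finitely many of those. *)
Lemma hits_next i U : meas_family U ->
  (forall j, connect e i j -> reg j -> hits (node j) U) -> hits (nodes (connect e i)) U.
Proof.
move=> mU HU.
pose D j : Q -> set T := if connect e i j && reg j then node j else fun=> set0.
have mD j : meas_family (D j) by rewrite /D; case: ifP => _ //; apply: meas_node.
apply: (hits_step (D' := fun q => [set x | exists j, D j q x]) (r := p)) => //.
- move=> q; have := measurable_finU xpredT (fun j => mD j q).
  by congr measurable; apply/seteqP; split => x [j]; exists j.
- move=> q x [k ik [-> kx]]; apply: le_trans (e_reg kx) _; apply: K_le.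
  + exact: measurable_finU.
  + have := measurable_finU xpredT (fun j => mD j (step (st k) x)).
    by congr measurable; apply/seteqP; split => y [j]; exists j.
  + move=> y [j /andP[ekj rj] jy]; exists j.
    rewrite /D (connect_trans ik (connect1 ekj)) rj.
    by split => //; rewrite (e_step ekj kx).
- apply: hits_bigcup => // j; rewrite /D; case: ifP => [/andP[ij rj]|_].
    exact: HU.
  by apply: hits_here => q x [].
Qed.

Lemma hits_recurrent i : hits (nodes (connect e i))
  (nodes (fun t => recurrent t && connect e i t)).
Proof.
apply: hits_next => [|j ij rj]; first exact: meas_nodes.
have [t jt rt] := connect_recurrent j.
apply: hits_into (hits_regular rj jt); [exact: meas_node|exact: meas_nodes|].
by move=> q x tx; exists t => //; rewrite rt (connect_trans ij jt).
Qed.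

Lemma hits_recurrent_class t u : recurrent t -> connect e t u ->
  hits (nodes (connect e t)) (node u).
Proof.
move=> /recurrentP rt tu; apply: hits_next => [|j tj rj]; first exact: meas_node.
by apply: hits_regular => //; apply: connect_trans (rt _ tj) tu.
Qed.

Lemma ae_implies (A B : set path) : measurable A -> measurable B ->
  P (A `\` B) = 0%E -> {ae P, forall w, A w -> B w}.
Proof.
move=> mA mB AB0; exists (A `\` B); split => //; first exact: measurableD.
by move=> w /= /not_implyP.
Qed.

(** Three almost sure events, for all times and nodes at once: descendants are never left, a
    recurrent node is met, and every node of its class is met after any time. The rest is
    deterministic. *)
Lemma limit_behaviour : {ae P, forall w, forall n i, at_time n (node i) w ->
  exists t, [/\ connect e i t, recurrent t, from_time n (node t) w &
    forall q, (forall m, exists2 k, (m <= k)%N & tracked w k = q) <->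
              exists2 u, connect e t u & st u = q]}.
Proof.
have cl t i j : connect e t i -> e i j -> connect e t j.
  by move=> ti eij; apply: connect_trans ti (connect1 eij).
have mn S n : measurable (at_time n (nodes S)) by apply: measurable_at; apply: meas_nodes.
have G1 : {ae P, forall w, forall n t, at_time n (nodes (connect e t)) w ->
    at_time n.+1 (nodes (connect e t)) w}.
  apply: ae_foralln => n; apply: filter_forall => t; apply: ae_implies => //.
  by apply: nodes_closed; apply: cl.
have G2 : {ae P, forall w, forall n i, at_time n (nodes (connect e i)) w ->
    from_time n (nodes (fun t => recurrent t && connect e i t)) w}.
  apply: ae_foralln => n; apply: filter_forall => i; apply: ae_implies => //.
    by apply: measurable_from; apply: meas_nodes.
  apply: eventually_hits; [exact: meas_nodes|exact: meas_nodes| |exact: hits_recurrent].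
  by move=> m; apply: nodes_closed; apply: cl.
have G3 : {ae P, forall w, forall n t u, recurrent t -> connect e t u ->
    at_time n (nodes (connect e t)) w -> from_time n (node u) w}.
  apply: ae_foralln => n; apply: filter_forall => t; apply: filter_forall => u.
  have [rt|] := boolP (recurrent t); last by move=> _; apply: nearW.
  have [tu|] := boolP (connect e t u); last by move=> _; apply: nearW.
  suff : {ae P, forall w, at_time n (nodes (connect e t)) w -> from_time n (node u) w}.
    by apply: filterS => w H _ _.
  apply: ae_implies => //; first by apply: measurable_from; apply: meas_node.
  apply: eventually_hits; [exact: meas_nodes|exact: meas_node| |exact: hits_recurrent_class].
  by move=> m; apply: nodes_closed; apply: cl.
apply: filterS3 G1 G2 G3 => w H1 H2 H3 n i ni.
have [k nk [t /andP[rt it] tk]] : from_time n (nodes (fun t => recurrent t && connect e i t)) w.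
  by apply: H2; exists i => //; apply: connect0.
exists t; split => // [|q]; first by exists k.
have after m : (k <= m)%N -> at_time m (nodes (connect e t)) w.
  move=> /subnKC <-; elim: (m - k)%N => [|a IH].
    by rewrite addn0; exists t => //; apply: connect0.
  by rewrite addnS; apply: H1.
split => [io|[u tu <-] m].
  have [m km <-] := io k; have [u tu [-> _]] := after m km.
  by exists u.
have := H3 (maxn k m) t u rt tu (after _ (leq_maxl _ _)).
move=> [a la [E _]]; exists a => //; exact: leq_trans (leq_maxr _ _) la.
Qed.

(* A state of i may be too far from t for its probability of reaching t to be
   bounded below uniformly, hence no statement of the form hits (node i) (node t). *)
Lemma reach_pos n i t : (0 < P (at_time n (node i)))%E -> connect e i t ->
  (0 < P (from_time n (node t)))%E.
Proof.
move=> Pi /connectP[s pis ->].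
pose C m : Q -> set T := fun q => [set x | q = st i /\ core m i s x].
have mC m : meas_family (C m) by move=> q; apply/measurable_guarded/core_meas.
have mCn m : measurable (at_time n (C m)) by apply: measurable_at.
have [m Pm] : exists m, (0 < P (at_time n (C m)))%E.
  apply: contrapT => no.
  have P0 m : P (at_time n (C m)) = 0%E.
    apply/eqP; rewrite eq_le measure_ge0 andbT leNgt; apply/negP => Pm.
    by apply: no; exists m.
  suff : P (at_time n (node i)) = 0%E by move=> E; rewrite E ltxx in Pi.
  have mni : measurable (at_time n (node i)) by apply: measurable_at; apply: meas_node.
  apply: (negligibleP P mni).1.
  apply: (@negligibleS _ _ _ P (\bigcup_m at_time n (C m))).
    by move=> w [E /(core_cover pis)[m mw]]; exists m.
  by apply: negligible_bigcup => m; exact: (negligibleP P (mCn m)).2 (P0 m).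
have [r r0 H] := hits_core m pis.
have mfr : measurable (from_time n (node (last i s))) by apply: measurable_from; apply: meas_node.
apply: lt_le_trans (_ : (P (at_time n (C m) `&` from_time n (node (last i s))) <= _)%E); last first.
  by apply: le_measure; rewrite ?inE //; apply: measurableI.
apply: lt_le_trans (H n (at_time n (C m)) _ _) => //.
  by apply: mule_gt0.
exact: hist_at.
Qed.

End finite_abstraction.
End history.

(** * Reactive automata *)

Lemma exists_lower_bound (R : realType) (T : finType) (f : T -> \bar R) :
  (forall t, 0 < f t)%E -> exists2 p : R, 0 < p & forall t, (p%:E <= f t)%E.
Proof.
move=> f0.
suff [p p0 H] : exists2 p : R, 0 < p & forall t, t \in enum T -> (p%:E <= f t)%E.
  by exists p => // t; apply: H; rewrite mem_enum.
elim: (enum T) => [|t s [p p0 IH]]; first by exists 1.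
have [r r0 rf] : exists2 r : R, 0 < r & (r%:E <= f t)%E.
  have := f0 t; case: (f t) => [r|_|] //; last by exists 1 => //; rewrite leey.
  by rewrite lte_fin => r0; exists r.
exists (Num.min p r); first by rewrite lt_min p0.
move=> u; rewrite in_cons => /predU1P[->|us].
  by apply: le_trans rf; rewrite lee_fin ge_min lexx orbT.
by apply: le_trans (IH u us); rewrite lee_fin ge_min lexx.
Qed.

Section reactive_chain.
Variables (R : realType) (AP : finType) (A : sta R AP) (M : muller AP).
Variable (m : location A -> probability (nnreal R) R).
Hypothesis all_enabled : forall c : config R A, enabled_delays c = setT.
Hypothesis m_supp : forall l, full_support (m l).
Hypothesis m_law : forall l (v : valuation R A) D, measurable D -> delay_law (l, v) D = m l D.
Notation ca := (code_ta A).
Notation cm := (code_muller M).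
Notation Mx := (max_const A).
Notation cell_of i := (cell_set (R := R) (cell_at A M i)).
Notation state := 'I_(nstates ca cm).

Definition read (q : mstate M) (c : config R A) : mstate M := mstep q (label c.1).

(* By memoryless_cell, all configurations of such a cell have the same future. *)
Definition regenerative (j : state) := `[< forall c, cell_of j c -> memoryless c >].

(** The exceptional delays are the n - x, for x the value of a clock and n at most the maximal
    constant: finitely many null points. *)
Lemma generic_ae l (c : config R A) : {ae m l, forall d, generic Mx (clk c.2) (real_of d)}.
Proof.
have FF : Filter (almost_everywhere (m l)) by exact: ae_filter_ringOfSetsType.
have H : {ae m l, forall d, forall (x : clock A) (n : 'I_Mx.+1),
    real_of d <> (nat_of_ord n)%:R - clk c.2 x}.
  apply: (@filter_forall _ _ _ _ FF) => x; apply: (@filter_forall _ _ _ _ FF) => n.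
  exists [set d : nnreal R | real_of d = (nat_of_ord n)%:R - clk c.2 x]; split.
  - have := @measurable_real_of R measurableT _ (measurable_set1 (n%:R - clk c.2 x)).
    by rewrite setTI.
  - exact: null_delay all_enabled m_law _ _.
  - by move=> d /= /contrapT.
apply: (@filterS _ _ FF _ _ _ H) => d {}H x hx; apply/negP => hi.
have xd0 : 0 <= clk c.2 x + real_of d by rewrite addr_ge0 ?clk_ge0 // /real_of.
have [n nx] := in_unit_ex xd0.
have E := (in_unit_int nx).1 hi.
have nM : (n < Mx.+1)%N by rewrite ltnS -(ler_nat R) -E.
by apply: (H x (Ordinal nM)); rewrite /= -E; lra.
Qed.

Lemma successor (i : state) (c : config R A) (d : nnreal R) e : cell_of i c ->
  generic Mx (clk c.2) (real_of d) -> e \in edges A -> enabled e (wait c d) ->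
  exists2 j : state, edgec ca cm i j & cell_of j (jump e (wait c d)).
Proof.
move=> ci gen eA en.
have [j [jN cj sj jy]] := canonical_state (jump e (wait c d))
  (mstep (state_at A M i) (label (loc_at A i))).
by exists (Ordinal jN) => //=; apply: step_edge eA ci gen en cj sj jy.
Qed.

Lemma kernel_total (i : state) c : cell_of i c ->
  (1 <= sta_kernel c [set y | exists2 j : state, edgec ca cm i j & cell_of j y])%E.
Proof.
move=> ci; have [N [mN N0 gN]] := generic_ae c.1 c.
have mB : measurable [set y | exists2 j : state, edgec ca cm i j & cell_of j y].
  by apply: (@measurable_finU _ _ state) => j; apply: measurable_cell.
have := @sta_kernel_lb _ _ _ m m_law c _ (~` N) 1 mB (measurableC mN) ler01.
rewrite mul1e probability_setC // N0 sube0; apply => d nNd.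
rewrite (jump_mass1 all_enabled) // => e eA en; apply: successor eA en => //.
by apply: contrapT => ng; apply: nNd; apply: gN.
Qed.

Lemma kernel_regenerates : exists2 p : R, 0 < p & forall (i : state) c, cell_of i c ->
  (p%:E <= sta_kernel c
    [set y | exists2 j : state, edgec ca cm i j && regenerative j & cell_of j y])%E.
Proof.
(* All delays in this ball exceed the maximal constant; its mass depends on the location only, so a
   minimum over locations bounds it. *)
pose B := [set d : nnreal R | `|real_of d - Mx.+1%:R| < 1].
have mB : measurable B by apply: measurable_ball_half_line.
have [p p0 Hp] := @exists_lower_bound R (loc A) (fun l => m l B)
  (fun l => ball_pos m_supp l (ler0n R Mx.+1) ltr01).
exists p => // i c ci.
have [N [mN N0 gN]] := generic_ae c.1 c.
have mS : measurable [set y | exists2 j : state, edgec ca cm i j && regenerative j & cell_of j y].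
  by apply: (@measurable_finU _ _ state) => j; apply: measurable_cell.
have mBN : measurable (B `\` N) by exact: measurableD.
have := @sta_kernel_lb _ _ _ m m_law c _ (B `\` N) 1 mS mBN ler01.
have BN0 : m c.1 (B `&` N) = 0%E.
  apply/eqP; rewrite eq_le measure_ge0 andbT -N0; apply: le_measure; rewrite ?inE //.
  exact: measurableI.
have -> : m c.1 (B `\` N) = m c.1 B.
  transitivity (m c.1 B - m c.1 (B `&` N))%E; last by rewrite BN0 sube0.
  by apply: measureD => //; rewrite ltey_eq fin_num_measure.
rewrite mul1e => H; apply: le_trans (Hp c.1) _; apply: H => d [Bd nNd].
rewrite (jump_mass1 all_enabled) // => e eA en.
have gen : generic Mx (clk c.2) (real_of d).
  by apply: contrapT => ng; apply: nNd; apply: gN.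
have [j eij jy] := successor ci gen eA en.
(* The cell of [j] contains a memoryless configuration, and then all its configurations are
   memoryless, the region fixing which clocks are 0 or beyond. *)
exists j => //; rewrite eij; apply/asboolP => c' jc' x.
have dM : Mx%:R < real_of d.
  by move: Bd; rewrite /B /= ltr_norml -natr1 => /andP[h _]; lra.
have mj := memoryless_jump e c dM.
by have [_ /(_ x)[E|[_ h]]] := memoryless_cell jy jc' mj; [rewrite -E; apply: mj|right].
Qed.

(** The ball of [edge_ball] is the union of the delays leading into [B k], so some of these sets has
    positive mass; the edge is then chosen with probability at least 1 / [total_weight A]. *)
Lemma kernel_pos (i j : state) c : edgec ca cm i j -> cell_of i c ->
  forall B : nat -> set (config R A), (forall k, measurable (B k)) -> nondecreasing_seq B ->
  \bigcup_k B k = cell_of j -> exists k, (0 < sta_kernel c (B k))%E.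
Proof.
move=> eij ci B mB ndB BU.
have [e [d0 [r [eA d00 r0 H]]]] := edge_ball eij ci.
pose D := [set d : nnreal R | `|real_of d - d0| < r].
have mD : measurable D by apply: measurable_ball_half_line.
have mJ : measurable_fun setT (fun d => jump e (wait c d)).
  by apply: (measurableT_comp (@measurable_jump R AP A e)); exact: measurable_wait1.
pose Dk k := D `&` [set d | B k (jump e (wait c d))].
have mDk k : measurable (Dk k).
  by apply: measurableI => //; have := mJ measurableT _ (mB k); rewrite setTI.
have [k Pk] : exists k, (0 < m c.1 (Dk k))%E.
  apply: contrapT => no.
  have P0 k : m c.1 (Dk k) = 0%E.
    apply/eqP; rewrite eq_le measure_ge0 andbT leNgt; apply/negP => Pk.
    by apply: no; exists k.
  have := ball_pos m_supp c.1 d00 r0; rewrite -/D.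
  have -> : m c.1 D = 0%E; last by rewrite ltxx.
  apply: (negligibleP (m c.1) mD).1.
  apply: (@negligibleS _ _ _ (m c.1) (\bigcup_k Dk k)).
    move=> d Dd; have [_ jy] := H d Dd; rewrite -BU in jy.
    by have [k _ Bk] := jy; exists k.
  by apply: negligible_bigcup => k; exact: (negligibleP (m c.1) (mDk k)).2 (P0 k).
exists k.
have w0 : 0 < (total_weight A)%:R^-1 :> R by rewrite invr_gt0 ltr0n (total_weight_gt0 all_enabled).
apply: lt_le_trans (sta_kernel_lb m_law (mB k) (mDk k) (ltW w0) _).
  exact: mule_gt0.
move=> d [Dd Bd]; have [en _] := H d Dd.
exact: jump_mass_lb eA en Bd.
Qed.

Lemma kernel_beyond c c' B : beyond_equiv c c' -> measurable B ->
  (forall b b', beyond_equiv b b' -> B b -> B b') -> sta_kernel (A := A) c B = sta_kernel c' B.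
Proof.
move=> cc' mB HB; rewrite !(sta_kernelE m_law) //; have [-> _] := cc'.
apply: eq_integral => d _; congr EFin; apply: eq_big_seq => e eA.
have wcc' := beyond_equiv_wait d cc'.
have -> : edge_prob (wait c d) e = edge_prob (wait c' d) e.
  rewrite /edge_prob (beyond_equiv_enabled eA wcc'); congr (if _ then _ / _%:R else _).
  rewrite big_seq_cond [RHS]big_seq_cond; apply: eq_bigl => f.
  by case fA: (f \in edges A) => //=; rewrite (beyond_equiv_enabled fA wcc').
congr (_ * _); rewrite !indicE; congr (nat_of_bool _)%:R.
have jj := beyond_equiv_jump e wcc'.
by apply/idP/idP; rewrite !inE; apply: HB => //; apply: beyond_equiv_sym.
Qed.

(** * Almost sure behaviour of the run *)

Variables (mu : probability (config R A) R) (P : probability (path_space R A) R).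
Hypothesis P_law : markov_law mu P.

Lemma read_meas q q' : measurable [set c | read q c = q'].
Proof.
have -> : [set c | read q c = q'] =
    \bigcup_(l in [set l : location A | mstep q (label l) = q']) [set c | c.1 = l].
  apply/seteqP; split => c /=; first by move=> E; exists c.1.
  by move=> [l E /= El]; rewrite /read El.
apply: fin_bigcup_measurable; first exact: (@finite_finset (loc A)).
by move=> l _; apply: measurable_loc.
Qed.

Definition graph : rel state := fun i j => edgec ca cm i j.

Definition in_state n (i : state) : set (path_space R A) :=
  [set w | mrun M (label_word w) n = state_at A M i /\ cell_of i (w n)].

Lemma tracked_mrun (w : path_space R A) n : tracked (minit M) read w n = mrun M (label_word w) n.
Proof. by elim: n => //= n ->. Qed.

Lemma in_stateE n i : in_state n i =
  at_time (minit M) read n (node (fun i : state => state_at A M i) (fun i : state => cell_of i) i).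
Proof. by apply/seteqP; split => w; rewrite /at_time /= tracked_mrun. Qed.

Lemma measurable_in_state n i : measurable (in_state n i).
Proof.
rewrite in_stateE; apply: measurable_at; first exact: read_meas.
by apply: meas_node => j; apply: measurable_cell.
Qed.

Lemma measurable_mrun n q : measurable [set w : path_space R A | mrun M (label_word w) n = q].
Proof.
have := hist_measurable (@hist_tracked_le _ _ _ (minit M) read read_meas n q).
by congr measurable; apply/seteqP; split => w /=; rewrite tracked_mrun.
Qed.

Let kernel_meas B (mB : measurable B) := measurable_sta_kernel m_law mB.
Let kernel_ge0 (c : config R A) B (mB : measurable B) := sta_kernel_ge0 m_law c mB.
Let markov n B (mB : forall i, measurable (B i)) := P_law.2 n B mB.
Let cells_meas (i : state) := @measurable_cell R AP A (cell_at A M i).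

Let graph_step (i j : state) (c : config R A) : graph i j -> cell_of i c ->
  state_at A M j = read (state_at A M i) c.
Proof. by move=> /(edgecP R)[_ -> _] [/= lc _]; rewrite /read lc. Qed.

Let regenerative_equiv (i : state) (c c' : config R A) : regenerative i -> cell_of i c ->
  cell_of i c' -> beyond_equiv c c'.
Proof. by move=> /asboolP ri ci ci'; apply: memoryless_cell ci ci' (ri c ci). Qed.

Definition recurrence_class (w : path_space R A) (t : state) := forall q,
  (forall n, exists2 k, (n <= k)%N & mrun M (label_word w) k = q) <->
  (exists2 u, connect graph t u & state_at A M u = q).

Lemma limit_states : {ae P, forall w, forall n (i : state), in_state n i w ->
  exists t, [/\ connect graph i t, recurrent graph t,
    exists2 k, (n <= k)%N & in_state k t w & recurrence_class w t]}.
Proof.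
have [p p0 Hp] := kernel_regenerates.
have := limit_behaviour kernel_meas kernel_ge0 markov (minit M) read_meas cells_meas
  graph_step kernel_total p0 Hp kernel_pos (fun c B B' => @sta_kernel_le _ _ _ m m_law c B B')
  (fun c c' B => @kernel_beyond c c' B) (fun i c c' => @beyond_equiv_cell _ _ _ M i c c')
  regenerative_equiv.
have FF : Filter (almost_everywhere P) by exact: ae_filter_ringOfSetsType.
apply: (@filterS _ _ FF) => w H n i ni.
have [|t [it rt [k nk tk] Ht]] := H n i; first by rewrite -in_stateE.
exists t; split => // [|q]; first by exists k; rewrite ?in_stateE.
rewrite -Ht; split => io b.
  by have [l kl E] := io b; exists l => //; rewrite tracked_mrun.
by have [l kl E] := io b; exists l => //; rewrite -tracked_mrun.
Qed.

Lemma reach_positive n (i t : state) : (0 < P (in_state n i))%E -> connect graph i t ->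
  (0 < P [set w | exists2 k, (n <= k)%N & in_state k t w])%E.
Proof.
have [p p0 Hp] := kernel_regenerates.
move=> Pi it; rewrite in_stateE in Pi.
have := reach_pos kernel_meas kernel_ge0 markov read_meas cells_meas
  graph_step kernel_pos (fun c B B' => @sta_kernel_le _ _ _ m m_law c B B') Pi it.
congr (0 < P _)%E; apply/seteqP; split => w [k nk].
  by exists k => //; rewrite in_stateE.
by exists k => //; rewrite -in_stateE.
Qed.

Lemma stays_in (S : pred state) : (forall i j, S i -> graph i j -> S j) ->
  {ae P, forall w, forall n i, in_state n i w -> S i ->
     exists2 j, S j & in_state n.+1 j w}.
Proof.
move=> Scl.
have FF : Filter (almost_everywhere P) by exact: ae_filter_ringOfSetsType.
have H n : {ae P, forall w, at_time (minit M) read n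
      (nodes (fun i : state => state_at A M i) (fun i : state => cell_of i) S) w ->
    at_time (minit M) read n.+1
      (nodes (fun i : state => state_at A M i) (fun i : state => cell_of i) S) w}.
  apply: ae_implies.
  - by apply: measurable_at; [exact: read_meas|exact: meas_nodes].
  - by apply: measurable_at; [exact: read_meas|exact: meas_nodes].
  apply: (nodes_closed kernel_meas kernel_ge0 markov (minit M) read_meas cells_meas
    graph_step kernel_total (fun c B B' => @sta_kernel_le _ _ _ m m_law c B B')) => //.
have := ae_foralln H; apply: (@filterS _ _ FF) => w {}H n i ni Si.
have [|j Sj jw] := H n; last by exists j => //; rewrite in_stateE.
by exists i => //; move: ni; rewrite in_stateE.
Qed.

Definition accepting (t : state) :=
  finset (fun q => [exists u, connect graph t u && (state_at A M u == q)]) \in mfinal M.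

Lemma accepts_class w t : recurrence_class w t -> accepts M (label_word w) <-> accepting t.
Proof.
move=> H; rewrite /accepts /accepting.
suff -> : finset (fun q => `[< forall n, exists2 k, (n <= k)%N & mrun M (label_word w) k = q >]) =
    finset (fun q => [exists u, connect graph t u && (state_at A M u == q)]) by [].
apply/setP => q; rewrite !inE; apply/asboolP/existsP => [/H[u tu E]|[u /andP[tu /eqP E]]].
  by exists u; rewrite tu E eqxx.
by apply/H; exists u.
Qed.

Definition good (i : state) := [forall t, connect graph i t && recurrent graph t ==> accepting t].
Definition bad (i : state) := [forall t, connect graph i t && recurrent graph t ==> ~~ accepting t].

Definition accepted : set (path_space R A) := [set w | accepts M (label_word w)].

Lemma measurable_accepted : measurable accepted.
Proof.
pose io q : set (path_space R A) := \bigcap_n \bigcup_(k in [set k | (n <= k)%N])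
  [set w : path_space R A | mrun M (label_word w) k = q].
have mio q : measurable (io q).
  apply: bigcapT_measurable => n; apply: bigcup_measurable => k _; exact: measurable_mrun.
have -> : accepted = \bigcup_(F in [set F | F \in mfinal M])
    \bigcap_(q in [set: mstate M]) (if q \in F then io q else ~` io q).
  have ioE w q : io q w <-> forall n, exists2 k, (n <= k)%N & mrun M (label_word w) k = q.
    by split => [H n|H n _]; [have [k nk E] := H n I|have [k nk E] := H n]; exists k.
  apply/seteqP; split => w /=.
    move=> acc; eexists; first exact: acc.
    move=> q _; rewrite inE; case: ifPn => [/asboolP /ioE //|/asboolPn nio /ioE //].
  move=> [F FM HF]; rewrite /accepted /= /accepts.
  rewrite (_ : finset _ = F) //; apply/setP => q; rewrite inE.
  have := HF q I; case: ifPn => qF Hq; first by apply/asboolP/ioE.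
  by apply/negbTE/asboolPn => /ioE.
apply: fin_bigcup_measurable => // F _; apply: fin_bigcap_measurable => // q _.
by case: ifP => // _; apply: measurableC.
Qed.

Lemma good_accepts : {ae P, forall w, forall n i, in_state n i w -> good i -> accepted w}.
Proof.
have FF : Filter (almost_everywhere P) by exact: ae_filter_ringOfSetsType.
apply: (@filterS _ _ FF _ _ _ limit_states) => w H n i ni /forallP gi.
have [t [it rt _ cl]] := H n i ni.
by apply/(accepts_class cl); have := gi t; rewrite it rt.
Qed.

Lemma bad_rejects : {ae P, forall w, forall n i, in_state n i w -> bad i -> ~ accepted w}.
Proof.
have FF : Filter (almost_everywhere P) by exact: ae_filter_ringOfSetsType.
apply: (@filterS _ _ FF _ _ _ limit_states) => w H n i ni /forallP gi.
have [t [it rt _ cl]] := H n i ni.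
by move=> /(accepts_class cl); have := gi t; rewrite it rt /= => /negP.
Qed.

(** Nodes of one bottom component have the same descendants. *)
Lemma recurrent_accepting t u : recurrent graph t -> connect graph t u -> accepting u = accepting t.
Proof.
move=> /recurrentP rt tu; rewrite /accepting.
suff -> : finset (fun q => [exists v, connect graph u v && (state_at A M v == q)]) =
  finset (fun q => [exists v, connect graph t v && (state_at A M v == q)]) by [].
apply/setP => q; rewrite !inE.
apply: eq_existsb => v; congr (_ && _); apply/idP/idP => h.
  exact: connect_trans tu h.
exact: connect_trans (rt u tu) h.
Qed.

Lemma recurrent_good_or_bad t : recurrent graph t -> good t || bad t.
Proof.
move=> rt; case ac : (accepting t); [apply/orP; left|apply/orP; right];
  by apply/forallP => u; apply/implyP => /andP[tu _]; rewrite (recurrent_accepting rt tu) ac.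
Qed.

Lemma decided_closed (i j : state) : good i || bad i -> graph i j -> good j || bad j.
Proof.
move=> h ij; case/orP: h => /forallP h; apply/orP; [left|right]; apply/forallP => t;
  apply/implyP => /andP[jt rt]; have := h t;
  by rewrite rt (connect_trans (connect1 ij) jt).
Qed.

Definition good_at k : set (path_space R A) :=
  [set w | exists2 i : state, canonc ca cm i && good i & in_state k i w].
Definition bad_at k : set (path_space R A) :=
  [set w | exists2 i : state, canonc ca cm i && bad i & in_state k i w].

Lemma measurable_good_at k : measurable (good_at k).
Proof. by apply: measurable_finU => i; apply: measurable_in_state. Qed.

Lemma measurable_bad_at k : measurable (bad_at k).
Proof. by apply: measurable_finU => i; apply: measurable_in_state. Qed.

Lemma ae_subset_le (B C : set (path_space R A)) : measurable B -> measurable C ->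
  {ae P, forall w, B w -> C w} -> (P B <= P C)%E.
Proof.
move=> mB mC [N [mN N0 BC]].
apply: (@le_trans _ _ (P (C `|` N))).
  apply: le_measure; rewrite ?inE //; first exact: measurableU.
  move=> w Bw; have [|nC] := pselect (C w); first by left.
  by right; apply: BC => /= H; apply: nC; apply: H.
apply: (@le_trans _ _ (P C + P N)%E); last by rewrite N0 adde0.
exact: measureU2.
Qed.

Lemma good_at_le k : (P (good_at k) <= P accepted)%E.
Proof.
apply: ae_subset_le; [exact: measurable_good_at|exact: measurable_accepted|].
have FF : Filter (almost_everywhere P) by exact: ae_filter_ringOfSetsType.
apply: (@filterS _ _ FF _ _ _ good_accepts) => w H [i /andP[_ gi] ki].
exact: H ki gi.
Qed.

Lemma bad_at_le k : (P (bad_at k) <= P (~` accepted))%E.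
Proof.
apply: ae_subset_le; [exact: measurable_bad_at|by apply: measurableC; exact: measurable_accepted|].
have FF : Filter (almost_everywhere P) by exact: ae_filter_ringOfSetsType.
apply: (@filterS _ _ FF _ _ _ bad_rejects) => w H [i /andP[_ gi] ki].
exact: H ki gi.
Qed.

Lemma some_state (w : path_space R A) n : exists2 i : state, canonc ca cm i & in_state n i w.
Proof.
have [i [iN ci si cw]] := canonical_state (w n) (mrun M (label_word w) n).
by exists (Ordinal iN).
Qed.

Lemma in_state_canonical n (i j : state) w : canonc ca cm i -> canonc ca cm j ->
  in_state n i w -> in_state n j w -> i = j.
Proof.
move=> ci cj [si wi] [sj wj]; apply: val_inj.
by apply: canonical_unique ci cj _ wi wj; rewrite -si -sj.
Qed.

Lemma graph_canonical (i j : state) : graph i j -> canonc ca cm j.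
Proof. by case/(edgecP R). Qed.

(** The recurrent node that is met is decided, and being decided is inherited along edges; edges
    lead to canonical nodes, as [good_at] and [bad_at] require. *)
Lemma eventually_decided :
  {ae P, forall w, exists n, forall k, (n <= k)%N -> (good_at k `|` bad_at k) w}.
Proof.
pose S (i : state) := canonc ca cm i && (good i || bad i).
have FF : Filter (almost_everywhere P) by exact: ae_filter_ringOfSetsType.
have Scl (i j : state) : S i -> graph i j -> S j.
  by move=> /andP[_ h] ij; rewrite /S (graph_canonical ij); apply: decided_closed ij.
have reach_canonical (i t : state) : canonc ca cm i -> connect graph i t -> canonc ca cm t.
  move=> ci /connectP[p pip ->]; elim: p i ci pip => //= j p IH i ci /andP[ij].
  by apply: IH; apply: graph_canonical ij.
apply: (@filterS2 _ _ FF _ _ _ _ limit_states (stays_in Scl)) => w H1 H2.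
have [i ci wi] := some_state w 0.
have [t [it rt [n _ tn] _]] := H1 0%N i wi.
exists n => k nk.
have : exists2 j, S j & in_state k j w.
  rewrite -(subnKC nk); elim: (k - n)%N => [|l [j Sj jl]].
    rewrite addn0; exists t => //; rewrite /S (reach_canonical i t) //.
    exact: recurrent_good_or_bad.
  by rewrite addnS; apply: H2 jl Sj.
by move=> [j /andP[cj /orP[gj|bj]] jk]; [left|right]; exists j; rewrite ?cj.
Qed.

Lemma decided_limit (r : R) : 0 < r ->
  exists k, ((1 - r)%:E <= P (good_at k) + P (bad_at k))%E.
Proof.
move=> r0; pose C k := good_at k `|` bad_at k.
have mC k : measurable (C k) 
  by apply: measurableU; [exact: measurable_good_at|exact: measurable_bad_at].
(* The sets [C k] increase only almost surely; these intersections do so everywhere, so continuity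
   from below applies. *)
pose F n := \bigcap_(k in [set k | (n <= k)%N]) C k.
have mF n : measurable (F n) by apply: bigcap_measurable => [|k _ //]; exists n => /=.
have mU : measurable (\bigcup_n F n) by apply: bigcupT_measurable.
have ndF : nondecreasing_seq F.
  by move=> a b ab; apply/subsetPset => w Fw k /= bk; apply: Fw => /=; apply: leq_trans bk.
have PU : P (\bigcup_n F n) = 1%E.
  apply/eqP; rewrite eq_le probability_le1 //=.
  rewrite -(@probability_setT _ _ _ P); apply: ae_subset_le => //.
  have FF : Filter (almost_everywhere P) by exact: ae_filter_ringOfSetsType.
  apply: (@filterS _ _ FF _ _ _ eventually_decided) => w [n H] _.
  by exists n => // k; apply: H.
have cvF : (P \o F) n @[n --> \oo] --> (1%E : \bar R).
  by rewrite -PU; apply: nondecreasing_cvg_mu.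
have : \forall n \near \oo, ((1 - r)%:E < P (F n))%E.
  apply: (cvF [set x | ((1 - r)%:E < x)%E]).
  apply: open_nbhs_nbhs; split; first exact: open_ereal_gt_ereal.
  by rewrite /= lte_fin; lra.
move=> [n _ /(_ n (leqnn n)) Pn]; exists n; apply: le_trans (ltW Pn) _.
apply: (@le_trans _ _ (P (C n))).
  by apply: le_measure; rewrite ?inE // => w Fw; apply: (Fw n) => /=.
by apply: measureU2; [exact: measurable_good_at|exact: measurable_bad_at].
Qed.

(** * Almost sure acceptance as a graph property *)

Definition good_cell (b : cell A) := exists i : state,
  [/\ canonc ca cm i, state_at A M i = minit M, loc_at A i = b.1,
      region_equiv (rat_valuation R b.2) (rat_valuation R (val_at A M i)) & good i].

Lemma in_state0 (i : state) : state_at A M i = minit M ->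
  P (in_state 0 i) = mu (cell_of i).
Proof.
move=> si; rewrite -P_law.1; last exact: measurable_cell.
by congr (P _); apply/seteqP; split => w /=; rewrite /in_state /= si => // -[].
Qed.

Lemma almost_sure_acceptance (s : seq (cell A)) : charged_cells mu s ->
  P accepted = 1%E <-> forall b, b \in s -> good_cell b.
Proof.
move=> ch; have FF : Filter (almost_everywhere P) by exact: ae_filter_ringOfSetsType.
split => [P1 b bs|H].
  have mub : (0 < mu (cell_set b))%E by apply/ch; exists b.
  (* The node is that of the rational point naming b. *)
  have [i [iN ci si [/= li ri]]] :=
    canonical_state ((b.1, rat_valuation R b.2) : config R A) (minit M).
  pose i' : state := Ordinal iN.
  exists i'; split => //; first exact: req_sym.
  apply/forallP => t; apply/implyP => /andP[it rt]; apply/negPn/negP => nat_.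
  (* Recurrent nodes reachable from [t] lie in its component, hence are not accepting either; so
     reaching [t], of positive probability, entails rejection. *)
  have bt : bad t.
    by apply/forallP => u; apply/implyP => /andP[tu _]; rewrite (recurrent_accepting rt tu).
  have cellE : cell_of i' = cell_set b.
    apply/seteqP; split => c [/= lc rc]; split; rewrite ?lc ?li //=.
      exact: req_trans (req_sym ri) rc.
    exact: req_trans ri rc.
  have Pi : (0 < P (in_state 0 i'))%E by rewrite in_state0 // cellE.
  have Pt := reach_positive Pi it.
  have le0 : (P [set w | exists2 k, (0 <= k)%N & in_state k t w] <= P (~` accepted))%E.
    apply: ae_subset_le.
    - by apply: bigcup_measurable => k _; apply: measurable_in_state.
    - by apply: measurableC; exact: measurable_accepted.
    apply: (@filterS _ _ FF _ _ _ bad_rejects) => w Hw [k _ kt]; exact: Hw kt bt.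
  have := lt_le_trans Pt le0.
  by rewrite (probability_setC P measurable_accepted) P1 subee // ltxx.
apply/eqP; rewrite eq_le (probability_le1 P measurable_accepted) /=.
rewrite -(@probability_setT _ _ _ P); apply: ae_subset_le => //; first exact: measurable_accepted.
(* Finitely many nodes are possible at time 0, so those with uncharged cells can be discarded
   together. *)
have null : {ae P, forall w, forall i : state, state_at A M i = minit M ->
    in_state 0 i w -> (0 < mu (cell_of i))%E}.
  apply: (@filter_forall _ _ _ _ FF) => i.
  have [si|nsi] := pselect (state_at A M i = minit M); last by apply: aeW => w.
  have [mui|/negP] := boolP (0 < mu (cell_of i))%E; first by apply: aeW => w.
  move=> nmui; exists (in_state 0 i); split; first exact: measurable_in_state.
    rewrite in_state0 //; apply/eqP; rewrite eq_le measure_ge0 andbT leNgt.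
    exact/negP.
  by move=> w /= h; apply: contrapT => nh; apply: h => _ /nh.
apply: (@filterS2 _ _ FF _ _ _ _ null good_accepts) => w H1 H2 _.
have [i ci iw] := some_state w 0.
have si : state_at A M i = minit M by case: iw.
have /ch[b bs cellb] := H1 i si iw.
have [j [cj sj lj rj gj]] := H b bs.
have [/= lb rb] : cell_set b (w 0%N) by rewrite cellb; case: iw.
have ij : in_state 0 j w.
  split => /=; first by rewrite sj.
  by split; [rewrite /= lb lj|exact: req_trans (req_sym rj) rb].
exact: H2 ij gj.
Qed.

End reactive_chain.

Section decision_procedures.
Variables (R : realType) (AP : finType) (A : sta R AP) (M : muller AP).
Notation ca := (code_ta A).
Notation cm := (code_muller M).
Notation state := 'I_(nstates ca cm).
Notation graph := (@graph R AP A M).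

Lemma all_states P : all_below (nstates ca cm) P = [forall i : state, P i].
Proof.
apply/all_belowP/forallP => [H i|H i lti]; first exact: H.
exact: (H (Ordinal lti)).
Qed.

Lemma has_states P : has_below (nstates ca cm) P = [exists i : state, P i].
Proof.
apply/has_belowP/existsP => [[i lti Pi]|[i Pi]]; last by exists i.
by exists (Ordinal lti).
Qed.

Lemma subset_number (S : pred state) :
  exists2 s, (s < 2 ^ nstates ca cm)%N & forall i : state, bit s i = S i.
Proof.
pose v k := if insub k is Some i then nat_of_bool (S i) else 0%N.
have [|s sN Hs] := @mixed_radix 2 (nstates ca cm) v.
  by move=> k _; rewrite /v; case: insubP => // i _ _; case: (S i).
by exists s => // i; rewrite /bit Hs // /v valK eqb1.
Qed.

(** One direction tests the closed set of all descendants of i; the other follows a path inside an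
    arbitrary closed set. *)
Lemma reachcE (i j : state) : reachc ca cm i j = connect graph i j.
Proof.
apply/all_belowP/idP => [H|/connectP[p pip ->] s _].
  have [s sN sE] := subset_number (connect graph i).
  move: (H s sN); rewrite !sE connect0 /= => /implyP; apply.
  rewrite /closedc all_states; apply/forallP => k; rewrite all_states sE.
  apply/implyP => ik; apply/forallP => l; apply/implyP => kl; rewrite sE.
  exact: connect_trans ik (@connect1 _ graph k l kl).
rewrite /closedc all_states; apply/implyP => /forallP cl.
elim: p i pip => [|k p IH] i /=; first by rewrite implybb.
move=> /andP[ik /IH Hk]; apply/implyP => si; apply: (implyP Hk).
by have := cl i; rewrite si all_states => /forallP/(_ k)/implyP; apply.
Qed.

Lemma reccE (t : state) : recc ca cm t = recurrent graph t.
Proof. by rewrite /recc all_states; apply: eq_forallb => u; rewrite !reachcE. Qed.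

Lemma acceptcE (t : state) : acceptc ca cm t = accepting t.
Proof.
rewrite /acceptc finalE exl_code has_map nstateE.
set C := finset (fun q => [exists u, connect graph t u && (state_at A M u == q)]).
have H F : all_below #|mstate M| (fun s => memc s (code_set F) == has_below (nstates ca cm)
    (fun u => reachc ca cm t u && (statec ca cm u == s))) = (F == C).
  rewrite all_below_enum; apply/forallP/eqP => [H|-> s].
    apply/setP => s; rewrite !inE -memc_set (eqP (H s)) has_states.
    by apply: eq_existsb => u; rewrite reachcE -code_state_at (inj_eq (@code_elt_inj _)).
  rewrite memc_set inE has_states; apply/eqP; apply: eq_existsb => u.
  by rewrite reachcE -code_state_at (inj_eq (@code_elt_inj _)).
rewrite /accepting -/C; apply/hasP/idP => [[F FM]|CM].
  by rewrite /= H => /eqP <-; rewrite mem_enum in FM.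
by exists C; rewrite ?mem_enum //= H.
Qed.

Lemma goodcE (i : state) : goodc ca cm i = good i.
Proof. by rewrite /goodc all_states; apply: eq_forallb => t; rewrite reachcE reccE acceptcE. Qed.

Lemma badcE (i : state) : badc ca cm i = bad i.
Proof. by rewrite /badc all_states; apply: eq_forallb => t; rewrite reachcE reccE acceptcE. Qed.

Lemma cell_goodcP (b : cell A) : reflect (good_cell M b) (cell_goodc ca cm (code_cell b)).
Proof.
rewrite /cell_goodc has_states /code_cell lftE rgtE maxcE nclockE init_stateE.
apply: (iffP existsP) => -[i].
  rewrite -code_state_at -code_loc_at valcE !(inj_eq (@code_elt_inj _)) goodcE.
  by move=> /and5P[ci /eqP si /eqP li /(equivcP R) ri gi]; exists i.
move=> [ci si li ri gi]; exists i.
rewrite -code_state_at -code_loc_at valcE !(inj_eq (@code_elt_inj _)) goodcE.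
by rewrite ci si li gi !eqxx andbT; apply/(equivcP R).
Qed.

Lemma surecP (s : seq (cell A)) : reflect (forall b, b \in s -> good_cell M b)
  (surec (code_seq [:: ca; cm; code_seq [seq code_cell b | b <- s]])).
Proof.
rewrite /surec !nthc_code //= alll_code all_map.
apply: (iffP allP) => H b bs; apply/cell_goodcP; exact: H.
Qed.

End decision_procedures.

(** * Approximation *)

Section rational_codes.
Variable R : realType.

Definition ratc (p : nat) : R := (nnrat R p)%:num.

Lemma ratcE p : ratc p = (lft p)%:R / (rgt p).+1%:R. Proof. by []. Qed.

Lemma ratc0 : ratc (pairn 0 0) = 0. Proof. by rewrite ratcE lftE mul0r. Qed.

Lemma ratcD p q : ratc (add_frac p q) = ratc p + ratc q.
Proof.
rewrite !ratcE /add_frac lftE rgtE prednK ?muln_gt0 // !natrD !natrM.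
by field; rewrite !nat1r !pnatr_eq0.
Qed.

Lemma ratc_precision a m k e : (0 < nseqs a m k)%N ->
  ratc (precision a m k e) = ratc e / (4 * (nseqs a m k)%:R).
Proof.
move=> N0; rewrite !ratcE /precision lftE rgtE prednK ?muln_gt0 // !natrM.
have : (nseqs a m k)%:R != 0 :> R by rewrite pnatr_eq0 -lt0n.
by move=> h; field; rewrite h nat1r pnatr_eq0.
Qed.

Lemma enoughE e acc : enough e acc =
  (1 <= ratc (lft acc) + ratc (rgt acc) + 3 / 4 * ratc e).
Proof.
rewrite /enough; set t := add_frac _ _.
have -> : ratc (lft acc) + ratc (rgt acc) + 3 / 4 * ratc e = ratc t.
  rewrite !ratcD [ratc (pairn _ _)]ratcE lftE rgtE prednK ?muln_gt0 // !natrM (ratcE e).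
  by field; rewrite nat1r pnatr_eq0.
by rewrite ratcE ler_pdivlMr ?ltr0n // mul1r ler_nat.
Qed.

Lemma add_answerE a m k n (h : nat -> nat) :
  let acc := iteri n (fun x b => add_answer a m k x b (h x)) (pairn (pairn 0 0) (pairn 0 0)) in
  ratc (lft acc) = \sum_(x < n | validc a m k x && goodc a m (digit a m x k)) ratc (h x) /\
  ratc (rgt acc) = \sum_(x < n | validc a m k x && badc a m (digit a m x k)) ratc (h x).
Proof.
elim: n => [|n [IH1 IH2]] /=; first by rewrite lftE rgtE !ratc0 !big_ord0.
rewrite {1 3}/add_answer lftE rgtE; split;
  rewrite big_mkcond big_ord_recr -big_mkcond /= -?IH1 -?IH2;
  by case: ifP => _; rewrite ?ratcD ?addr0.
Qed.

End rational_codes.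

Lemma digits_inj g n x y : (x < g ^ n)%N -> (y < g ^ n)%N ->
  (forall i, (i < n)%N -> x %/ g ^ i %% g = y %/ g ^ i %% g)%N -> x = y.
Proof.
elim: n x y => [|n IH] x y; first by rewrite expn0 !ltnS !leqn0 => /eqP-> /eqP->.
move=> xn yn H; have g0 : (0 < g)%N by move: xn; rewrite expnS; case: (g).
have := H 0%N (ltn0Sn n); rewrite !divn1 => xy.
rewrite (divn_eq x g) (divn_eq y g) xy (IH (x %/ g)%N (y %/ g)%N) //.
- by rewrite ltn_divLR // mulnC -expnS.
- by rewrite ltn_divLR // mulnC -expnS.
- by move=> i ii; rewrite -!divnMA -expnS; apply: H.
Qed.

Lemma sum_error (R : realType) n (C : pred 'I_n) (f g : 'I_n -> R) (r : R) : (0 < n)%N ->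
  0 <= r -> (forall i, `|f i - g i| <= r / n%:R) ->
  `|\sum_(i < n | C i) f i - \sum_(i < n | C i) g i| <= r.
Proof.
move=> n0 r0 H; rewrite -sumrB; apply: le_trans (ler_norm_sum _ _ _) _.
apply: (@le_trans _ _ (\sum_(i < n) r / n%:R)); last first.
  by rewrite sumr_const card_ord -[_ / _ *+ _]mulr_natr divfK // pnatr_eq0 -lt0n.
rewrite big_mkcond; apply: ler_sum => i _; case: ifP => // _.
by rewrite divr_ge0.
Qed.

Section approximation.
Variables (R : realType) (AP : finType) (A : sta R AP) (M : muller AP).
Variables (P : probability (path_space R A) R).
Notation ca := (code_ta A).
Notation cm := (code_muller M).
Notation state := 'I_(nstates ca cm).
Notation digit := (digit ca cm).

Lemma nstates_gt0 : (0 < nstates ca cm)%N.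
Proof. by rewrite /nstates nlocE nstateE !muln_gt0 loc_gt0 state_gt0 expn_gt0. Qed.

Lemma nseqs_gt0 k : (0 < nseqs ca cm k)%N.
Proof. by rewrite expn_gt0 nstates_gt0. Qed.

Lemma ltn_digit x i : (digit x i < nstates ca cm)%N.
Proof. by rewrite ltn_mod nstates_gt0. Qed.

Definition digit_state x i : state := Ordinal (ltn_digit x i).

Definition cylinder k x : set (path_space R A) :=
  [set w | forall i, (i <= k)%N -> cell_set (cell_at A M (digit x i)) (w i)].

Lemma measurable_cylinder k x : measurable (cylinder k x).
Proof.
have -> : cylinder k x = \bigcap_(i in [set i | (i <= k)%N])
    [set w : path_space R A | cell_set (cell_at A M (digit x i)) (w i)].
  by apply/seteqP; split => w H i; apply: H.
apply: bigcap_measurable => [|i _]; first by exists 0%N.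
by apply: measurable_coordinate; apply: measurable_cell.
Qed.

Lemma validcP k x : reflect
  [/\ forall i, (i <= k)%N -> canonc ca cm (digit x i), state_at A M (digit x 0) = minit M &
      forall i, (i < k)%N -> state_at A M (digit x i.+1) =
        mstep (state_at A M (digit x i)) (label (loc_at A (digit x i)))]
  (validc ca cm k x).
Proof.
rewrite /validc init_stateE -!code_state_at (inj_eq (@code_elt_inj _)).
apply: (iffP and3P) => -[H1 H2 H3]; split.
- by move=> i ik; apply: (all_belowP _ _ H1).
- exact/eqP.
- move=> i ik; have := all_belowP _ _ H3 i ik.
  by rewrite -code_loc_at -[X in stepc _ _ _ _ X]code_state_at stepcE => /eqP.
- by apply/all_belowP => i ik; apply: H1.
- exact/eqP.
apply/all_belowP => i ik.
by rewrite -code_loc_at -[X in stepc _ _ _ _ X]code_state_at stepcE H3.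
Qed.

Lemma cylinder_in_state k x w : validc ca cm k x -> cylinder k x w ->
  forall i, (i <= k)%N -> in_state i (digit_state x i) w.
Proof.
move=> /validcP[_ s0 sS] cw i ik; split; last exact: cw.
elim: i ik => [|i IH] ik //=.
rewrite sS // IH ?(ltnW ik) //; congr (mstep _ (label _)).
by have [] := cw i (ltnW ik).
Qed.

Lemma exists_cylinder k w :
  exists2 x, (x < nseqs ca cm k)%N & validc ca cm k x /\ cylinder k x w.
Proof.
pose s i := projT1 (cid2 (some_state M w i)).
have sP i : canonc ca cm (s i) /\ in_state i (s i) w.
  by rewrite /s; case: cid2.
have [|x xN xs] := @mixed_radix (nstates ca cm) k.+1 (fun i => s i).
  by move=> i _; apply: ltn_ord.
exists x => //; split; last by move=> i ik; rewrite /digit xs //; case: (sP i) => _ [].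
apply/validcP; split => [i ik||i ik].
- by rewrite /digit xs //; case: (sP i).
- by rewrite /digit xs //; case: (sP 0%N) => _ [<-].
- rewrite /digit (xs i.+1) // (xs i) ?leqW //; case: (sP i.+1) => _ [<- _] /=.
  by rewrite /label_word; case: (sP i) => _ [<- [/= -> _]].
Qed.

Lemma cylinder_unique k x y w : (x < nseqs ca cm k)%N -> (y < nseqs ca cm k)%N ->
  validc ca cm k x -> validc ca cm k y -> cylinder k x w -> cylinder k y w -> x = y.
Proof.
move=> xN yN vx vy cx cy; apply: digits_inj xN yN _ => i ik.
have [canx _ _] := validcP _ _ vx; have [cany _ _] := validcP _ _ vy.
have := @in_state_canonical _ _ A M i (digit_state x i) (digit_state y i) w (canx i ik) (cany i ik)
  (cylinder_in_state vx cx ik) (cylinder_in_state vy cy ik).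
by move=> /(congr1 val).
Qed.

(** Every run follows one and only one valid sequence, so the event is a disjoint union of
    cylinders, of which only the last node is tested. *)
Lemma sum_cylinders (G : pred state) (g : nat -> bool) k : (forall i : state, g i = G i) ->
  P [set w | exists2 i : state, canonc ca cm i && G i & in_state k i w] =
  (\sum_(x < nseqs ca cm k | validc ca cm k x && g (digit x k)) P (cylinder k x))%E.
Proof.
move=> gG; pose V := [pred x : 'I_(nseqs ca cm k) | validc ca cm k x && g (digit x k)].
rewrite -(@measure_bigsetU_ord_cond _ _ _ P _ V); first last.
- move=> x y /andP[vx _] /andP[vy _] [w [cx cy]].
  by apply: val_inj; apply: cylinder_unique vx vy cx cy.
- by move=> x _; apply: measurable_cylinder.
congr (P _); rewrite -bigcup_seq_cond; apply/seteqP; split => w.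
  move=> [i /andP[ci Gi] iw]; have [x xN [vx cx]] := exists_cylinder k w.
  have [canx _ _] := validcP _ _ vx.
  have E := @in_state_canonical _ _ A M k i (digit_state x k) w ci (canx k (leqnn k))
    iw (cylinder_in_state vx cx (leqnn k)).
  exists (Ordinal xN) => //=; rewrite mem_index_enum vx /=.
  by rewrite -[digit x k]/(nat_of_ord (digit_state x k)) -E gG.
move=> [x /= /andP[_ /andP[vx gx]] cx]; have [canx _ _] := validcP _ _ vx.
exists (digit_state x k); last exact: cylinder_in_state vx cx _ (leqnn k).
by rewrite canx //= -gG.
Qed.


Lemma amenable_answer (mu : probability (config R A) R) q k e x :
  numerically_amenable_by mu q -> markov_law mu P -> 0 < ratc R e ->
  exists n, run q (queryc ca cm k e x) n /\
    `|ratc R n - fine (P (cylinder k x))| <= ratc R e / 4 / (nseqs ca cm k)%:R.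
Proof.
move=> am law e0; have N0 := nseqs_gt0 k.
have p0 : 0 < (nnrat R (precision ca cm k e))%:num.
  by rewrite -[_%:num]/(ratc R _) ratc_precision // divr_gt0 // mulr_gt0 // ltr0n.
pose cell i := cell_at A M (digit x i).
(* Amenability takes a nonempty list of cells as head and tail: digit 0, then digits 1 to k. *)
have [n run_n err] := am P law (cell 0%N) (map cell (iota 1 k)) _ p0.
exists n; split.
  move: run_n; congr (run q (pairn _ _) _); rewrite mkl_code; congr code_seq.
  rewrite -[_ :: _]/(mkseq cell k.+1) /mkseq -map_comp; apply: eq_map => i /=.
  by rewrite code_cell_at.
move: err; rewrite size_map size_iota.
have -> : [set w : path_space R A | forall i, (i <= k)%N ->
    cell_set (nth (cell 0%N) (cell 0%N :: [seq cell i | i <- iota 1 k]) i) (w i)] = cylinder k x.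
  apply/seteqP; split => w H i ik; have := H i ik;
    by rewrite -[_ :: _]/(mkseq cell k.+1) nth_mkseq.
rewrite -[(nnrat R (precision _ _ _ _))%:num]/(ratc R _) ratc_precision //.
rewrite -[P _]fineK; last by apply: fin_num_measure; exact: measurable_cylinder.
by rewrite -EFinB abse_EFin lee_fin invfM mulrA.
Qed.

End approximation.

(** * The approximation algorithm *)

Definition estimate a m (h : nat -> nat -> nat) k :=
  iteri (nseqs a m k) (fun x acc => add_answer a m k x acc (h k x))
    (pairn (pairn 0 0) (pairn 0 0)).

Ltac cpt_ext ::= first [use3 nseqs cpt_nseqs | use5 queryc cpt_queryc].

Lemma estimation_program : exists p,
  forall (sub : nat -> nat -> Prop) a m e (h : nat -> nat -> nat),
  (forall k x, sub (queryc a m k e x) (h k x)) ->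
  (exists k, enough e (estimate a m h k)) ->
  exists2 k, enough e (estimate a m h k) &
    computes sub p (code_seq [:: a; m; e]) (lft (estimate a m h k)).
Proof.
(* The input of the loop is the pair of the original input and the prefix length k, as the search
   will supply it. *)
have [||||p Hp] := @loop_with_calls
  (fun env => nseqs (nthc (lft env) 0) (nthc (lft env) 1) (rgt env))
  (fun=> pairn (pairn 0 0) (pairn 0 0))
  (fun env x => queryc (nthc (lft env) 0) (nthc (lft env) 1) (rgt env) (nthc (lft env) 2) x)
  (fun env x acc ans => add_answer (nthc (lft env) 0) (nthc (lft env) 1) (rgt env) x acc ans).
- by cpt_go.
- exact: cpt_cst.
- by rewrite /cpt2; cpt_go.
- have : cpt (fun n => code_seq [:: nthc (lft (lft n)) 0; nthc (lft (lft n)) 1; rgt (lft n);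
    lft (rgt n); lft (rgt (rgt n)); rgt (rgt (rgt n))]) by rewrite /=; cpt_go.
  move=> /(cpt_comp cpt_add_answer); rewrite /cpt4; apply: eq_cpt => n.
  by rewrite !nthc_code.
have [||p' Hp'] := @search_with_calls p
  (fun env acc => enough (nthc (lft env) 2) acc) (fun env acc => lft acc).
- have : cpt (fun n => enough (nthc (lft (lft n)) 2) (rgt n)).
    by apply: (cpt_app2 cpt_enough); cpt_go.
  by [].
- by rewrite /cpt2; cpt_go.
exists p' => sub a m e h Hsub ex; set n := code_seq _.
have n0 : nthc n 0 = a by rewrite nthc_code.
have n1 : nthc n 1 = m by rewrite nthc_code.
have n2 : nthc n 2 = e by rewrite nthc_code.
have [||k] := Hp' sub (fun _ k => estimate a m h k) n.
- move=> k; have := Hp sub (h k) (pairn n k); rewrite lftE rgtE n0 n1 n2; apply.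
  by move=> i _; apply: Hsub.
- by have [k ek] := ex; exists k; rewrite lftE n2.
by rewrite lftE n2; exists k.
Qed.

Section estimation.
Variables (R : realType) (AP : finType) (A : sta R AP) (M : muller AP).
Variable (m : location A -> probability (nnreal R) R).
Hypothesis all_enabled : forall c : config R A, enabled_delays c = setT.
Hypothesis m_supp : forall l, full_support (m l).
Hypothesis m_law : forall l (v : valuation R A) D, measurable D -> delay_law (l, v) D = m l D.
Variables (mu : probability (config R A) R) (P : probability (path_space R A) R).
Hypothesis P_law : markov_law mu P.
Notation ca := (code_ta A).
Notation cm := (code_muller M).
Variables (e : nat) (h : nat -> nat -> nat).
Hypothesis e_gt0 : 0 < ratc R e.
Hypothesis hP : forall k x,
  `|ratc R (h k x) - fine (P (cylinder M k x))| <= ratc R e / 4 / (nseqs ca cm k)%:R.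
Notation S := (estimate ca cm h).

Lemma estimate_error k :
  `|ratc R (lft (S k)) - fine (P (good_at M k))| <= ratc R e / 4 /\
  `|ratc R (rgt (S k)) - fine (P (bad_at M k))| <= ratc R e / 4.
Proof.
have [-> ->] := add_answerE R ca cm k (nseqs ca cm k) (h k).
have H G (g : nat -> bool) : (forall i : 'I_(nstates ca cm), g i = G i) ->
    fine (P [set w | exists2 i : 'I_(nstates ca cm), canonc ca cm i && G i & in_state k i w]) =
    \sum_(x < nseqs ca cm k | validc ca cm k x && g (digit ca cm x k)) fine (P (cylinder M k x)).
  move=> gG; rewrite (sum_cylinders P k gG) -sum_fine // => x _.
  by apply: fin_num_measure; exact: measurable_cylinder.
rewrite (H _ _ (@goodcE R AP A M)) (H _ _ (@badcE R AP A M)).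
by split; (apply: sum_error => [||x]; [exact: nseqs_gt0|by rewrite divr_ge0 // ltW|exact: hP]).
Qed.

Lemma fine_limits k : fine (P (good_at M k)) <= fine (P (@accepted R AP A M)) /\
  fine (P (bad_at M k)) <= 1 - fine (P (@accepted R AP A M)).
Proof.
have macc := @measurable_accepted R AP A M.
have facc : P (@accepted R AP A M) \is a fin_num by apply: fin_num_measure.
have fin B : measurable B -> P B \is a fin_num by apply: fin_num_measure.
split.
  apply: fine_le => //; first by apply: fin; exact: measurable_good_at.
  exact: (good_at_le M all_enabled m_supp m_law P_law).
have <- : fine (P (~` @accepted R AP A M)) = 1 - fine (P (@accepted R AP A M)).
  by rewrite (probability_setC P macc) fineB.
apply: fine_le; [by apply: fin; exact: measurable_bad_at|by apply: fin; exact: measurableC|].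
exact: (bad_at_le M all_enabled m_supp m_law P_law).
Qed.

Lemma estimate_enough : exists k, enough e (S k).
Proof.
have r0 : 0 < ratc R e / 4 by rewrite divr_gt0.
have [k] := decided_limit M all_enabled m_supp m_law P_law r0.
rewrite -[P (good_at _ _)]fineK -1?[P (bad_at _ _)]fineK; first last.
- by apply: fin_num_measure; exact: measurable_good_at.
- by apply: fin_num_measure; exact: measurable_bad_at.
rewrite -EFinD lee_fin => H; exists k; rewrite (enoughE R).
have [] := estimate_error k; rewrite !ler_distl => /andP[H1 _] /andP[H2 _]; lra.
Qed.

(** Let p be the probability of acceptance and g, b the two estimates. Then g - e/4 <= p and p <= 1
    - b + e/4, which the test bounds by g + 3e/4 + e/4 = g + e. *)
Lemma estimate_accurate k : enough e (S k) ->
  (`|(ratc R (lft (S k)))%:E - P (@accepted R AP A M)| <= (ratc R e)%:E)%E.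
Proof.
rewrite -[P _]fineK; last by apply: fin_num_measure; exact: measurable_accepted.
rewrite -EFinB abse_EFin lee_fin (enoughE R) => H.
have [] := estimate_error k; rewrite !ler_distl => /andP[H1 H2] /andP[H3 H4].
have [H5 H6] := fine_limits k.
by apply/andP; split; lra.
Qed.

End estimation.

(** * Conclusion *)

Section initial.
Variables (R : realType) (AP : finType) (A : sta R AP) (M : muller AP).

Definition initial_cell : cell A := (loc0 A, [ffun=> 0%N]).

Lemma cell_set_equiv (b c : cell A) : b.1 = c.1 ->
  region_equiv (rat_valuation R b.2) (rat_valuation R c.2) -> cell_set (R := R) b = cell_set c.
Proof.
move=> bc rbc; apply/seteqP; split => g [/= lg rg]; split; rewrite ?lg //=.
  exact: req_trans (req_sym rbc) rg.
exact: req_trans rbc rg.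
Qed.

Lemma initial_config_cell : cell_set initial_cell (initial_config A).
Proof.
split => //=; rewrite region_equivE; apply: req_beyond => x; left.
by rewrite /clk /rat_valuation ffunE /real_of -[LHS]/(ratc R 0) -[0%N]/(pairn 0 0) ratc0.
Qed.

Lemma charged_initial : charged_cells (initial_distribution A) [:: initial_cell].
Proof.
move=> c; rewrite /initial_distribution /= diracE lte_fin ltr0n lt0b.
have [lI rI] := initial_config_cell.
split => [|[b]]; last first.
  by rewrite mem_seq1 => /eqP -> <-; rewrite mem_set //; exact: initial_config_cell.
rewrite inE => -[lc rc]; exists initial_cell; rewrite ?inE //.
apply: cell_set_equiv; first by rewrite -lI lc.
exact: req_trans rI (req_sym rc).
Qed.

Lemma initcE : initc (pairn (code_ta A) (code_muller M)) =
  code_seq [:: code_ta A; code_muller M; code_seq [seq code_cell c | c <- [:: initial_cell]]].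
Proof.
rewrite /initc lftE rgtE init_locE nclockE /code_cell /=.
congr (code_seq [:: _; _; code_seq [:: pairn _ _]]).
by apply: mkl_enum => x; rewrite ffunE.
Qed.

Lemma decide_almost_sure (mu : probability (config R A) R) s P :
  reactive A -> charged_cells mu s -> markov_law mu P ->
  (muller_prob P M == 1%E) =
  surec (code_seq [:: code_ta A; code_muller M; code_seq [seq code_cell c | c <- s]]).
Proof.
move=> [en [m Hm]] ch law.
have m_supp l := (Hm l).1; have m_law l := (Hm l).2.
have H := almost_sure_acceptance M en m_supp m_law law ch.
by apply/eqP/surecP => /H.
Qed.

End initial.

Theorem corollary67 :
  (* 1, from the initial configuration, and from an arbitrary initial
     distribution of which the charged cells are given *)
  ((exists p : program,
      forall (R : realType) (AP : finType) (A : sta R AP) (M : muller AP),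
      reactive A ->
      forall P, markov_law (initial_distribution A) P ->
        run p (pairn (code_ta A) (code_muller M))
              (nat_of_bool (muller_prob P M == 1%E))) /\
   (exists p : program,
      forall (R : realType) (AP : finType) (A : sta R AP) (M : muller AP),
      reactive A ->
      forall (mu : probability (config R A) R) (s : seq (cell A)),
      charged_cells mu s ->
      forall P, markov_law mu P ->
        run p (code_seq [:: code_ta A; code_muller M;
                            code_seq [seq code_cell c | c <- s]])
              (nat_of_bool (muller_prob P M == 1%E)))) /\
  (* 2, q being the algorithm witnessing numerical amenability *)
  (exists p : program,
     forall (R : realType) (AP : finType) (A : sta R AP) (M : muller AP),
     reactive A ->
     forall (mu : probability (config R A) R) (q : program),
     numerically_amenable_by mu q ->
     forall P, markov_law mu P ->
     forall e : nat, 0 < (nnrat R e)%:num ->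
       exists2 n,
         run_with q p (code_seq [:: code_ta A; code_muller M; e]) n &
         (`|(nnrat R n)%:num%:E - muller_prob P M| <= (nnrat R e)%:num%:E)%E).
Proof.
split; [split|].
- have [p Hp] := cpt_comp cpt_surec cpt_initc.
  exists p => R AP A M reac P law.
  rewrite (decide_almost_sure _ reac (@charged_initial _ _ A) law) -initcE.
  exact: Hp.
- have [p Hp] := cpt_surec; exists p => R AP A M reac mu s ch P law.
  by rewrite (decide_almost_sure _ reac ch law); apply: Hp.
have [p Hp] := estimation_program; exists p => R AP A M [en [m Hm]] mu q am P law e e0.
have m_supp l := (Hm l).1; have m_law l := (Hm l).2.
(* Amenability only asserts that some accurate answer exists for each query, so one is chosen for
   every length and sequence. *)
have [h hP] := choice (fun kx : nat * nat =>
  @amenable_answer R AP A M P mu q kx.1 e kx.2 am law e0).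
pose h' k x := h (k, x).
have hrun k x : run q (queryc (code_ta A) (code_muller M) k e x) (h' k x) := (hP (k, x)).1.
have herr k x := (hP (k, x)).2.
have ex := estimate_enough en m_supp m_law law e0 (h := h') herr.
have [k ek run_p] := Hp (run q) _ _ _ _ hrun ex.
exists (lft (estimate (code_ta A) (code_muller M) h' k)); first exact: run_p.
exact: (estimate_accurate en m_supp m_law law e0 herr ek).
Qed.
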